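(* Let $q\in\mathbb C$, $0<|q|<1$, and let $\kappa=(\kappa_0,\kappa_t,\kappa_1,\kappa_\infty)\in(\mathbb C^* )^4$, $t_0\in\mathbb C^*$ satisfy the non-resonance conditions. Denote by $\widehat\kappa=(1,\kappa_t,\kappa_1,\kappa_\infty)$ the tuple $\kappa$ after replacing $\kappa_0\mapsto1$. Then the image of the monodromy manifold $\mathcal M(\kappa,t_0)$ under the mapping $\mathcal P:\mathcal M(\kappa,t_0)\to(\mathbb P^1)^4/\mathbb C^*$, $[C(z)]\mapsto[\rho]$, is the surface $\mathcal S(\kappa,t_0)$ minus the curve $$\mathcal X(\kappa,t_0):=\mathcal S(\kappa,t_0)\cap\mathcal S(\widehat\kappa,t_0).$$ Writing $\mathcal S^*(\kappa,t_0)=\mathcal S(\kappa,t_0)\setminus\mathcal X(\kappa,t_0)$, the mapping $$\mathcal M(\kappa,t_0)\to\mathcal S^*(\kappa,t_0),\qquad [C(z)]\mapsto\mathcal P([C(z)]),$$ is a bijection.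
   Context: **Notation.** $(z;q)_\infty=\prod_{k\ge0}(1-q^kz)$, $\theta_q(z)=(z;q)_\infty(q/z;q)_\infty$, $\theta_q(z_1,\dots,z_n)=\prod_j\theta_q(z_j)$, $\sigma_3=\mathrm{diag}(1,-1)$, $|M|=\det M$, $q^{\mathbb Z}=\{q^n:n\in\mathbb Z\}$, $\mathbb P^1=\mathbb{CP}^1$. **Non-resonance conditions.** $\kappa_0^2,\kappa_t^2,\kappa_1^2,\kappa_\infty^2\notin q^{\mathbb Z}$ and $(\kappa_t\kappa_1)^{\pm1},(\kappa_t/\kappa_1)^{\pm1}\notin t_0q^{\mathbb Z}$. **Monodromy manifold.** $\mathfrak C(\kappa,t_0)$ is the set of $2\times2$ matrix functions $C(z)$ that are (1) single-valued and analytic on $\mathbb C^*$; (2) satisfy $C(qz)=t_0z^{-2}\kappa_0^{\sigma_3}C(z)\kappa_\infty^{-\sigma_3}$; (3) satisfy $|C(z)|=c\,\theta_q(\kappa_tz/t_0,\kappa_t^{-1}z/t_0,\kappa_1z,\kappa_1^{-1}z)$ for some $c\in\mathbb C^*$. $\mathcal M(\kappa,t_0)$ is the quotient of $\mathfrak C(\kappa,t_0)$ by arbitrary left- and right-multiplication by invertible diagonal matrices; $[C(z)]$ is the class of $C(z)$. **Coordinates and the map $\mathcal P$.** For a $2\times2$ matrix $R$ of rank one with columns $R_1,R_2$, define $\pi(R)\in\mathbb P^1$ by $R_1=\pi(R)R_2$, with $\pi(R)=0$ iff $R_1=0$ and $\pi(R)=\infty$ iff $R_2=0$. Let $(x_1,x_2,x_3,x_4)=(\kappa_tt_0,\kappa_t^{-1}t_0,\kappa_1,\kappa_1^{-1})$.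 For $C\in\mathfrak C(\kappa,t_0)$ each $C(x_k)$ has rank one; set $\rho_k=\pi(C(x_k))$, $1\le k\le4$, $\rho=(\rho_1,\rho_2,\rho_3,\rho_4)$. Left-multiplication of $C$ by diagonal matrices leaves $\rho$ invariant, right-multiplication scales $\rho\mapsto c\rho$, $c\in\mathbb C^*$. $(\mathbb P^1)^4/\mathbb C^*$ is the quotient by this scalar multiplication, and $\mathcal P([C(z)])=[\rho]$. **The polynomial $T$ and the surface $\mathcal S$.** $T(\rho:\kappa,t_0)=\sum_{1\le i<j\le4}T_{ij}\rho_i\rho_j$ with $$\begin{aligned} T_{12}&=\theta_q(\kappa_t^2,\kappa_1^2)\,\theta_q(\kappa_0\kappa_\infty^{-1}t_0,\kappa_0^{-1}\kappa_\infty^{-1}t_0)\,\kappa_\infty^2,\\ T_{34}&=\theta_q(\kappa_t^2,\kappa_1^2)\,\theta_q(\kappa_0\kappa_\infty t_0,\kappa_0^{-1}\kappa_\infty t_0),\\ T_{13}&=-\theta_q(\kappa_t\kappa_1^{-1}t_0,\kappa_t^{-1}\kappa_1t_0)\,\theta_q(\kappa_t\kappa_1\kappa_0^{-1}\kappa_\infty^{-1},\kappa_0\kappa_t\kappa_1\kappa_\infty^{-1})\,\kappa_\infty^2,\\ T_{24}&=-\theta_q(\kappa_t\kappa_1^{-1}t_0,\kappa_t^{-1}\kappa_1t_0)\,\theta_q(\kappa_0\kappa_t\kappa_1\kappa_\infty,\kappa_t\kappa_1\kappa_\infty\kappa_0^{-1}),\\ T_{14}&=\theta_q(\kappa_t\kappa_1t_0,\kappa_t^{-1}\kappa_1^{-1}t_0)\,\theta_q(\kappa_1\kappa_\infty\kappa_0^{-1}\kappa_t^{-1},\kappa_0\kappa_1\kappa_\infty\kappa_t^{-1})\,\kappa_t^2,\\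 T_{23}&=\theta_q(\kappa_t\kappa_1t_0,\kappa_t^{-1}\kappa_1^{-1}t_0)\,\theta_q(\kappa_t\kappa_\infty\kappa_0^{-1}\kappa_1^{-1},\kappa_0\kappa_t\kappa_\infty\kappa_1^{-1})\,\kappa_1^2. \end{aligned}$$ In homogeneous coordinates $\rho_k=[\rho_k^x:\rho_k^y]$, the equation $T(\rho:\kappa,t_0)=0$ on $(\mathbb P^1)^4$ means $T_{hom}=0$ with $T_{hom}=\rho_1^y\rho_2^y\rho_3^y\rho_4^y\,T\big(\tfrac{\rho_1^x}{\rho_1^y},\tfrac{\rho_2^x}{\rho_2^y},\tfrac{\rho_3^x}{\rho_3^y},\tfrac{\rho_4^x}{\rho_4^y}:\kappa,t_0\big)$ (a multihomogeneous polynomial). It is invariant under scalar multiplication, and $\mathcal S(\kappa,t_0)=\{[\rho]\in(\mathbb P^1)^4/\mathbb C^*:T(\rho:\kappa,t_0)=0\}$. $\mathcal S(\widehat\kappa,t_0)$ is defined by the same formulas with $\kappa_0$ replaced by $1$. *)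

(* Defs.v *)
From HB Require Import structures.
From mathcomp Require Import all_boot all_order all_algebra.
From mathcomp Require Import all_classical all_reals topology normedtype derive.
From mathcomp Require Export complex.

Set Implicit Arguments.
Unset Strict Implicit.
Unset Printing Implicit Defensive.

Import Order.TTheory GRing.Theory Num.Theory.
Import numFieldNormedType.Exports.

Local Open Scope classical_set_scope.
Local Open Scope ring_scope.

Section Theta.
Variables (R : realType) (q : R[i]).

(* The topology on the complex numbers is the one carried by R[i]^o. *)
Definition qPochhammer (z : R[i]) : R[i] :=
  lim ((\prod_(0 <= k < n) (1 - q ^+ k * z) : R[i]^o) @[n --> \oo]).

Definition theta (z : R[i]) : R[i] := qPochhammer z * qPochhammer (q / z).

Definition thetas (s : seq R[i]) : R[i] := \prod_(z <- s) theta z.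

Definition qZ : set R[i] := range (fun n : int => q ^ n).

End Theta.

Record params (K : Type) : Type :=
  Params { k0 : K; kt : K; k1 : K; kinf : K }.

Definition hat (R : realType) (kappa : params R[i]) : params R[i] :=
  Params 1 (kt kappa) (k1 kappa) (kinf kappa).

Definition nonresonant (R : realType) (q : R[i]) (kappa : params R[i])
    (t0 : R[i]) : Prop :=
  let t0qZ := [set t0 * x | x in qZ q] in
  [/\ [/\ ~ qZ q (k0 kappa ^+ 2), ~ qZ q (kt kappa ^+ 2),
          ~ qZ q (k1 kappa ^+ 2) & ~ qZ q (kinf kappa ^+ 2)],
      ~ t0qZ (kt kappa * k1 kappa), ~ t0qZ (kt kappa * k1 kappa)^-1,
      ~ t0qZ (kt kappa / k1 kappa) & ~ t0qZ (kt kappa / k1 kappa)^-1].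

Section MonodromyManifold.
Variables (R : realType) (q : R[i]) (kappa : params R[i]) (t0 : R[i]).

(* a ^ sigma_3 with sigma_3 = diag(1, -1); thus a ^ (- sigma_3) is
   pow_sigma3 a^-1. *)
Definition pow_sigma3 (a : R[i]) : 'M[R[i]]_2 :=
  diag_mx (\row_j if j == 0 then a else a^-1).

(* Complex differentiability of every entry at every point of C^*. *)
Definition analytic_Cstar (C : R[i] -> 'M[R[i]]_2) : Prop :=
  forall (i j : 'I_2) (z : R[i]), z != 0 ->
    derivable ((fun w => C w i j) : R[i]^o -> R[i]^o) z 1.

(* Matrix functions on C^* are represented by total functions whose value at 0
   is junk: no condition below involves it, and diag_equiv ignores it. *)
Definition connection_matrix (C : R[i] -> 'M[R[i]]_2) : Prop :=
  [/\ analytic_Cstar C,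
      forall z : R[i], z != 0 ->
        C (q * z) = (t0 * z ^- 2) *:
          (pow_sigma3 (k0 kappa) *m C z *m pow_sigma3 (kinf kappa)^-1) &
      exists2 c : R[i], c != 0 & forall z : R[i], z != 0 ->
        \det (C z) = c * thetas q [:: kt kappa * z / t0; (kt kappa)^-1 * z / t0;
                                      k1 kappa * z; (k1 kappa)^-1 * z]].

Definition diag_equiv (C C' : R[i] -> 'M[R[i]]_2) : Prop :=
  exists D1 D2 : 'M[R[i]]_2,
    [/\ is_diag_mx D1 && (D1 \in unitmx), is_diag_mx D2 && (D2 \in unitmx) &
        forall z : R[i], z != 0 -> C' z = D1 *m C z *m D2].

Definition diag_class (C : R[i] -> 'M[R[i]]_2) : set (R[i] -> 'M[R[i]]_2) :=
  [set C' | diag_equiv C C'].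

Definition monodromy_manifold : set (set (R[i] -> 'M[R[i]]_2)) :=
  [set diag_class C | C in connection_matrix].

End MonodromyManifold.

(* The projective line C \cup {oo}: Some z is [z : 1] and None is [1 : 0]. *)
Definition P1 (K : Type) : Type := option K.

Section ProjectiveCoordinates.
Variable R : realType.

Definition hom_x (p : P1 R[i]) : R[i] := if p is Some z then z else 1.
Definition hom_y (p : P1 R[i]) : R[i] := if p is Some _ then 1 else 0.

Definition scale_P1 (c : R[i]) (p : P1 R[i]) : P1 R[i] := omap ( *%R c) p.

Definition scale_class (rho : 'I_4 -> P1 R[i]) : set ('I_4 -> P1 R[i]) :=
  [set rho' | exists2 c : R[i], c != 0 & forall k, rho' k = scale_P1 c (rho k)].

Definition is_column_ratio (M : 'M[R[i]]_2) (p : P1 R[i]) : Prop :=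
  if p is Some a then col 0 M = a *: col 1 M else col 1 M = 0.

(* For M of rank one exactly one p satisfies is_column_ratio M p; the value of
   column_ratio at other matrices is irrelevant. *)
Definition column_ratio (M : 'M[R[i]]_2) : P1 R[i] :=
  xget None (is_column_ratio M).

End ProjectiveCoordinates.

Section Coordinates.
Variables (R : realType) (q : R[i]) (kappa : params R[i]) (t0 : R[i]).

(* The index k : 'I_4 stands for the mathematical index k + 1. *)
Definition xpt : 4.-tuple R[i] :=
  [tuple kt kappa * t0; (kt kappa)^-1 * t0; k1 kappa; (k1 kappa)^-1].

Definition rho_of (C : R[i] -> 'M[R[i]]_2) : 'I_4 -> P1 R[i] :=
  fun k => column_ratio (C (tnth xpt k)).

(* The image of a class X is the union of the classes [rho_of C], C in X. *)
Definition Pmap (X : set (R[i] -> 'M[R[i]]_2)) : set ('I_4 -> P1 R[i]) :=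
  \bigcup_(C in X) scale_class (rho_of C).

End Coordinates.

Section Surface.
Variables (R : realType) (q : R[i]) (kappa : params R[i]) (t0 : R[i]).

Definition Tcoef (i j : nat) : R[i] :=
  let: Params k0 kt k1 ki := kappa in
  match i, j with
  | 1, 2 => thetas q [:: kt ^+ 2; k1 ^+ 2]
            * thetas q [:: k0 * ki^-1 * t0; k0^-1 * ki^-1 * t0] * ki ^+ 2
  | 3, 4 => thetas q [:: kt ^+ 2; k1 ^+ 2]
            * thetas q [:: k0 * ki * t0; k0^-1 * ki * t0]
  | 1, 3 => - thetas q [:: kt * k1^-1 * t0; kt^-1 * k1 * t0]
            * thetas q [:: kt * k1 * k0^-1 * ki^-1; k0 * kt * k1 * ki^-1]
            * ki ^+ 2
  | 2, 4 => - thetas q [:: kt * k1^-1 * t0; kt^-1 * k1 * t0]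
            * thetas q [:: k0 * kt * k1 * ki; kt * k1 * ki * k0^-1]
  | 1, 4 => thetas q [:: kt * k1 * t0; kt^-1 * k1^-1 * t0]
            * thetas q [:: k1 * ki * k0^-1 * kt^-1; k0 * k1 * ki * kt^-1]
            * kt ^+ 2
  | 2, 3 => thetas q [:: kt * k1 * t0; kt^-1 * k1^-1 * t0]
            * thetas q [:: kt * ki * k0^-1 * k1^-1; k0 * kt * ki * k1^-1]
            * k1 ^+ 2
  | _, _ => 0
  end.

(* The multihomogenisation of T in the coordinates rho_k = [x k : y k]. *)
Definition Thom (x y : 'I_4 -> R[i]) : R[i] :=
  \sum_(i < 4) \sum_(j < 4 | (i < j)%N)
    Tcoef i.+1 j.+1 * x i * x j * \prod_(k < 4 | (k != i) && (k != j)) y k.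

Definition T_zero (rho : 'I_4 -> P1 R[i]) : Prop :=
  Thom (fun k => hom_x (rho k)) (fun k => hom_y (rho k)) = 0.

Definition surface : set (set ('I_4 -> P1 R[i])) :=
  [set scale_class rho | rho in T_zero].

End Surface.

Definition curve (R : realType) (q : R[i]) (kappa : params R[i]) (t0 : R[i]) :
    set (set ('I_4 -> P1 R[i])) :=
  surface q kappa t0 `&` surface q (hat kappa) t0.

Definition surface_star (R : realType) (q : R[i]) (kappa : params R[i])
    (t0 : R[i]) : set (set ('I_4 -> P1 R[i])) :=
  surface q kappa t0 `\` curve q kappa t0.

(* Main.v *)
(* Each row (f, g) of C solves the linear system f(x_k) = rho_k g(x_k), 1 <= k <= 4,
   in a four-dimensional space of pairs of theta functions of degree two, and the
   determinant of this system is a nonzero multiple of T(rho : kappa, t0). The wedge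
   f1 g2 - f2 g1 of solutions of the systems for kappa_0 = s and kappa_0 = s' is a
   theta function of degree four vanishing at x_1, ..., x_4: it is a constant
   multiple of |C| if s s' = 1, and it vanishes if s s' is not in q^Z. For the rows
   of two matrices with the same rho this yields injectivity; for a row of C and a
   row for kappa_0 = 1 it shows that T(rho : hat kappa, t0) <> 0 on the image.
   Conversely, a zero rho of T provides rows for kappa_0 and 1 / kappa_0. If their
   wedge vanished although T(rho : hat kappa, t0) <> 0, then taking wedges with the
   dual solutions of the nonsingular system for kappa_0 = 1 would give one of the
   rows too many zeros.

   That a theta function is determined by its zeros up to a constant comes from
   Liouville's theorem: its quotient by a product of functions theta(z / p) is
   quasi-periodic, hence after multiplication by a power of z it extends to an
   entire function which is o(z^2) at infinity. Only complex differentiability is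
   given, so Goursat's bisection argument is needed; points where the quotient is
   merely continuous are harmless in it. *)
Require Import Defs.
From mathcomp Require Import all_boot all_order all_algebra.
From mathcomp Require Import all_classical all_reals topology normedtype derive.
From mathcomp Require Import sequences measure lebesgue_measure lebesgue_integral exp.
From mathcomp Require Import ring lra.

Set Implicit Arguments.
Unset Strict Implicit.
Unset Printing Implicit Defensive.

Import Order.TTheory GRing.Theory Num.Theory.
Import numFieldNormedType.Exports.
Import ComplexField.Normc.

Local Open Scope classical_set_scope.
Local Open Scope ring_scope.

(** * Complex differentiability *)

(** The value $1$ of $\kappa_0$ is a neutral comparison: since $\kappa_0^2\notin q^{\mathbb Z}$,
    also $\kappa_0^{\pm1}\cdot1\notin q^{\mathbb Z}$, so a row for $1$ has vanishing wedge with both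
    rows of [C]; as these are independent, it is zero. The symmetry of $T$ under
    $\kappa_0\mapsto1/\kappa_0$ is the reason why one zero of $T$ yields both rows.

    The count behind too many zeros: a nonzero theta function of degree two has two zeros modulo
    $q^{\mathbb Z}$, and its multiplier prescribes their product. If the rows $f$ and $g$ were
    parallel, then for each $k$ either $f$ vanishes at $x_k$, or $f$ vanishes at $\kappa_0x_k$ and
    $g$ at $x_k/\kappa_0$. Three indices of the first kind, or two of the second, contradict the
    prescribed products, and four indices always contain one of these configurations.

    Non-resonance enters as follows: the conditions on $\kappa_t$, $\kappa_1$, $t_0$ separate the
    $x_k$ modulo $q^{\mathbb Z}$, the one on $\kappa_0$ separates the two rows, and the one on
    $\kappa_\infty$ the two entries of a row. *)

Section HoloAlgebra.
Variable K : numFieldType.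
Implicit Types (z w : K) (f g : K -> K).

(** The record keeps continuity for the topology of [K^o] folded, so that unification meets only
    [ccont]. *)
Record ccont f z : Prop := CCont { ccontW : {for z, continuous (f : K^o -> K^o)} }.

Lemma ccont_cst c z : ccont (fun=> c) z.
Proof. by split; exact: cst_continuous. Qed.

Lemma ccont_id z : ccont id z.
Proof. by split. Qed.

Lemma ccontD f g z : ccont f z -> ccont g z -> ccont (fun w => f w + g w) z.
Proof. by move=> [cf] [cg]; split; exact: (@continuousD K K^o K^o). Qed.

Lemma ccontN f z : ccont f z -> ccont (fun w => - f w) z.
Proof. by move=> [cf]; split; exact: (@continuousN K K^o K^o). Qed.

Lemma ccontB f g z : ccont f z -> ccont g z -> ccont (fun w => f w - g w) z.
Proof. by move=> [cf] [cg]; split; exact: (@continuousB K K^o K^o). Qed.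

Lemma ccontM f g z : ccont f z -> ccont g z -> ccont (fun w => f w * g w) z.
Proof. by move=> [cf] [cg]; split; exact: (@continuousM K K^o). Qed.

Lemma ccontV f z : f z != 0 -> ccont f z -> ccont (fun w => (f w)^-1) z.
Proof. by move=> fz [cf]; split; apply: (@cvgV K K^o (nbhs (z : K^o)) _ f (f z)). Qed.

Lemma ccont_comp f g z : ccont g z -> ccont f (g z) -> ccont (f \o g) z.
Proof. by move=> [cg] [cf]; split; exact: (@continuous_comp K^o K^o K^o). Qed.

Lemma ccontP f z : ccont f z <-> forall e : K, 0 < e -> exists2 d : K, 0 < d &
    forall w, `|w - z| < d -> `|f w - f z| < e.
Proof.
split.
- move=> [cf] e e0.
  have /(@cvgrPdist_lt K K^o K^o (nbhs (z : K^o)) _ f (f z)) /(_ e e0) := cf.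
  move=> /nbhs_ballP [d /= d0 H]; exists d => // w wz; rewrite distrC; apply: H.
  by rewrite -ball_normE /= distrC.
- move=> H; split.
  apply/(@cvgrPdist_lt K K^o K^o (nbhs (z : K^o)) _ f (f z)) => e e0.
  have [d d0 Hd] := H _ e0.
  apply/nbhs_ballP; exists d => // w.
  by rewrite -ball_normE /= distrC => wd; rewrite distrC; apply: Hd.
Qed.

(* Caratheodory's form of complex differentiability: the quotient (extended by
   the derivative) is a continuous function. *)
Definition cdiff f z (phi : K -> K) :=
  ccont phi z /\
  forall w, f w = f z + phi w * (w - z).

Definition holo_at f z := exists phi, cdiff f z phi.

(** [analytic_Cstar] is stated with [derivable]; this is the passage to the Caratheodory form, where
    the difference quotient is completed at [z] by the derivative. *)
Lemma holo_atP f z : holo_at f z <-> derivable (f : K^o -> K^o) z 1.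
Proof.
split.
- move=> [phi [cphi fE]].
  apply/cvg_ex; exists (phi z).
  apply/cvgrPdist_lt => e e0.
  have /ccontP /(_ _ e0) [d d0 Hd] := cphi.
  rewrite near_withinE; apply/nbhs_ballP; exists d => // h.
  rewrite -ball_normE /= sub0r normrN => hd h0.
  have hE : h *: (1 : K^o) = h by exact: mulr1.
  rewrite distrC hE [f (h + z)]fE.
  have -> : h^-1 *: ((f z + phi (h + z) * (h + z - z) - f z) : K^o) = phi (h + z).
    by rewrite addrK addrAC subrr add0r [LHS]mulrC mulfK.
  by apply: Hd; rewrite addrK.
- move=> /cvg_ex [l Hl].
  exists (fun w => if w == z then l else (f w - f z) / (w - z)); split; last first.
    move=> w; case: eqVneq => [->|wz]; first by rewrite subrr mulr0 addr0.
    by rewrite divfK ?subr_eq0 // addrC subrK.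
  apply/ccontP => e e0.
  have /cvgrPdist_lt /(_ e e0) := Hl.
  rewrite near_withinE => /nbhs_ballP [d /= d0 H]; exists d => // w wz.
  rewrite eqxx; have [_|wnz] := eqVneq w z; first by rewrite subrr normr0.
  have : ball (0 : K^o) d (w - z) by rewrite -ball_normE /= sub0r normrN.
  move/H => /= /(_ _)/wrap[]; first by rewrite subr_eq0.
  have hE : (w - z) *: (1 : K^o) = w - z by exact: mulr1.
  by rewrite distrC hE subrK [_ *: _]mulrC.
Qed.

Lemma holo_ccont f z : holo_at f z -> ccont f z.
Proof.
move=> [phi [cphi fE]].
have -> : f = (fun w => f z + phi w * (w - z)) by apply/funext.
apply: ccontD; first exact: ccont_cst.
by apply: (ccontM cphi); apply: ccontB; [exact: ccont_id|exact: ccont_cst].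
Qed.

Lemma ccont_near f g z (d : K) : 0 < d ->
  (forall w, `|w - z| < d -> f w = g w) -> ccont f z -> ccont g z.
Proof.
move=> d0 fg /ccontP cf; apply/ccontP => e e0.
have [r r0 Hr] := cf _ e0.
have [m m0 mE] : exists2 m : K, 0 < m & (m <= r) && (m <= d).
  have /orP[rd|dr] := real_leVge (gtr0_real r0) (gtr0_real d0).
    by exists r => //; rewrite lexx.
  by exists d => //; rewrite lexx andbT.
exists m => // w wm; case/andP: mE => /(lt_le_trans wm) wr /(lt_le_trans wm) wd.
by rewrite -!fg ?Hr // subrr normr0.
Qed.

Lemma ccont_neq0 f z : ccont f z -> f z != 0 ->
  exists2 d : K, 0 < d & forall w, `|w - z| < d -> f w != 0.
Proof.
move=> /ccontP cf fz; have /cf [d d0 H] : 0 < `|f z| by rewrite normr_gt0.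
exists d => // w /H; apply: contraTN => /eqP ->.
by rewrite sub0r normrN ltxx.
Qed.

Lemma holo_cst c z : holo_at (fun=> c) z.
Proof.
exists (fun=> 0); split; first exact: ccont_cst.
by move=> w; rewrite mul0r addr0.
Qed.

Lemma holo_id z : holo_at id z.
Proof.
exists (fun=> 1); split; first exact: ccont_cst.
by move=> w; rewrite mul1r addrC subrK.
Qed.

Lemma holoD f g z : holo_at f z -> holo_at g z -> holo_at (fun w => f w + g w) z.
Proof.
move=> [p [cp fE]] [r [cr gE]]; exists (fun w => p w + r w); split.
  exact: ccontD.
by move=> w; rewrite [f w]fE [g w]gE; ring.
Qed.

Lemma holoM f g z : holo_at f z -> holo_at g z -> holo_at (fun w => f w * g w) z.
Proof.
move=> hf hg; have cg := holo_ccont hg.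
move: hf hg => [p [cp fE]] [r [cr gE]].
exists (fun w => p w * g w + f z * r w); split.
  exact: (ccontD (ccontM cp cg) (ccontM (ccont_cst (f z) z) cr)).
by move=> w; rewrite [f w]fE [g w]gE; ring.
Qed.

Lemma holoN f z : holo_at f z -> holo_at (fun w => - f w) z.
Proof.
move=> [p [cp fE]]; exists (fun w => - p w); split; first exact: ccontN.
by move=> w; rewrite [f w]fE; ring.
Qed.

Lemma holoB f g z : holo_at f z -> holo_at g z -> holo_at (fun w => f w - g w) z.
Proof. by move=> hf hg; apply: holoD => //; exact: holoN. Qed.

(** The identity in [cdiff] is required for every [w], also far from [z]; hence the quotient is
    rebuilt from the values of [g], and only its continuity at [z] is inherited. *)
Lemma holo_near f g z (d : K) : 0 < d ->
  (forall w, `|w - z| < d -> f w = g w) -> holo_at f z -> holo_at g z.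
Proof.
move=> d0 fg [p [cp fE]].
have fgz : f z = g z by apply: fg; rewrite subrr normr0.
exists (fun w => if w == z then p z else (g w - g z) / (w - z)); split.
  apply: (ccont_near d0 _ cp) => w wd; have [-> //|wz] := eqVneq w z.
  by rewrite -fgz -fg // [f w]fE addrAC subrr add0r mulfK // subr_eq0.
move=> w; have [->|wz] := eqVneq w z; first by rewrite subrr mulr0 addr0.
by rewrite divfK ?subr_eq0 // addrC subrK.
Qed.

Lemma holoV f z : f z != 0 -> holo_at f z -> holo_at (fun w => (f w)^-1) z.
Proof.
move=> fz hf; have cf := holo_ccont hf; move: hf => [p [cp fE]].
have [d d0 fn0] := ccont_neq0 cf fz.
(* This expression is $1/f$ wherever [f] does not vanish, thus near [z], and its quotient can be
   read off. *)
suff : holo_at (fun w => (f z)^-1 - p w / (f w * f z) * (w - z)) z.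
  apply: (holo_near d0) => w /fn0 fw.
  have -> : p w / (f w * f z) * (w - z) = (f w - f z) / (f w * f z).
    have -> : f w - f z = p w * (w - z) by rewrite {1}fE addrAC subrr add0r.
    by rewrite mulrAC.
  by move: (f w) (f z) fw fz => a b a0 b0; field; rewrite a0 b0.
exists (fun w => - (p w / (f w * f z))); split.
  apply/ccontN/(ccontM cp)/ccontV; first by rewrite mulf_neq0.
  exact: (ccontM cf (ccont_cst _ _)).
by move=> w; rewrite !subrr mulr0 subr0 mulNr.
Qed.

Lemma holo_comp f g z : holo_at g z -> holo_at f (g z) -> holo_at (f \o g) z.
Proof.
move=> hg; have cg := holo_ccont hg; move: hg => [r [cr gE]] [p [cp fE]].
exists (fun w => p (g w) * r w); split.
  exact: (ccontM (ccont_comp cg cp) cr).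
by move=> w; rewrite /= [f (g w)]fE [g w in X in _ + _ * X = _]gE; ring.
Qed.

End HoloAlgebra.

(** * The modulus as a real number *)

Section ComplexBasics.
Variable R : realType.
Local Notation K := R[i].
Local Notation Re := complex.Re.
Local Notation Im := complex.Im.
Implicit Types (z w : K) (f g : K -> K).

Lemma normc_ge0 z : 0 <= normc z.
Proof. by case: z => a b; rewrite /normc sqrtr_ge0. Qed.

Lemma normC_normc z : `|z| = (normc z)%:C%C.
Proof. by []. Qed.

Lemma normc_eq0 z : (normc z == 0) = (z == 0).
Proof. apply/eqP/eqP => [/eq0_normc//|->]; exact: normc0. Qed.

Lemma normc_gt0 z : (0 < normc z) = (z != 0).
Proof. by rewrite lt_neqAle normc_ge0 andbT eq_sym normc_eq0. Qed.

Lemma lec_normcD z w : normc (z + w) <= normc z + normc w.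
Proof. exact: le_normcD. Qed.

Lemma normcNE z : normc (- z) = normc z.
Proof. exact: normcN. Qed.

Lemma normcX z n : normc (z ^+ n) = normc z ^+ n.
Proof. by elim: n => [|n IH]; rewrite ?normc1 // !exprS normcM IH. Qed.

Lemma normcB z w : normc (z - w) = normc (w - z).
Proof. by rewrite -normcNE opprB. Qed.

Lemma le_normcB z w : normc z - normc w <= normc (z - w).
Proof. by rewrite lerBlDr -{1}(subrK w z) lec_normcD. Qed.

Lemma normc_real (x : R) : normc x%:C%C = `|x|.
Proof. by rewrite /normc /= expr0n /= addr0 sqrtr_sqr. Qed.

Lemma Re_le_normc z : `|Re z| <= normc z.
Proof. by have := normc_ge_Re z; rewrite normC_normc lecR. Qed.

Lemma Im_le_normc z : `|Im z| <= normc z.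
Proof.
have := Re_le_normc (z * 'i%C); rewrite ReiNIm normrN normcM.
have -> : normc ('i%C : K) = 1 by rewrite /normc /= expr0n expr1n add0r sqrtr1.
by rewrite mulr1.
Qed.

Lemma normc_le_ReIm z : normc z <= `|Re z| + `|Im z|.
Proof.
rewrite {1}(complexE z); apply: le_trans (lec_normcD _ _) _.
rewrite normcM !normc_real.
have -> : normc ('i%C : K) = 1 by rewrite /normc /= expr0n expr1n add0r sqrtr1.
by rewrite mul1r.
Qed.

(** Positive elements of [R[i]] are real, so the epsilons of [ccontP] may be taken in [R]. *)
Lemma contcP f z : ccont f z <->
  forall e : R, 0 < e -> exists2 d : R, 0 < d &
    forall w, normc (w - z) < d -> normc (f w - f z) < e.
Proof.
split.
- move=> /ccontP cf e e0.
  have /cf [d d0 H] : (0 : K) < e%:C%C by rewrite ltcR.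
  have [dR dE] : exists k, d = (k%:C)%C by apply/complex_realP/gtr0_real.
  move: d0 H; rewrite dE ltcR => d0 H; exists dR => // w wz.
  by rewrite -ltcR -normC_normc; apply: H; rewrite normC_normc ltcR.
- move=> H; apply/ccontP => e e0.
  have [eR eE] : exists k, e = (k%:C)%C by apply/complex_realP/gtr0_real.
  move: e0; rewrite eE ltcR => e0.
  have [d d0 Hd] := H _ e0.
  exists (d%:C)%C; first by rewrite ltcR.
  by move=> w; rewrite !normC_normc !ltcR; apply: Hd.
Qed.

End ComplexBasics.

(** * Integrals on segments *)

Section Integrals.
Variable R : realType.
Local Notation K := R[i].
Local Notation Re := complex.Re.
Local Notation Im := complex.Im.
Implicit Types (a b m M : R).

Definition rint (f : R -> R) a b : R :=
  (\int[lebesgue_measure]_(x in `[a, b]) f x)%R.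

Lemma rint_integrable (f : R -> R) a b : continuous f ->
  lebesgue_measure.-integrable `[a, b] (EFin \o f).
Proof.
move=> cf; apply: continuous_compact_integrable; first exact: segment_compact.
exact: continuous_subspaceT.
Qed.

Lemma rintD (f g : R -> R) a b : continuous f -> continuous g ->
  rint (fun x => f x + g x) a b = rint f a b + rint g a b.
Proof.
by move=> cf cg; rewrite /rint RintegralD //; exact: rint_integrable.
Qed.

Lemma rintZ c (f : R -> R) a b : continuous f ->
  rint (fun x => c * f x) a b = c * rint f a b.
Proof. by move=> cf; rewrite /rint RintegralZl //; exact: rint_integrable. Qed.

Lemma rint_cst c a b : a <= b -> rint (fun=> c) a b = c * (b - a).
Proof.
move=> ab; rewrite /rint Rintegral_cst //= lebesgue_measure_itv /= lte_fin.
move: ab; rewrite le_eqVlt => /predU1P[->|ab]; first by rewrite ltxx subrr.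
by rewrite ab -EFinB.
Qed.

Lemma rint_split (f : R -> R) a m b : continuous f -> a <= m -> m <= b ->
  rint f a b = rint f a m + rint f m b.
Proof.
move=> cf am mb; rewrite /rint.
have H := @Rintegral_itvB R f (BLeft a) (BRight b) m (rint_integrable a b cf).
rewrite bnd_simp in H; rewrite -(Rintegral_itv_obnd_cbnd (r := m)).
  by rewrite -H // addrC subrK.
apply: integrableS (rint_integrable m b cf) => //.
by move=> x /=; rewrite !in_itv /= => /andP[/ltW -> ->].
Qed.

Lemma rint_le (f g : R -> R) a b : continuous f -> continuous g ->
  (forall x, a <= x <= b -> f x <= g x) -> rint f a b <= rint g a b.
Proof.
move=> cf cg fg; apply: le_Rintegral; [by []|exact: rint_integrable..|].
by move=> x /=; rewrite in_itv /=; exact: fg.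
Qed.

Lemma cst_cont (c : R) : continuous (fun _ : R => c).
Proof. exact: cst_continuous. Qed.

Lemma rint_bound (f : R -> R) a b M : continuous f -> a <= b ->
  (forall x, a <= x <= b -> `|f x| <= M) -> `|rint f a b| <= M * (b - a).
Proof.
move=> cf ab fM; rewrite ler_norml -mulNr -!rint_cst //.
by apply/andP; split; apply: rint_le => //; try exact: cst_cont;
  move=> x /fM; rewrite ler_norml => /andP[].
Qed.

Definition rccont (f : R -> K) :=
  continuous (fun x => Re (f x)) /\ continuous (fun x => Im (f x)).

Definition cint (f : R -> K) a b : K :=
  (rint (fun x => Re (f x)) a b +i* rint (fun x => Im (f x)) a b)%C.

Lemma cReD (z w : K) : Re (z + w) = Re z + Re w.
Proof. by case: z w => ? ? []. Qed.
Lemma cImD (z w : K) : Im (z + w) = Im z + Im w.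
Proof. by case: z w => ? ? []. Qed.
Lemma cReM (z w : K) : Re (z * w) = Re z * Re w - Im z * Im w.
Proof. by case: z w => ? ? []. Qed.
Lemma cImM (z w : K) : Im (z * w) = Re z * Im w + Im z * Re w.
Proof. by case: z w => ? ? []. Qed.

Lemma contRD (f g : R -> R) : continuous f -> continuous g ->
  continuous (fun x => f x + g x).
Proof. by move=> cf cg x; exact: (@continuousD R R^o R f g x (cf x) (cg x)). Qed.

Lemma contRM (f g : R -> R) : continuous f -> continuous g ->
  continuous (fun x => f x * g x).
Proof. by move=> cf cg x; exact: (@continuousM R R f g x (cf x) (cg x)). Qed.

Lemma rccontD f g : rccont f -> rccont g -> rccont (fun x => f x + g x).
Proof.
move=> [f1 f2] [g1 g2]; split.
  by under eq_fun do rewrite cReD; exact: contRD.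
by under eq_fun do rewrite cImD; exact: contRD.
Qed.

Lemma rccontM f g : rccont f -> rccont g -> rccont (fun x => f x * g x).
Proof.
move=> [f1 f2] [g1 g2]; split.
  under eq_fun do rewrite cReM -mulN1r.
  by apply: contRD; [|apply: contRM; [exact: cst_cont|]]; exact: contRM.
by under eq_fun do rewrite cImM; apply: contRD; exact: contRM.
Qed.

Lemma rccont_cst c : rccont (fun=> c).
Proof. split; exact: cst_cont. Qed.

Lemma cintD f g a b : rccont f -> rccont g ->
  cint (fun x => f x + g x) a b = cint f a b + cint g a b.
Proof.
move=> [f1 f2] [g1 g2]; rewrite /cint.
under eq_fun do rewrite cReD; under [X in (_ +i* rint X _ _)%C]eq_fun do rewrite cImD.
by rewrite !rintD.
Qed.

Lemma cintZ c f a b : rccont f -> cint (fun x => c * f x) a b = c * cint f a b.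
Proof.
move=> [f1 f2]; rewrite /cint; case: c => c d.
have cZ (r : R) (h : R -> R) : continuous h -> continuous (fun x => r * h x).
  by move=> ch; apply: contRM ch; exact: cst_cont.
have -> : (fun x => Re ((c +i* d)%C * f x)) = (fun x => c * Re (f x) + (- d) * Im (f x)).
  by apply/funext => x; rewrite cReM mulNr.
have -> : (fun x => Im ((c +i* d)%C * f x)) = (fun x => c * Im (f x) + d * Re (f x)).
  by apply/funext => x; rewrite cImM.
by rewrite !rintD ?rintZ //; try exact: cZ; rewrite mulNr.
Qed.

Lemma cintB f g a b : rccont f -> rccont g ->
  cint (fun x => f x - g x) a b = cint f a b - cint g a b.
Proof.
move=> cf cg; under [X in cint X]eq_fun do rewrite -mulN1r.
rewrite cintD // ?cintZ ?mulN1r //.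
exact: rccontM (rccont_cst _) cg.
Qed.

Lemma cint_cst c a b : a <= b -> cint (fun=> c) a b = c * (b - a)%:C%C.
Proof.
by move=> ab; rewrite /cint !rint_cst //; case: c => c d; apply/eqP;
  rewrite eq_complex /= !mulr0 subr0 add0r !eqxx.
Qed.

Lemma cint_split f a m b : rccont f -> a <= m -> m <= b ->
  cint f a b = cint f a m + cint f m b.
Proof.
move=> [f1 f2] am mb.
by rewrite /cint (rint_split f1 am mb) (rint_split f2 am mb).
Qed.

(** The factor 2 comes from adding the bounds for the real and the imaginary part. *)
Lemma cint_bound f a b M : rccont f -> a <= b ->
  (forall x, a <= x <= b -> normc (f x) <= M) ->
  normc (cint f a b) <= 2 * M * (b - a).
Proof.
move=> [f1 f2] ab fM; apply: le_trans (normc_le_ReIm _) _.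
rewrite -mulrA mulr_natl mulr2n /=; apply: lerD; apply: rint_bound => // x /fM.
  exact: le_trans (Re_le_normc _).
exact: le_trans (Im_le_normc _).
Qed.

Lemma rccont_line (g : K -> K) (h : R -> K) : (forall x, ccont g (h x)) ->
  (forall x y, normc (h x - h y) = `|x - y|) -> rccont (g \o h).
Proof.
move=> cg hh; split=> x; apply/(@cvgrPdist_lt R R^o R (nbhs x)) => e e0;
  have /contcP /(_ e e0) [d d0 H] := cg x;
  apply/nbhs_ballP; exists d => // y; rewrite /ball /= => xy;
  rewrite distrC.
- have := H (h y); rewrite hh (distrC y) => /(_ xy).
  apply: le_lt_trans; apply: le_trans (Re_le_normc _).
  by rewrite /=; case: (g _) => ? ?; case: (g _).
- have := H (h y); rewrite hh (distrC y) => /(_ xy).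
  apply: le_lt_trans; apply: le_trans (Im_le_normc _).
  by rewrite /=; case: (g _) => ? ?; case: (g _).
Qed.

End Integrals.

(** * Goursat's theorem on rectangles *)

Section Cousin.
Variable R : realType.
Implicit Types (a b c d x y : R).

Lemma half_pow_lt (w e : R) : 0 < e -> exists n, w / 2 ^+ n < e.
Proof.
move=> e0; have [n Hn] : exists n : nat, w / e < n%:R.
  exists (Num.bound `|w / e|); apply: le_lt_trans (ler_norm _) _.
  exact: archi_boundP.
exists n; rewrite ltr_pdivrMr ?exprn_gt0 //.
rewrite mulrC -ltr_pdivrMr //; apply: lt_trans Hn _.
by rewrite -natrX ltr_nat ltn_expl.
Qed.

(* Bisection: a property of rectangles inherited from the four quarters holds as
   soon as it holds for all small rectangles around every point. *)
Lemma cousin_rectangle (P : R -> R -> R -> R -> Prop) :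
  (forall a b c d, a <= b -> c <= d ->
     P a ((a + b) / 2) c ((c + d) / 2) -> P ((a + b) / 2) b c ((c + d) / 2) ->
     P a ((a + b) / 2) ((c + d) / 2) d -> P ((a + b) / 2) b ((c + d) / 2) d ->
     P a b c d) ->
  forall a b c d, a <= b -> c <= d ->
  (forall x y, a <= x <= b -> c <= y <= d -> exists2 e, 0 < e &
     forall a' b' c' d', a <= a' <= x -> x <= b' <= b -> c <= c' <= y ->
       y <= d' <= d -> b' - a' < e -> d' - c' < e -> P a' b' c' d') ->
  P a b c d.
Proof.
move=> quarter a b c d ab cd loc; apply: contrapT => nP.
pose T := {s : (R * R) * (R * R) | [/\ s.1.1 <= s.1.2, s.2.1 <= s.2.2 &
  ~ P s.1.1 s.1.2 s.2.1 s.2.2]}.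
pose L (I I' : R * R) := [/\ I.1 <= I'.1, I'.2 <= I.2 & I'.2 - I'.1 = (I.2 - I.1) / 2].
have next (s : T) : {s' : T | L (sval s).1 (sval s').1 /\ L (sval s).2 (sval s').2}.
  apply: cid; case: s => -[[a1 b1] [c1 d1]] /= [ab1 cd1 nP1].
  set m := (a1 + b1) / 2; set n := (c1 + d1) / 2.
  have [am mb] : a1 <= m /\ m <= b1 by rewrite /m; lra.
  have [cn nd] : c1 <= n /\ n <= d1 by rewrite /n; lra.
  have LL x y : x <= y -> L (x, y) (x, (x + y) / 2) by split => /=; lra.
  have LR x y : x <= y -> L (x, y) ((x + y) / 2, y) by split => /=; lra.
  apply: contrapT => H.
  have mk x1 x2 y1 y2 : x1 <= x2 -> y1 <= y2 -> L (a1, b1) (x1, x2) ->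
      L (c1, d1) (y1, y2) -> P x1 x2 y1 y2.
    move=> x12 y12 LI LJ; apply: contrapT => nP2; apply: H.
    by exists (exist _ ((x1, x2), (y1, y2)) (And3 x12 y12 nP2)).
  by apply: nP1; apply: quarter => //; apply: mk => //; (exact: LL) || exact: LR.
pose u := fix u n : T := if n is n.+1 then sval (next (u n))
  else exist _ ((a, b), (c, d)) (And3 ab cd nP).
have uL n : L (sval (u n)).1 (sval (u n.+1)).1 /\ L (sval (u n)).2 (sval (u n.+1)).2.
  by rewrite /=; case: (next (u n)).
(* Nested intervals for one coordinate, used once for each: the limit point is the supremum of the
   left endpoints. *)
have nested (I : nat -> R * R) : (forall n, (I n).1 <= (I n).2) ->
    (forall n, L (I n) (I n.+1)) ->
    exists x, forall n, (I n).1 <= x <= (I n).2 /\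
      [/\ (I 0).1 <= (I n).1, (I n).2 <= (I 0).2 &
      (I n).2 - (I n).1 = ((I 0).2 - (I 0).1) / 2 ^+ n].
  move=> I12 IL.
  have incr n k : (I n).1 <= (I (n + k)%N).1.
    elim: k => [|k IH]; first by rewrite addn0.
    by rewrite addnS; case: (IL (n + k)%N) => /(le_trans IH).
  have decr n k : (I (n + k)%N).2 <= (I n).2.
    elim: k => [|k IH]; first by rewrite addn0.
    by rewrite addnS; case: (IL (n + k)%N) => _ /le_trans /(_ IH).
  have cross n m : (I n).1 <= (I m).2.
    apply: le_trans (incr n m) _; apply: le_trans (I12 _) _.
    by rewrite addnC; exact: decr.
  pose S := range (fun n => (I n).1).
  have ubS m : ubound S (I m).2 by move=> _ [n _ <-]; exact: cross.
  have supS : has_sup S by split; [exists (I 0).1; exists 0|exists (I 0).2; exact: ubS].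
  exists (sup S) => n; split; last split.
  - apply/andP; split; first by apply: ub_le_sup; [case: supS|exists n].
    by apply: ge_sup; [case: supS|exact: ubS].
  - exact: (incr 0 n).
  - exact: (decr 0 n).
  elim: n => [|n IH]; first by rewrite expr0 divr1.
  by case: (IL n) => _ _ ->; rewrite IH exprSr invfM mulrA.
have [x Hx] := nested (fun n => (sval (u n)).1) (fun n => let: And3 h _ _ := svalP (u
  n) in h)
   (fun n => (uL n).1).
have [y Hy] := nested (fun n => (sval (u n)).2) (fun n => let: And3 _ h _ := svalP (u
  n) in h)
   (fun n => (uL n).2).
have [e e0 He] := loc x y (Hx 0).1 (Hy 0).1.
have [n1 Hn1] := half_pow_lt (b - a) e0.
have [n2 Hn2] := half_pow_lt (d - c) e0.
pose n := maxn n1 n2.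
have small w k : 0 <= w -> (k <= n)%N -> w / 2 ^+ k < e -> w / 2 ^+ n < e.
  move=> w0 kn; apply: le_lt_trans; apply: ler_wpM2l => //.
  by rewrite lef_pV2 ?posrE ?exprn_gt0 // ler_weXn2l // ler1n.
have [_ _] := svalP (u n); apply.
have [/andP[x1 x2] [x3 x4 x5]] := Hx n; have [/andP[y1 y2] [y3 y4 y5]] := Hy n.
apply: He; rewrite ?x1 ?x2 ?x3 ?x4 ?y1 ?y2 ?y3 ?y4 //.
  by rewrite x5; apply: (small _ n1) => //; rewrite ?subr_ge0 ?leq_maxl.
by rewrite y5; apply: (small _ n2) => //; rewrite ?subr_ge0 ?leq_maxr.
Qed.

End Cousin.

Section Goursat.
Variable R : realType.
Local Notation K := R[i].
Local Notation Re := complex.Re.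
Local Notation Im := complex.Im.
Implicit Types (a b c d x y : R) (g h : K -> K).

Definition hline c : R -> K := fun x => (x +i* c)%C.
Definition vline a : R -> K := fun y => (a +i* y)%C.

Lemma hlineB c x y : normc (hline c x - hline c y) = `|x - y|.
Proof.
rewrite -normc_real; congr normc.
by apply/eqP; rewrite eq_complex /= subrr !eqxx.
Qed.

Lemma vlineB a x y : normc (vline a x - vline a y) = `|x - y|.
Proof.
have -> : vline a x - vline a y = 'i%C * (x - y)%:C%C.
  by apply/eqP; rewrite eq_complex /= subrr; apply/andP; split; apply/eqP; ring.
rewrite normcM normc_real.
by rewrite [normc 'i%C]/normc /= expr0n expr1n add0r sqrtr1 mul1r.
Qed.

(** The counterclockwise boundary integral, with opposite sides combined under one integral. *)
Definition rect_int g a b c d : K :=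
  cint (fun x => g (hline c x) - g (hline d x)) a b +
  'i%C * cint (fun y => g (vline b y) - g (vline a y)) c d.

Definition cont_everywhere g := forall z, ccont g z.

Lemma rccont_h g c : cont_everywhere g -> rccont (fun x => g (hline c x)).
Proof. move=> cg; exact: (rccont_line (fun x => cg _) (hlineB c)). Qed.

Lemma rccont_v g a : cont_everywhere g -> rccont (fun y => g (vline a y)).
Proof. move=> cg; exact: (rccont_line (fun x => cg _) (vlineB a)). Qed.

Lemma rccontB (f g : R -> K) : rccont f -> rccont g -> rccont (fun x => f x - g x).
Proof.
move=> cf cg; under eq_fun do rewrite -mulN1r.
by apply: rccontD => //; apply: rccontM cg; exact: rccont_cst.
Qed.

Lemma rccont_hh g c d : cont_everywhere g -> rccont (fun x => g (hline c x) - g (hline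
  d x)).
Proof. by move=> cg; apply: rccontB; exact: rccont_h. Qed.

Lemma rccont_vv g a b : cont_everywhere g -> rccont (fun x => g (vline b x) - g (vline
  a x)).
Proof. by move=> cg; apply: rccontB; exact: rccont_v. Qed.

Lemma cint_xx (f : R -> K) a : cint f a a = 0.
Proof. by rewrite /cint /rint set_itv1 !Rintegral_set1. Qed.

Lemma rect_int_xx g a c d : c <= d -> rect_int g a a c d = 0.
Proof.
move=> cd; rewrite /rect_int cint_xx add0r.
under [X in cint X]eq_fun do rewrite subrr.
by rewrite cint_cst // mul0r mulr0.
Qed.

Lemma rect_int_yy g a b c : a <= b -> rect_int g a b c c = 0.
Proof.
move=> ab; rewrite /rect_int cint_xx mulr0 addr0.
under [X in cint X]eq_fun do rewrite subrr.
by rewrite cint_cst // mul0r.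
Qed.

Lemma rect_int_splitx g m a b c d : cont_everywhere g -> a <= m -> m <= b ->
  rect_int g a b c d = rect_int g a m c d + rect_int g m b c d.
Proof.
move=> cg am mb; rewrite /rect_int (cint_split (rccont_hh _ _ cg) am mb).
have -> : (fun y => g (vline b y) - g (vline a y)) =
  (fun y => (g (vline m y) - g (vline a y)) + (g (vline b y) - g (vline m y))).
  by apply/funext => y; ring.
by rewrite (cintD _ _ (rccont_vv a m cg) (rccont_vv m b cg)); ring.
Qed.

Lemma rect_int_splity g n a b c d : cont_everywhere g -> c <= n -> n <= d ->
  rect_int g a b c d = rect_int g a b c n + rect_int g a b n d.
Proof.
move=> cg cn nd; rewrite /rect_int (cint_split (rccont_vv _ _ cg) cn nd).
have -> : (fun x => g (hline c x) - g (hline d x)) =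
  (fun x => (g (hline c x) - g (hline n x)) + (g (hline n x) - g (hline d x))).
  by apply/funext => y; ring.
by rewrite (cintD _ _ (rccont_hh c n cg) (rccont_hh n d cg)); ring.
Qed.

Lemma rect_intD g h a b c d : cont_everywhere g -> cont_everywhere h ->
  rect_int (fun z => g z + h z) a b c d = rect_int g a b c d + rect_int h a b c d.
Proof.
move=> cg ch; rewrite /rect_int.
have -> : (fun x => g (hline c x) + h (hline c x) - (g (hline d x) + h (hline d x))) =
  (fun x => (g (hline c x) - g (hline d x)) + (h (hline c x) - h (hline d x))).
  by apply/funext => x; ring.
have -> : (fun y => g (vline b y) + h (vline b y) - (g (vline a y) + h (vline a y))) =
  (fun y => (g (vline b y) - g (vline a y)) + (h (vline b y) - h (vline a y))).
  by apply/funext => x; ring.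
rewrite (cintD _ _ (rccont_hh c d cg) (rccont_hh c d ch)).
by rewrite (cintD _ _ (rccont_vv a b cg) (rccont_vv a b ch)); ring.
Qed.

(** Between opposite sides the function differs by a constant, $iB(c-d)$ for the horizontal pair and
    $B(b-a)$ for the vertical one, and the two contributions cancel. *)
Lemma rect_int_affine (A B : K) a b c d : a <= b -> c <= d ->
  rect_int (fun z => A + B * z) a b c d = 0.
Proof.
move=> ab cd; rewrite /rect_int.
have -> : (fun x => A + B * hline c x - (A + B * hline d x)) =
    (fun=> B * ('i%C * (c - d)%:C%C)).
  apply/funext => x.
  have -> : 'i%C * (c - d)%:C%C = hline c x - hline d x.
    by apply/eqP; rewrite eq_complex /= subrr; apply/andP; split; apply/eqP; ring.
  by ring.
have -> : (fun x => A + B * vline b x - (A + B * vline a x)) =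
    (fun=> B * (b - a)%:C%C).
  apply/funext => x.
  have -> : (b - a)%:C%C = vline b x - vline a x.
    by apply/eqP; rewrite eq_complex /= subrr !eqxx.
  by ring.
rewrite !cint_cst //.
have -> : (c - d)%:C%C = - (d - c)%:C%C :> K by rewrite -rmorphN opprB.
by ring.
Qed.

(** The constant 4 is the 2 of [cint_bound] times two opposite sides. *)
Lemma rect_int_bound g a b c d M : cont_everywhere g -> a <= b -> c <= d ->
  (forall x y, a <= x <= b -> c <= y <= d -> normc (g (x +i* y)%C) <= M) ->
  normc (rect_int g a b c d) <= 4 * M * ((b - a) + (d - c)).
Proof.
move=> cg ab cd gM; apply: le_trans (lec_normcD _ _) _.
rewrite normcM [normc 'i%C]/normc /= expr0n expr1n add0r sqrtr1 mul1r mulrDr.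
have HB u v : normc u <= M -> normc v <= M -> normc (u - v : K) <= 2 * M.
  by move=> uM vM; apply: le_trans (lec_normcD _ _) _; rewrite normcNE; lra.
have -> : 4 * M = 2 * (2 * M) by rewrite mulrA; congr (_ * _); lra.
by apply: lerD; apply: cint_bound => //; [exact: rccont_hh| |exact: rccont_vv|];
  move=> t tab; apply: HB; apply: gM; rewrite ?lexx ?ab ?cd.
Qed.

Lemma cont_affine (A B : K) : cont_everywhere (fun z => A + B * z).
Proof.
move=> z; exact: (ccontD (@ccont_cst _ A z) (ccontM (@ccont_cst _ B z) (@ccont_id _ z))).
Qed.

(* Goursat's lemma: bisection and first order expansion around the limit point. *)
Lemma goursat g a b c d : cont_everywhere g -> a <= b -> c <= d ->
  (forall x y, a <= x <= b -> c <= y <= d -> holo_at g (x +i* y)%C) ->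
  rect_int g a b c d = 0.
Proof.
move=> cg ab cd hg; apply/eqP; rewrite -normc_eq0.
set J := normc _.
(* The bound is quadratic in the half-perimeter: halving the sides divides it by 4, so the bounds of
   the four quarters add up to that of the whole. With $e=J/(8(S+1))$ it falls below $J/2$; the $+1$
   covers $S=0$. *)
suff H e : 0 < e -> J <= 4 * e * ((b - a) + (d - c)) ^+ 2.
  rewrite eq_le normc_ge0 andbT; apply: contraT; rewrite -ltNge => J0.
  set S := (_ + _) ^+ 2 in H.
  have S0 : 0 <= S by exact: sqr_ge0.
  have e0 : 0 < J / (8 * (S + 1)) by rewrite divr_gt0 // mulr_gt0 // ltr_pwDr.
  have := H _ e0; rewrite leNgt => /negP[].
  have JE : J = J / (8 * (S + 1)) * (8 * (S + 1)).
    by rewrite divfK // mulf_neq0 ?gt_eqF // ltr_pwDr.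
  rewrite [ltRHS]JE; set t := _ / _ in e0 *.
  have : 0 <= t * S by rewrite mulr_ge0 // ltW.
  lra.
move=> e0; rewrite /J {J}.
apply: (@cousin_rectangle R (fun a b c d => normc (rect_int g a b c d) <=
   4 * e * ((b - a) + (d - c)) ^+ 2)) => //.
- move=> {ab cd hg a b c d} a b c d ab cd; set m := (a + b) / 2; set n := (c + d) / 2.
  have [am mb] : a <= m /\ m <= b by rewrite /m; lra.
  have [cn nd] : c <= n /\ n <= d by rewrite /n; lra.
  have -> : m - a = (b - a) / 2 by rewrite /m; field.
  have -> : b - m = (b - a) / 2 by rewrite /m; field.
  have -> : n - c = (d - c) / 2 by rewrite /n; field.
  have -> : d - n = (d - c) / 2 by rewrite /n; field.
  rewrite -mulrDl => H1 H2 H3 H4.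
  rewrite (rect_int_splitx _ _ cg am mb) !(rect_int_splity _ _ cg cn nd).
  apply: le_trans (lec_normcD _ _) _.
  apply: le_trans (lerD (lec_normcD _ _) (lec_normcD _ _)) _.
  move: H1 H2 H3 H4; rewrite expr_div_n.
  set S := (b - a + _) ^+ 2.
  have -> : 4 * e * (S / 2 ^+ 2) = e * S by field.
  lra.
move=> x y xab ycd; have [phi [/contcP cphi gE]] := hg x y xab ycd.
set p := (x +i* y)%C in cphi gE.
have [r r0 Hr] := cphi e e0.
exists (r / 2); first by rewrite divr_gt0.
move=> a' b' c' d' /andP[a1 a2] /andP[b1 b2] /andP[c1 c2] /andP[d1 d2] bar dcr.
(* [A + B * z] is the first order expansion of [g] at [p], with boundary integral 0; the remainder
   [h] is at most [e * S] on the small rectangle. *)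
pose A := g p - phi p * p; pose B := phi p.
pose h z := g z - (A + B * z).
have ch : cont_everywhere h by move=> z; exact: (ccontB (cg z) (@cont_affine A B z)).
have -> : g = (fun z => h z + (A + B * z)) by apply/funext => z; rewrite /h subrK.
have ab' : a' <= b' by lra.
have cd' : c' <= d' by lra.
rewrite rect_intD //; last exact: cont_affine.
rewrite rect_int_affine // addr0.
set S := b' - a' + (d' - c').
have -> : 4 * e * S ^+ 2 = 4 * (e * S) * S by ring.
apply: rect_int_bound => // x1 y1 /andP[xa xb] /andP[yc yd].
have -> : h (x1 +i* y1)%C = (phi (x1 +i* y1)%C - phi p) * ((x1 +i* y1)%C - p).
  by rewrite /h {1}gE /A /B; ring.
have Hp : normc ((x1 +i* y1)%C - p) <= S.
  apply: le_trans (normc_le_ReIm _) _.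
  rewrite /p /= /S; apply: lerD; rewrite ler_norml; apply/andP; split; lra.
rewrite normcM; apply: ler_pM => //; try exact: normc_ge0.
by apply/ltW/Hr; apply: le_lt_trans Hp _; rewrite /S; lra.
Qed.

Definition in_rect (p : K) a b c d := (a <= Re p <= b) && (c <= Im p <= d).

(* A point of continuity is negligible: shrink a rectangle around it. *)
Lemma rect_int_shrink g (p : K) a b c d : cont_everywhere g -> a <= b -> c <= d ->
  (forall a' b' c' d', a <= a' -> a' <= b' -> b' <= b ->
     c <= c' -> c' <= d' -> d' <= d -> ~~ in_rect p a' b' c' d' ->
     rect_int g a' b' c' d' = 0) ->
  rect_int g a b c d = 0.
Proof.
move=> cg ab cd H; have [pin|] := boolP (in_rect p a b c d); last first.
  by apply: H.
move: pin => /andP[/andP[pa pb] /andP[pc pd]].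
case: p pa pb pc pd H => x y /= xa xb yc yd H.
have /contcP /(_ 1 ltr01) [r r0 Hr] := cg (x +i* y)%C.
pose M := normc (g (x +i* y)%C) + 1.
have M0 : 0 < M by rewrite ltr_wpDl // normc_ge0.
suff Hs s : 0 < s -> s < r / 2 -> normc (rect_int g a b c d) <= 16 * M * s.
  apply/eqP; rewrite -normc_eq0 eq_le normc_ge0 andbT.
  apply: contraT; rewrite -ltNge; set J := normc _ in Hs * => J0.
  have s1 : 0 < Num.min (r / 4) (J / (32 * M)).
    by rewrite lt_min !divr_gt0 // mulr_gt0.
  have s2 : Num.min (r / 4) (J / (32 * M)) < r / 2.
    by rewrite gt_min; apply/orP; left; lra.
  have := Hs _ s1 s2; rewrite leNgt => /negP[].
  apply: (@le_lt_trans _ _ (16 * M * (J / (32 * M)))).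
    by apply: ler_wpM2l; [rewrite mulr_ge0 // ltW|rewrite ge_min lexx orbT].
  have -> : 16 * M * (J / (32 * M)) = J / 2 by field; rewrite gt_eqF.
  lra.
move=> s0 sr.
(* The square of half-side [s] around [p], clipped to the rectangle. Each of the four strips around
   it is degenerate or misses [p]; the clipped square has half-perimeter at most [4 * s], whence
   [16 * M * s]. *)
pose a' := Num.max a (x - s); pose b' := Num.min b (x + s).
pose c' := Num.max c (y - s); pose d' := Num.min d (y + s).
have [aa1 aa2] : a <= a' /\ a' <= x by rewrite le_max lexx ge_max xa; split => //=; lra.
have [bb1 bb2] : x <= b' /\ b' <= b by rewrite ge_min lexx le_min xb; split => //=; lra.
have [cc1 cc2] : c <= c' /\ c' <= y by rewrite le_max lexx ge_max yc; split => //=; lra.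
have [dd1 dd2] : y <= d' /\ d' <= d by rewrite ge_min lexx le_min yd; split => //=; lra.
have ab' := le_trans aa2 bb1; have cd' := le_trans cc2 dd1.
have a'b := le_trans ab' bb2; have c'd := le_trans cd' dd2.
rewrite (rect_int_splitx _ _ cg aa1 a'b) (rect_int_splitx _ _ cg ab' bb2).
rewrite (rect_int_splity a' b' cg cc1 c'd) (rect_int_splity a' b' cg cd' dd2).
have -> : rect_int g a a' c d = 0.
  have [ax|ax] := leP (x - s) a.
    by rewrite /a' (max_idPl ax) rect_int_xx.
  by apply: H => //; rewrite /in_rect /= /a' (max_idPr (ltW ax)); apply/negP =>
    /andP[/andP[? ?] /andP[? ?]]; lra.
have -> : rect_int g b' b c d = 0.
  have [bx|bx] := leP b (x + s).
    by rewrite /b' (min_idPl bx) rect_int_xx.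
  by apply: H => //; rewrite ?(le_trans aa1) // /in_rect /= /b' (min_idPr (ltW bx));
    apply/negP => /andP[/andP[? ?] /andP[? ?]]; lra.
have -> : rect_int g a' b' c c' = 0.
  have [cy|cy] := leP (y - s) c.
    by rewrite /c' (max_idPl cy) rect_int_yy.
  by apply: H => //; rewrite /in_rect /= /c' (max_idPr (ltW cy)); apply/negP =>
    /andP[/andP[? ?] /andP[? ?]]; lra.
have -> : rect_int g a' b' d' d = 0.
  have [dy|dy] := leP d (y + s).
    by rewrite /d' (min_idPl dy) rect_int_yy.
  by apply: H => //; rewrite ?(le_trans cc1) // /in_rect /= /d' (min_idPr (ltW dy));
    apply/negP => /andP[/andP[? ?] /andP[? ?]]; lra.
rewrite !add0r !addr0.
have S1 : b' - a' + (d' - c') <= 4 * s.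
  have : b' <= x + s by rewrite ge_min lexx orbT.
  have : x - s <= a' by rewrite le_max lexx orbT.
  have : d' <= y + s by rewrite ge_min lexx orbT.
  have : y - s <= c' by rewrite le_max lexx orbT.
  lra.
apply: (@le_trans _ _ (4 * M * (b' - a' + (d' - c')))); last first.
  have -> : 16 * M * s = 4 * M * (4 * s) by ring.
  by rewrite ler_pM2l // mulr_gt0.
apply: rect_int_bound => // x1 y1 /andP[xa1 xb1] /andP[yc1 yd1].
rewrite -lerBlDl; apply: le_trans (le_normcB _ _) _; apply/ltW/Hr.
apply: le_lt_trans (normc_le_ReIm _) _.
have xs : `|x1 - x| <= s.
  have : b' <= x + s by rewrite ge_min lexx orbT.
  have : x - s <= a' by rewrite le_max lexx orbT.
  by rewrite ler_norml => *; apply/andP; split; lra.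
have ys : `|y1 - y| <= s.
  have : d' <= y + s by rewrite ge_min lexx orbT.
  have : y - s <= c' by rewrite le_max lexx orbT.
  by rewrite ler_norml => *; apply/andP; split; lra.
by rewrite /=; lra.
Qed.

(* The exceptional points of a quotient by theta functions accumulate at 0, hence
   the special role of 0. *)
Definition quasi_holo g := cont_everywhere g /\
  forall p, p != 0 -> exists2 e : R, 0 < e &
    forall w, w != p -> normc (w - p) < e -> holo_at g w.

(** Away from 0, bisection leads to rectangles with at most one exceptional point, removed by
    [rect_int_shrink]. A second use of [rect_int_shrink] removes 0, where exceptional points may
    accumulate. *)
Lemma goursat_quasi g a b c d : quasi_holo g -> a <= b -> c <= d ->
  rect_int g a b c d = 0.
Proof.
move=> [cg hg].
have step a1 b1 c1 d1 : a1 <= b1 -> c1 <= d1 -> ~~ in_rect 0 a1 b1 c1 d1 ->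
    rect_int g a1 b1 c1 d1 = 0.
  move=> ab cd n0; apply: (@cousin_rectangle R (fun a b c d => rect_int g a b c d = 0))
    => //.
    move=> {ab cd n0 a b c d a1 b1 c1 d1} a b c d ab cd.
    have [am mb] : a <= (a + b) / 2 /\ (a + b) / 2 <= b by lra.
    have [cn nd] : c <= (c + d) / 2 /\ (c + d) / 2 <= d by lra.
    rewrite (rect_int_splitx _ _ cg am mb) !(rect_int_splity _ _ cg cn nd).
    by move=> -> -> -> ->; rewrite !addr0.
  move=> x y xab ycd.
  have p0 : (x +i* y)%C != 0 :> K.
    apply: contraNneq n0 => -[x0 y0].
    by rewrite /in_rect /=; move: xab ycd; rewrite x0 y0 => -> ->.
  have [e e0 He] := hg _ p0.
  exists (e / 2); first by rewrite divr_gt0.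
  move=> a' b' c' d' /andP[a2 a3] /andP[b2 b3] /andP[c2 c3] /andP[d2 d3] bar dcr.
  apply: (rect_int_shrink (p := (x +i* y)%C)) => //; try lra.
  move=> a'' b'' c'' d'' a4 ab4 b4 c4 cd4 d4 np.
  apply: goursat => // x1 y1 /andP[xa xb] /andP[yc yd]; apply: He.
    apply: contraNneq np => -[<- <-].
    by rewrite /in_rect /= xa xb yc yd.
  apply: le_lt_trans (normc_le_ReIm _) _ => /=.
  have xs : `|x1 - x| <= b' - a' by rewrite ler_norml; apply/andP; split; lra.
  have ys : `|y1 - y| <= d' - c' by rewrite ler_norml; apply/andP; split; lra.
  lra.
move=> ab cd; apply: (rect_int_shrink (p := 0)) => //.
by move=> a' b' c' d' *; apply: step.
Qed.

End Goursat.

(** * Liouville's theorem *)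

Section Liouville.
Variable R : realType.
Local Notation K := R[i].
Local Notation Re := complex.Re.
Local Notation Im := complex.Im.
Implicit Types (g h : K -> K) (z w p : K) (e : R).

Lemma normc_pos_real e : 0 < e -> normc (e%:C%C : K) = e.
Proof. by move=> e0; rewrite normc_real gtr0_norm. Qed.

(** Provides the base points of the difference quotients in [quasi_holo_affine], which must be
    points of differentiability. *)
Lemma quasi_holo_dense g z e : quasi_holo g -> 0 < e ->
  exists w, [/\ normc (w - z) < e, w != 0 & holo_at g w].
Proof.
move=> [cg hg]; wlog z0 : z e / z != 0 => [H|] e0.
  have [->|/H] := eqVneq z 0; last exact.
  have e20 : 0 < e / 2 by rewrite divr_gt0.
  have p0 : (e / 2)%:C%C != 0 :> K by rewrite -normc_eq0 normc_pos_real ?gt_eqF.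
  have [w [we w0 hw]] := H _ _ p0 e20.
  exists w; split => //; rewrite subr0 -(subrK (e / 2)%:C%C w).
  by apply: le_lt_trans (lec_normcD _ _) _; rewrite normc_pos_real // [ltRHS](splitr e)
    ltrD2r.
have [d d0 Hd] := hg _ z0.
pose r := Num.min (Num.min d e) (normc z) / 2.
have r0 : 0 < r by rewrite divr_gt0 // !lt_min d0 e0 normc_gt0.
have [rd re rz] : [/\ r < d, r < e & r < normc z].
  have : Num.min (Num.min d e) (normc z) <= d by rewrite !ge_min lexx.
  have : Num.min (Num.min d e) (normc z) <= e by rewrite !ge_min lexx orbT.
  have : Num.min (Num.min d e) (normc z) <= normc z by rewrite !ge_min lexx orbT.
  by move: r0; rewrite /r; set m := Num.min _ _ => *; split; lra.
have wz : z + r%:C%C - z = r%:C%C by rewrite addrAC subrr add0r.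
exists (z + r%:C%C); split; first by rewrite wz normc_pos_real.
  apply: contraTneq rz => /eqP; rewrite addr_eq0 => /eqP ->.
  by rewrite normcNE normc_pos_real // ltxx.
apply: Hd; last by rewrite wz normc_pos_real.
by rewrite -subr_eq0 wz -normc_eq0 normc_pos_real // gt_eqF.
Qed.

Lemma ccont_dense_eq g h z : ccont g z -> ccont h z ->
  (forall e, 0 < e -> exists2 w, normc (w - z) < e & g w = h w) -> g z = h z.
Proof.
move=> cg ch H; apply/eqP; rewrite -subr_eq0; apply: contraT => gh.
have [|d d0 Hd] := @ccont_neq0 _ (fun w => g w - h w) z _ gh.
  exact: (ccontB cg ch).
have [dR dE] : exists k, d = (k%:C)%C by apply/complex_realP/gtr0_real.
move: d0 Hd; rewrite dE ltcR => d0 Hd.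
have [w wz E] := H _ d0.
by have := Hd w; rewrite normC_normc ltcR E subrr eqxx => /(_ wz).
Qed.

(** At [a] the continuity of [phi] is part of [cdiff]; there [a] becomes one more exceptional point.
    Around any other [p] the radius is cut so as to exclude [a]. *)
Lemma quasi_holo_quotient g a phi : quasi_holo g -> cdiff g a phi -> quasi_holo phi.
Proof.
move=> [cg hg] [cphi gE].
have phiE w : w != a -> phi w = (g w - g a) / (w - a).
  by move=> wa; rewrite gE addrAC subrr add0r mulfK // subr_eq0.
have near w : w != a -> exists2 d : K, 0 < d &
    forall v, `|v - w| < d -> (g v - g a) / (v - a) = phi v.
  move=> wa; exists `|w - a|; first by rewrite normr_gt0 subr_eq0.
  move=> v vw; rewrite phiE //; apply: contraTneq vw => ->.
  by rewrite distrC ltxx.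
split.
  move=> w; have [->//|wa] := eqVneq w a.
  have [d d0 Hd] := near w wa; apply: (ccont_near d0 Hd).
  apply: (ccontM (ccontB (cg w) (@ccont_cst _ (g a) w))); apply: ccontV.
    by rewrite subr_eq0.
  exact: (ccontB (@ccont_id _ w) (@ccont_cst _ a w)).
move=> p p0; have [d d0 Hd] := hg p p0.
exists (if p == a then d else Num.min d (normc (p - a))).
  by case: eqVneq => // pa; rewrite lt_min d0 normc_gt0 subr_eq0.
move=> w wp wd; have wa : w != a.
  have [<-//|pa] := eqVneq p a; rewrite (negPf pa) lt_min in wd.
  by apply: contraTneq wd => ->; rewrite normcB ltxx andbF.
have hw : holo_at g w.
  apply: Hd => //; move: wd; case: ifP => // _; rewrite lt_min => /andP[//].
have [r r0 Hr] := near w wa; apply: (holo_near r0 Hr).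
apply: (holoM (holoB hw (holo_cst (g a) w))); apply: holoV; first by rewrite subr_eq0.
exact: (holoB (holo_id w) (holo_cst a w)).
Qed.

Definition little_at_infty g n := forall e, 0 < e -> exists2 M : R, 0 < M &
  forall z, M < normc z -> normc (g z) <= e * normc z ^+ n.

Lemma little_quotient g a phi n : cdiff g a phi ->
  little_at_infty g n.+1 -> little_at_infty phi n.
Proof.
move=> [_ gE] H e e0.
have e40 : 0 < e / 4 by rewrite divr_gt0.
have [M M0 HM] := H _ e40.
(* The summands ensure, in this order, the growth bound of [g] at [z], $|z|\ge1$, $|z-a|\ge|z|/2$,
   and $|g(a)|\le(e/4)|z|$. *)
exists (M + 1 + 2 * normc a + normc (g a) / (e / 4)).
  have := normc_ge0 a; have : 0 <= normc (g a) / (e / 4).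
    by rewrite divr_ge0 ?normc_ge0 // ltW.
  lra.
move=> z; have := normc_ge0 a.
have : 0 <= normc (g a) / (e / 4) by rewrite divr_ge0 ?normc_ge0 // ltW.
move=> ga0 a0 Hz.
have zM : M < normc z by lra.
have z1 : 1 <= normc z by lra.
have za : 2 * normc a <= normc z by lra.
have zg : normc (g a) <= e / 4 * normc z.
  by rewrite mulrC -ler_pdivrMr //; lra.
have zn : normc z <= normc z ^+ n.+1 by rewrite -[leLHS]expr1 ler_weXn2l.
have zg' : normc (g a) <= e / 4 * normc z ^+ n.+1.
  by apply: le_trans zg _; rewrite ler_pM2l.
have Hza : normc z / 2 <= normc (z - a) by have := le_normcB z a; lra.
have z2 : 0 < normc z / 2 by lra.
have Hg : normc (phi z) * normc (z - a) <= e * normc z ^+ n * (normc z / 2).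
  rewrite -normcM.
  have -> : phi z * (z - a) = g z - g a by rewrite gE addrAC subrr add0r.
  apply: le_trans (lec_normcD _ _) _; rewrite normcNE.
  have := HM z zM; move: zg'; rewrite exprS.
  have -> : e * normc z ^+ n * (normc z / 2) = e / 4 * (normc z * normc z ^+ n) * 2 by
    field.
  lra.
rewrite -(ler_pM2r z2); apply: le_trans Hg.
by apply: ler_wpM2l => //; exact: normc_ge0.
Qed.

(* Cauchy's formula on large squares: a quasi-holomorphic function tending to 0
   at infinity vanishes, since the loop integral of 1 / (z - p) has imaginary
   part at least 4. *)
Lemma quasi_holo_vanish k p : quasi_holo k -> little_at_infty k 0 ->
  holo_at k p -> k p = 0.
Proof.
move=> qk k0 [phi dphi]; have qphi := quasi_holo_quotient qk dphi.
move: dphi => [cphi kE]; have [ck hk] := qk.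
case: p cphi kE => p1 p2 cphi kE; set p := (p1 +i* p2)%C in cphi kE *.
apply/eqP; rewrite -normc_eq0 eq_le normc_ge0 andbT.
suff H e : 0 < e -> normc (k p) <= 4 * e.
  apply: contraT; rewrite -ltNge; set J := normc _ in H * => J0.
  have J8 : 0 < J / 8 by lra.
  by have := H _ J8; lra.
move=> e0; have [M M0 HM] := k0 e e0.
(* On the boundary of the square of half-side [r] around [p] one has $|z|\ge r-|p|>M$, so [k] is at
   most [e] there. *)
pose r := M + normc p + 1.
have r0 : 0 < r by have := normc_ge0 p; rewrite /r; lra.
pose a := p1 - r; pose b := p1 + r; pose c := p2 - r; pose d := p2 + r.
have ab : a <= b by rewrite /a /b; lra.
have cd : c <= d by rewrite /c /d; lra.
have := goursat_quasi qphi ab cd.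
pose h := fun z => (z - p)^-1.
have ch z : z != p -> ccont h z.
  move=> zp; apply: ccontV; first by rewrite subr_eq0.
  exact: (ccontB (@ccont_id _ z) (@ccont_cst _ p z)).
have phiE z : z != p -> phi z = k z * h z - k p * h z.
  by move=> zp; rewrite -mulrBl kE addrAC subrr add0r mulfK // subr_eq0.
have hc x : hline c x != p by apply/eqP => -[_]; rewrite /c; lra.
have hd x : hline d x != p by apply/eqP => -[_]; rewrite /d; lra.
have va y : vline a y != p by apply/eqP => -[]; rewrite /a; lra.
have vb y : vline b y != p by apply/eqP => -[]; rewrite /b; lra.
have ch_c : rccont (fun x => h (hline c x)).
  by apply: (rccont_line _ (hlineB c)) => x; exact: ch.
have ch_d : rccont (fun x => h (hline d x)).
  by apply: (rccont_line _ (hlineB d)) => x; exact: ch.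
have ch_a : rccont (fun x => h (vline a x)).
  by apply: (rccont_line _ (vlineB a)) => x; exact: ch.
have ch_b : rccont (fun x => h (vline b x)).
  by apply: (rccont_line _ (vlineB b)) => x; exact: ch.
have rH := rccontB ch_c ch_d; have rV := rccontB ch_b ch_a.
have rkH := rccontB (rccontM (rccont_h c ck) ch_c) (rccontM (rccont_h d ck) ch_d).
have rkV := rccontB (rccontM (rccont_v b ck) ch_b) (rccontM (rccont_v a ck) ch_a).
rewrite /rect_int.
have -> : (fun x => phi (hline c x) - phi (hline d x)) =
   (fun x => (k (hline c x) * h (hline c x) - k (hline d x) * h (hline d x)) -
      k p * (h (hline c x) - h (hline d x))).
  by apply/funext => x; rewrite !phiE //; ring.
have -> : (fun x => phi (vline b x) - phi (vline a x)) =
   (fun x => (k (vline b x) * h (vline b x) - k (vline a x) * h (vline a x)) -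
      k p * (h (vline b x) - h (vline a x))).
  by apply/funext => x; rewrite !phiE //; ring.
rewrite (cintB _ _ rkH (rccontM (rccont_cst (k p)) rH)) (cintZ _ _ _ rH).
rewrite (cintB _ _ rkV (rccontM (rccont_cst (k p)) rV)) (cintZ _ _ _ rV).
set XH := cint _ a b; set WH := cint _ a b; set XV := cint _ c d; set WV := cint _ c d.
move=> E; have {}E : k p * (WH + 'i%C * WV) = XH + 'i%C * XV.
  by apply/eqP; rewrite eq_sym -subr_eq0 -E; apply/eqP; ring.
(* Each pair of opposite sides contributes the integral, over an interval of length $2r$, of
   $2r/(u^2+r^2)\ge1/r$, hence at least 2. This crude bound replaces the exact value $2\pi$. *)
have W4 : 4 <= normc (WH + 'i%C * WV).
  apply: le_trans (Im_le_normc _); apply: le_trans (ler_norm _).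
  have -> : Im (WH + 'i%C * WV) = Im WH + Re WV.
    by rewrite cImD cImM /= mul0r mul1r add0r.
  have low (f : R -> R) x y : continuous f -> y - x = 2 * r -> (forall t, x <= t <= y
    -> r^-1 <= f t) ->
      2 <= rint f x y.
    move=> cf xy Hf; apply: (@le_trans _ _ (rint (fun=> r^-1) x y)).
      rewrite rint_cst; last by lra.
      by rewrite xy mulrC mulfK ?gt_eqF.
    by apply: rint_le => //; exact: cst_cont.
  have est (u : R) : `|u| <= r -> r^-1 <= 2 * r / (u ^+ 2 + r ^+ 2).
    move=> ur; have u2 : u ^+ 2 <= r ^+ 2 by rewrite -[u ^+ 2]real_normK ?num_real //
      lerXn2r ?nnegrE // ltW.
    have s0 : 0 < u ^+ 2 + r ^+ 2 by rewrite ltr_wpDl ?sqr_ge0 // exprn_gt0.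
    rewrite ler_pdivlMr // mulrC ler_pdivrMr //; lra.
  have -> : (4 : R) = 2 + 2 by lra.
  apply: lerD; apply: low; [exact: rH.2|by rewrite /a /b; ring| |exact: rV.1|by rewrite
    /c /d; ring|].
    move=> x /andP[xa xb].
    apply: le_trans (est (x - p1) _) _.
      by rewrite ler_norml; apply/andP; move: xa xb; rewrite /a /b; split; lra.
    rewrite /h /hline /p /c /d /= le_eqVlt; apply/orP; left; apply/eqP.
    have -> : p2 - r - p2 = - r by ring.
    have -> : p2 + r - p2 = r by ring.
    by rewrite sqrrN; ring.
  move=> y /andP[yc yd].
  apply: le_trans (est (y - p2) _) _.
    by rewrite ler_norml; apply/andP; move: yc yd; rewrite /c /d; split; lra.
  rewrite /h /vline /p /a /b /= le_eqVlt; apply/orP; left; apply/eqP.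
  have -> : p1 - r - p1 = - r by ring.
  have -> : p1 + r - p1 = r by ring.
  by rewrite sqrrN [_ ^+ 2 + r ^+ 2]addrC; ring.
have far z : r <= normc (z - p) -> normc (k z * h z) <= e / r.
  move=> rz; rewrite normcM /h normcV; apply: ler_pM; rewrite ?invr_ge0 ?normc_ge0 //.
    have := HM z; rewrite expr0 mulr1; apply.
    have := lec_normcD z (- p); rewrite normcNE => H.
    by move: rz; rewrite /r; lra.
  by rewrite lef_pV2 ?posrE // (lt_le_trans r0).
have farB z w : r <= normc (z - p) -> r <= normc (w - p) ->
    normc (k z * h z - k w * h w) <= 2 * (e / r).
  move=> /far Hz /far Hw; apply: le_trans (lec_normcD _ _) _.
  by rewrite normcNE; lra.
have fc x : r <= normc (hline c x - p).
  apply: le_trans (Im_le_normc _); rewrite /hline /p /c /=.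
  have -> : p2 - r - p2 = - r by ring.
  by rewrite normrN ger0_norm // ltW.
have fd x : r <= normc (hline d x - p).
  apply: le_trans (Im_le_normc _); rewrite /hline /p /d /=.
  have -> : p2 + r - p2 = r by ring.
  by rewrite ger0_norm // ltW.
have fa x : r <= normc (vline a x - p).
  apply: le_trans (Re_le_normc _); rewrite /vline /p /a /=.
  have -> : p1 - r - p1 = - r by ring.
  by rewrite normrN ger0_norm // ltW.
have fb x : r <= normc (vline b x - p).
  apply: le_trans (Re_le_normc _); rewrite /vline /p /b /=.
  have -> : p1 + r - p1 = r by ring.
  by rewrite ger0_norm // ltW.
have X16 : normc (XH + 'i%C * XV) <= 16 * e.
  apply: le_trans (lec_normcD _ _) _.
  rewrite normcM [normc 'i%C]/normc /= expr0n expr1n add0r sqrtr1 mul1r.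
  have H1 : normc XH <= 2 * (2 * (e / r)) * (b - a).
    by apply: cint_bound => // x _; exact: farB.
  have H2 : normc XV <= 2 * (2 * (e / r)) * (d - c).
    by apply: cint_bound => // x _; exact: farB.
  have E1 : 2 * (2 * (e / r)) * (b - a) = 8 * e.
    by rewrite /a /b; field; rewrite gt_eqF.
  have E2 : 2 * (2 * (e / r)) * (d - c) = 8 * e.
    by rewrite /c /d; field; rewrite gt_eqF.
  have -> : 16 * e = 8 * e + 8 * e by ring.
  by move: H1 H2; rewrite E1 E2; exact: lerD.
have e16 : 4 * e * 4 = 16 * e by ring.
rewrite -(@ler_pM2r _ 4) // e16; apply: le_trans X16; rewrite -E normcM.
by apply: ler_wpM2l => //; exact: normc_ge0.
Qed.

Lemma quasi_holo_zero k : quasi_holo k -> little_at_infty k 0 -> forall z, k z = 0.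
Proof.
move=> qk k0 z; apply: (@ccont_dense_eq k (fun=> 0)); first by case: qk.
  exact: ccont_cst.
move=> e e0; have [w [wz w0 hw]] := quasi_holo_dense z qk e0.
by exists w => //; exact: quasi_holo_vanish.
Qed.

(** Each difference quotient lowers the growth by one power of $z$; the second one is $o(1)$ and
    vanishes by [quasi_holo_zero]. *)
Lemma quasi_holo_affine g : quasi_holo g -> little_at_infty g 2 ->
  exists A B, forall z, g z = A + B * z.
Proof.
move=> qg g2.
have [a [_ a0 [phi dphi]]] := quasi_holo_dense 0 qg ltr01.
have qphi := quasi_holo_quotient qg dphi.
have phi1 := little_quotient dphi g2.
have [b [_ b0 [psi dpsi]]] := quasi_holo_dense 0 qphi ltr01.
have qpsi := quasi_holo_quotient qphi dpsi.
have psi0 := little_quotient dpsi phi1.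
have Z := quasi_holo_zero qpsi psi0.
exists (g a - phi b * a), (phi b) => z.
case: dphi => _ ->; case: dpsi => _ ->; rewrite Z mul0r addr0; ring.
Qed.

End Liouville.

(** * Quasi-periodic functions *)

Section QPeriodic.
Variable R : realType.
Local Notation K := R[i].
Variable q : K.
Hypotheses (q0 : q != 0) (q1 : normc q < 1).
Implicit Types (f g m F D : K -> K) (z w p : K) (e : R).

Lemma pow_lt (r e : R) : 0 <= r -> r < 1 -> 0 < e -> exists n, r ^+ n < e.
Proof.
move=> r0 r1 e0.
have /cvg_expr : `|r| < 1 by rewrite ger0_norm.
move=> /(@cvgrPdist_lt R R^o) /(_ e e0) [n _ Hn]; exists n.
by have := Hn n (leqnn n); rewrite /= sub0r normrN ger0_norm // exprn_ge0.
Qed.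

Lemma pow_bracket (r x : R) : 0 < r -> r < 1 -> 0 < x -> x <= 1 ->
  exists k, (r ^+ k.+1 < x) && (x <= r ^+ k).
Proof.
move=> r0 r1 x0 x1.
have ex : exists k, r ^+ k.+1 < x.
  have [n Hn] := pow_lt (ltW r0) r1 x0; exists n; apply: le_lt_trans Hn.
  by rewrite ler_wiXn2l ?ltW // leqnSn.
case: (ex_minnP ex) => k Hk Hmin; exists k; rewrite Hk /=.
case: k Hk Hmin => [|k] _ Hmin; first by rewrite expr0.
by rewrite leNgt; apply/negP => /Hmin; rewrite ltnn.
Qed.

Let r := normc q.
Let r0 : 0 < r. Proof. by rewrite normc_gt0. Qed.

(** A point near 0 is $q^kw$ with $w$ in the annulus $|q|\le|w|\le1$ and [k] large, and
    $G(q^kw)=\nu^kG(w)$. *)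
Lemma quasi_small (G : K -> K) (nu : K) (B : R) :
  (forall z, z != 0 -> G (q * z) = nu * G z) -> normc nu < 1 ->
  (forall z, r <= normc z <= 1 -> normc (G z) <= B) ->
  forall e, 0 < e -> exists2 d, 0 < d &
    forall z, z != 0 -> normc z < d -> normc (G z) < e.
Proof.
move=> Gq nu1 GB e e0.
have B0 : 0 <= B.
  by apply: le_trans (normc_ge0 (G 1)) (GB 1 _); rewrite normc1 lexx ltW.
have [N HN] : exists N, normc nu ^+ N < e / (B + 1).
  by apply: pow_lt => //; [exact: normc_ge0|rewrite divr_gt0 // ltr_wpDl].
exists (r ^+ N); first by rewrite exprn_gt0.
move=> z z0 zN.
have z1 : normc z <= 1.
  by apply: le_trans (ltW zN) _; rewrite exprn_ile1 // ltW.
have zp : 0 < normc z by rewrite normc_gt0.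
have [k /andP[kz zk]] := pow_bracket r0 q1 zp z1.
have Nk : (N <= k)%N.
  have H : r ^+ k.+1 < r ^+ N by exact: lt_trans zN.
  by rewrite leqNgt; apply: contraL H => kN; rewrite -leNgt ler_wiXn2l // ltW.
pose w := z / q ^+ k.
have w0 : w != 0 by rewrite mulf_neq0 // invr_neq0 // expf_neq0.
have zE : z = q ^+ k * w by rewrite mulrC divfK // expf_neq0.
have Gk j : G (q ^+ j * w) = nu ^+ j * G w.
  elim: j => [|j IH]; first by rewrite !expr0 !mul1r.
  have -> : q ^+ j.+1 * w = q * (q ^+ j * w) by rewrite exprS mulrA.
  have w1 : q ^+ j * w != 0 by rewrite mulf_neq0 // expf_neq0.
  by rewrite (Gq _ w1) IH exprS mulrA.
have wB : normc (G w) <= B.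
  have rk0 : 0 < r ^+ k by rewrite exprn_gt0.
  apply: GB; rewrite /w normcM normcV normcX -/r.
  rewrite ler_pdivlMr // ler_pdivrMr // mul1r zk andbT -exprS; exact: ltW.
rewrite zE Gk normcM normcX.
apply: (@le_lt_trans _ _ (normc nu ^+ N * B)).
  apply: ler_pM => //; rewrite ?exprn_ge0 ?normc_ge0 //.
  by rewrite ler_wiXn2l ?normc_ge0 // ltW.
apply: (@le_lt_trans _ _ (e / (B + 1) * B)).
  by apply: ler_wpM2r => //; exact: ltW.
rewrite -mulrA gtr_pMr // ltr_pdivrMl; lra.
Qed.

(** Compactness by bisection of the square $[-1,1]^2$: boundedness passes from quarters to the
    whole, continuity gives it locally, and small rectangles around 0 miss the annulus. *)
Lemma annulus_bounded g (s : R) : 0 < s -> (forall z, z != 0 -> ccont g z) ->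
  exists B, forall z, s <= normc z <= 1 -> normc (g z) <= B.
Proof.
move=> s0 cg.
have [B HB] : exists B, forall x y, -1 <= x <= 1 -> -1 <= y <= 1 ->
    s <= normc (x +i* y)%C -> normc (g (x +i* y)%C) <= B.
  apply: (@cousin_rectangle R (fun a b c d => exists B, forall x y, a <= x <= b ->
    c <= y <= d -> s <= normc (x +i* y)%C -> normc (g (x +i* y)%C) <= B)); try lra.
  - move=> a b c d ab cd [B1 H1] [B2 H2] [B3 H3] [B4 H4].
    exists (Num.max (Num.max B1 B2) (Num.max B3 B4)) => x y /andP[ax xb] /andP[cy yd] sz.
    rewrite !le_max.
    have [xm|/ltW xm] := leP x ((a + b) / 2); have [yn|/ltW yn] := leP y ((c + d) / 2).
    + by rewrite H1 ?ax ?cy.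
    + by rewrite H3 ?ax ?yn ?orbT.
    + by rewrite H2 ?xm ?cy ?orbT.
    + by rewrite H4 ?xm ?yn ?orbT.
  move=> x y _ _; have [xy0|xy0] := eqVneq (x +i* y)%C 0.
    exists (s / 2); first by rewrite divr_gt0.
    move=> a b c d /andP[_ ax] /andP[xb _] /andP[_ cy] /andP[yd _] ba dc.
    case: xy0 => x0 y0; exists 0 => x1 y1 /andP[ax1 x1b] /andP[cy1 y1d].
    rewrite leNgt => /negP[].
    apply: le_lt_trans (normc_le_ReIm _) _ => /=.
    have h1 : `|x1| <= b - a by rewrite ler_norml; apply/andP; split; lra.
    have h2 : `|y1| <= d - c by rewrite ler_norml; apply/andP; split; lra.
    lra.
  have /contcP /(_ 1 ltr01) [d d0 Hd] := cg _ xy0.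
  exists (d / 2); first by rewrite divr_gt0.
  move=> a b c d' /andP[_ ax] /andP[xb _] /andP[_ cy] /andP[yd _] ba dc.
  exists (normc (g (x +i* y)%C) + 1) => x1 y1 /andP[ax1 x1b] /andP[cy1 y1d] _.
  rewrite -lerBlDl; apply: le_trans (le_normcB _ _) _; apply/ltW/Hd.
  apply: le_lt_trans (normc_le_ReIm _) _ => /=.
  have h1 : `|x1 - x| <= b - a by rewrite ler_norml; apply/andP; split; lra.
  have h2 : `|y1 - y| <= d' - c by rewrite ler_norml; apply/andP; split; lra.
  lra.
exists B => -[x y] /andP[sz z1]; apply: HB => //.
  by rewrite -ler_norml; exact: le_trans (Re_le_normc _) z1.
by rewrite -ler_norml; exact: le_trans (Im_le_normc _) z1.
Qed.

Lemma holo_exprn n z : holo_at (fun w : K => w ^+ n) z.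
Proof.
elim: n => [|n IH]; first exact: (holo_cst (1 : K) z).
by under eq_fun do rewrite exprS; exact: (holoM (holo_id z) IH).
Qed.

Lemma holo_exprz (n : int) z : z != 0 -> holo_at (fun w : K => w ^ n) z.
Proof.
by move=> z0; case: n => n; [|apply: holoV; [by rewrite expf_neq0|]]; exact: holo_exprn.
Qed.

(* z ^ (1 - n) m z, for suitable n, is o(1) at 0 and o(z ^ 2) at infinity. *)
Lemma qperiodic_monomial m mu : mu != 0 ->
  (forall z, z != 0 -> ccont m z) ->
  (forall p, p != 0 -> exists2 e : R, 0 < e &
     forall w, w != p -> normc (w - p) < e -> holo_at m w) ->
  (forall z, z != 0 -> m (q * z) = mu * m z) ->
  exists (n : int) (beta : K),
    (forall z, z != 0 -> m z = beta * z ^ n) /\ (beta = 0 \/ mu = q ^ n).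
Proof.
move=> mu0 cm hm mq.
have mp : 0 < normc mu by rewrite normc_gt0.
(* This is the multiplier $\lambda$ of $N(z)=z^{1-n}m(z)$. Below 1 in modulus it makes [N] tend to 0
   at 0; above $|q|^2$ it makes $N(z)/z^2$ tend to 0 at infinity. *)
have [n /andP[n1 n2]] : exists n : int, (r ^+ 2 < normc (q ^ (1 - n) * mu)) && (normc
  (q ^ (1 - n) * mu) < 1).
  have [mu1|mu1] := leP (normc mu) 1.
    have [k /andP[k1 k2]] := pow_bracket r0 q1 mp mu1.
    exists k%:Z; have rk0 : 0 < r ^+ k by rewrite exprn_gt0.
    rewrite expfzDr // expr1z normcM normcM -exprz_inv -exprnP exprVn normcV normcX -/r.
    rewrite -mulrA [_^-1 * _]mulrC expr2 ltr_pM2l // ltr_pdivlMr // -exprS k1 /=.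
    rewrite mulrA ltr_pdivrMr // mul1r; apply: le_lt_trans (_ : r * r ^+ k < _).
      by rewrite ler_pM2l.
    by rewrite gtr_pMl.
  have mui : (normc mu)^-1 <= 1 by rewrite invf_le1 ?ltW // (lt_trans ltr01).
  have mip : 0 < (normc mu)^-1 by rewrite invr_gt0.
  have [k /andP[k1 k2]] := pow_bracket r0 q1 mip mui.
  exists (- k%:Z); rewrite opprK expfzDr // expr1z normcM normcM -exprnP normcX -/r.
  move: k1 k2; rewrite -div1r ltr_pdivlMr // ler_pdivrMr // -exprS => -> k2.
  rewrite andbT [r ^+ k.+1]exprS -mulrA expr2 ltr_pM2l //; exact: (lt_le_trans q1).
set lam := q ^ (1 - n) * mu in n1 n2.
pose N z := if z == 0 then 0 else z ^ (1 - n) * m z.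
have N0 : N 0 = 0 by rewrite /N eqxx.
have NE z : z != 0 -> N z = z ^ (1 - n) * m z by rewrite /N => /negPf ->.
have Nq z : z != 0 -> N (q * z) = lam * N z.
  move=> z0; rewrite !NE ?mulf_neq0 // mq // exprzMl ?unitfE // /lam; ring.
have nb z : z != 0 -> exists2 d : K, 0 < d &
    forall w, `|w - z| < d -> w ^ (1 - n) * m w = N w.
  move=> z0; exists `|z|; first by rewrite normr_gt0.
  move=> w wz; rewrite NE //; apply: contraTneq wz => ->.
  by rewrite sub0r normrN ltxx.
have cN z : z != 0 -> ccont N z.
  move=> z0; have [d d0 Hd] := nb z z0; apply: (ccont_near d0 Hd).
  exact: (ccontM (holo_ccont (holo_exprz _ z0)) (cm z z0)).
have hN z : z != 0 -> holo_at m z -> holo_at N z.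
  move=> z0 hz; have [d d0 Hd] := nb z z0; apply: (holo_near d0 Hd).
  exact: (holoM (holo_exprz _ z0) hz).
have [B HB] := annulus_bounded r0 cN.
have small := quasi_small Nq n2 HB.
have qN : quasi_holo N.
  split=> [z|p p0].
    have [->|] := eqVneq z 0; last exact: cN.
    apply/contcP => e e0; have [d d0 Hd] := small e e0; exists d => // w.
    rewrite N0 !subr0; have [->|w0 /Hd] := eqVneq w 0; first by rewrite N0 normc0.
    exact.
  have [e e0 He] := hm p p0.
  exists (Num.min e (normc p)); first by rewrite lt_min e0 normc_gt0.
  move=> w wp; rewrite lt_min => /andP[we wp']; apply: hN; last exact: He.
  by apply: contraTneq wp' => ->; rewrite sub0r normcNE ltxx.
have lN : little_at_infty N 2.
  (* The inversion turns growth at infinity into decay at 0, with multiplier $q^2/\lambda$, so that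
     [quasi_small] applies again. *)
  pose G z := N z^-1 * z ^+ 2.
  have cG z : z != 0 -> ccont G z.
    move=> z0; apply: ccontM; last exact: holo_ccont (holo_exprn 2 z).
    have cV := ccontV z0 (@ccont_id _ z).
    exact: (ccont_comp cV (cN z^-1 (invr_neq0 z0))).
  have [B' HB'] := annulus_bounded r0 cG.
  have Gq z : z != 0 -> G (q * z) = (q ^+ 2 / lam) * G z.
    move=> z0; have lam0 : lam != 0 by rewrite /lam mulf_neq0 // expfz_neq0.
    have E : N z^-1 = lam * N (q * z)^-1.
      rewrite -Nq ?invr_neq0 ?mulf_neq0 //; congr N; field; rewrite z0 q0 //.
    rewrite /G E; field; exact: lam0.
  have nu1 : normc (q ^+ 2 / lam) < 1.
    by rewrite normcM normcV normcX -/r ltr_pdivrMr ?mul1r // (lt_trans _ n1) //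
      exprn_gt0.
  move=> e e0; have [d d0 Hd] := quasi_small Gq nu1 HB' e0.
  exists d^-1; first by rewrite invr_gt0.
  move=> z dz; have z0 : z != 0.
    by rewrite -normc_gt0; apply: lt_trans dz; rewrite invr_gt0.
  have zp : 0 < normc z by rewrite normc_gt0.
  have := Hd z^-1 (invr_neq0 z0); rewrite normcV invf_plt ?posrE // => /(_ dz) /ltW.
  rewrite /G invrK normcM normcX normcV exprVn ler_pdivrMr ?exprn_gt0 //.
have [A [C NAC]] := quasi_holo_affine qN lN.
(* Hence $N(z)=Cz$, that is $m(z)=Cz^n$; evaluating the functional equation at 1 then gives
   $\mu=q^n$ unless $C=0$. *)
have A0 : A = 0 by have := NAC 0; rewrite N0 mulr0 addr0.
have mE z : z != 0 -> m z = C * z ^ n.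
  move=> z0; have := NAC z; rewrite NE // A0 add0r => E.
  have zz : z ^ (1 - n) != 0 by rewrite expfz_neq0.
  apply: (mulfI zz); rewrite E mulrCA -expfzDr // subrK expr1z; ring.
exists n, C; split=> //.
have [->|C0] := eqVneq C 0; [by left|right].
have := mq 1 (oner_neq0 _); rewrite !mE ?oner_neq0 ?mulr1 // exp1rz mulr1.
by rewrite mulrC => /(mulIf C0).
Qed.

(* L'Hopital at the simple zeros of the denominator *)
Lemma qperiodic_quotient F D (s : K -> K) a b : a != 0 -> b != 0 ->
  (forall z, z != 0 -> s z != 0) ->
  (forall z, z != 0 -> holo_at F z) -> (forall z, z != 0 -> holo_at D z) ->
  (forall z, z != 0 -> F (q * z) = a * s z * F z) ->
  (forall z, z != 0 -> D (q * z) = b * s z * D z) ->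
  (forall z, z != 0 -> D z = 0 -> F z = 0 /\ exists2 psi, cdiff D z psi & psi z != 0) ->
  exists (n : int) (beta : K),
    (forall z, z != 0 -> F z = beta * z ^ n * D z) /\ (beta = 0 \/ a = b * q ^ n).
Proof.
move=> a0 b0 s0 hF hD Fq Dq simple.
pose L z := [set l | exists phi psi, [/\ cdiff F z phi, cdiff D z psi, psi z != 0 & l =
  phi z / psi z]].
pose m z := if D z == 0 then xget 0 (L z) else F z / D z.
have Lz z : z != 0 -> D z = 0 -> exists phi psi, [/\ cdiff F z phi, cdiff D z psi,
    psi z != 0 & m z = phi z / psi z].
  move=> z0 Dz; have [Fz [psi dpsi psi0]] := simple z z0 Dz.
  have [phi dphi] := hF z z0.
  have [p [s' [dp ds s'0 E]]] : L z (xget 0 (L z)).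
    by apply: xgetPex; exists (phi z / psi z), phi, psi.
  by exists p, s'; split => //; rewrite /m Dz eqxx.
have mD z : D z != 0 -> m z = F z / D z by rewrite /m => /negPf ->.
have nbD z : z != 0 -> exists2 d : K, 0 < d & forall w, w != z -> `|w - z| < d -> D w
  != 0.
  move=> z0; have [Dz|Dz] := eqVneq (D z) 0; last first.
    have [d d0 Hd] := ccont_neq0 (holo_ccont (hD z z0)) Dz.
    by exists d => // w _; exact: Hd.
  have [_ [psi [cpsi DE] psi0]] := simple z z0 Dz.
  have [d d0 Hd] := ccont_neq0 cpsi psi0.
  exists d => // w wz /Hd psiw; rewrite DE Dz add0r mulf_neq0 // subr_eq0 //.
have hm z : z != 0 -> D z != 0 -> holo_at m z.
  move=> z0 Dz; have [d d0 Hd] := ccont_neq0 (holo_ccont (hD z z0)) Dz.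
  apply: (@holo_near _ (fun w => F w * (D w)^-1) m z d d0).
    by move=> w /Hd Dw; rewrite mD.
  exact: (holoM (hF z z0) (holoV Dz (hD z z0))).
have cm z : z != 0 -> ccont m z.
  move=> z0; have [Dz|Dz] := eqVneq (D z) 0; last exact: holo_ccont (hm z z0 Dz).
  have [Fz _] := simple z z0 Dz.
  have [phi [psi [[cphi FE] [cpsi DE] psi0 mE]]] := Lz z z0 Dz.
  have [d d0 Hd] := ccont_neq0 cpsi psi0.
  apply: (@ccont_near _ (fun w => phi w * (psi w)^-1) m z d d0).
    move=> w /Hd psiw; have [->|wz] := eqVneq w z; first by rewrite mE.
    have wz' : w - z != 0 by rewrite subr_eq0.
    have Dw : D w != 0 by rewrite DE Dz add0r mulf_neq0.
    by rewrite mD // FE DE Fz Dz !add0r invfM mulrACA mulfV // mulr1.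
  exact: (ccontM cphi (ccontV psi0 cpsi)).
have R_of (d : K) : 0 < d -> exists2 e : R, 0 < e & d = e%:C%C.
  move=> d0; have [e dE] : exists k, d = (k%:C)%C by apply/complex_realP/gtr0_real.
  by exists e => //; move: d0; rewrite dE ltcR.
have ab0 : a / b != 0 by rewrite mulf_neq0 // invr_neq0.
have [||n [beta [H1 H2]]] := @qperiodic_monomial m (a / b) ab0 cm.
- move=> p p0; have [d /R_of [e e0 ->] Hd] := nbD p p0.
  exists (Num.min e (normc p)); first by rewrite lt_min e0 normc_gt0.
  move=> w wp; rewrite lt_min => /andP[we wp']; apply: hm.
    by apply: contraTneq wp' => ->; rewrite sub0r normcNE ltxx.
  by apply: Hd => //; rewrite normC_normc ltcR.
(* Off the zeros of [D] the equation follows by division. It extends to [z] by continuity along the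
   points [z + t], with [t] positive and so small that [D] does not vanish there. *)
- move=> z z0; apply: (@ccont_dense_eq _ (m \o (fun w => q * w)) (fun w => a / b * m w)).
  + apply: ccont_comp; last by apply: cm; rewrite mulf_neq0.
    exact: (ccontM (@ccont_cst _ q z) (@ccont_id _ z)).
  + exact: (ccontM (@ccont_cst _ (a / b) z) (cm z z0)).
  have [d /R_of [e e0 ->] Hd] := nbD z z0.
  move=> e' e'0; pose t := Num.min (Num.min e e') (normc z) / 2.
  have t0 : 0 < t by rewrite divr_gt0 // !lt_min e0 e'0 normc_gt0.
  have [te te' tz] : [/\ t < e, t < e' & t < normc z].
    have : Num.min (Num.min e e') (normc z) <= e by rewrite !ge_min lexx.
    have : Num.min (Num.min e e') (normc z) <= e' by rewrite !ge_min lexx orbT.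
    have : Num.min (Num.min e e') (normc z) <= normc z by rewrite !ge_min lexx orbT.
    by move: t0; rewrite /t; set u := Num.min _ _ => *; split; lra.
  have wz : z + t%:C%C - z = t%:C%C by rewrite addrAC subrr add0r.
  exists (z + t%:C%C); first by rewrite wz normc_pos_real.
  have w0 : z + t%:C%C != 0.
    apply: contraTneq tz => /eqP; rewrite addr_eq0 => /eqP ->.
    by rewrite normcNE normc_pos_real // ltxx.
  have Dw : D (z + t%:C%C) != 0.
    apply: Hd; last by rewrite wz normC_normc normc_pos_real // ltcR.
    by rewrite -subr_eq0 wz -normc_eq0 normc_pos_real // gt_eqF.
  set w := z + _ in w0 Dw *.
  have sw := s0 _ w0; have Dqw : D (q * w) != 0 by rewrite Dq // !mulf_neq0.
  rewrite /= (mD _ Dqw) (mD _ Dw) Fq // Dq //; field.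
  by rewrite Dw b0 sw.
exists n, beta; split; last first.
  case: H2 => [->|H2]; [by left|right].
  by rewrite -H2 mulrC divfK.
move=> z z0; rewrite -H1 //; have [Dz|Dz] := eqVneq (D z) 0.
  by rewrite Dz mulr0; case: (simple z z0 Dz).
by rewrite mD // divfK.
Qed.

End QPeriodic.

(** * Theta functions *)

Section ComplexLimits.
Variable R : realType.
Local Notation K := R[i].
Local Notation Re := complex.Re.
Local Notation Im := complex.Im.
Implicit Types (u v : nat -> K) (l m : K).

Record clim u l : Prop := CLim { climW : (u : nat -> K^o) @ \oo --> (l : K^o) }.

Lemma climP u l : clim u l <-> forall e : R, 0 < e ->
  exists N, forall n, (N <= n)%N -> normc (u n - l) < e.
Proof.
split.
- move=> [ul] e e0.
  have e0' : (0 : K) < e%:C%C by rewrite ltcR.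
  have /(@cvgrPdist_lt K K^o nat (nbhs \oo) _ u l) /(_ _ e0') [N _ HN] := ul.
  exists N => n /HN; rewrite /= distrC => H.
  by rewrite -ltcR -normC_normc.
- move=> H; split; apply/(@cvgrPdist_lt K K^o nat (nbhs \oo) _ u l) => e e0.
  have [eR eE] : exists k, e = (k%:C)%C by apply/complex_realP/gtr0_real.
  move: e0; rewrite eE ltcR => /H [N HN]; exists N => // n /HN h.
  by rewrite /= distrC normC_normc ltcR.
Qed.

Lemma clim_cst l : clim (fun=> l) l.
Proof. by split; exact: cvg_cst. Qed.

Lemma climD u v l m : clim u l -> clim v m -> clim (fun n => u n + v n) (l + m).
Proof. by move=> [cu] [cv]; split; exact: (@cvgD K K^o nat (nbhs \oo) _ u v l m cu cv).
  Qed.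

Lemma climM u v l m : clim u l -> clim v m -> clim (fun n => u n * v n) (l * m).
Proof. by move=> [cu] [cv]; split; exact: (@cvgM K nat (nbhs \oo) _ u v l m cu cv). Qed.

Lemma climB u v l m : clim u l -> clim v m -> clim (fun n => u n - v n) (l - m).
Proof. by move=> [cu] [cv]; split; exact: (@cvgB K K^o nat (nbhs \oo) _ u v l m cu cv).
  Qed.

Lemma clim_unique u l m : clim u l -> clim u m -> l = m.
Proof.
move=> /climP cl /climP cm; apply/eqP; rewrite -subr_eq0 -normc_eq0.
rewrite eq_le normc_ge0 andbT; apply: contraT; rewrite -ltNge => lm.
have e0 : 0 < normc (l - m) / 2 by rewrite divr_gt0.
have [N1 H1] := cl _ e0; have [N2 H2] := cm _ e0.
have h1 := H1 (maxn N1 N2) (leq_maxl _ _); have h2 := H2 (maxn N1 N2) (leq_maxr _ _).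
have : normc (l - m) <= normc (u (maxn N1 N2) - m) + normc (u (maxn N1 N2) - l).
  rewrite -(normcB l); apply: le_trans (lec_normcD _ _).
  by have -> : u (maxn N1 N2) - m + (l - u (maxn N1 N2)) = l - m by ring.
rewrite leNgt => /negP[]; rewrite [ltRHS](splitr (normc (l - m))); exact: ltrD.
Qed.

Lemma clim_lim u l : clim u l -> lim ((u : nat -> K^o) @ \oo) = l.
Proof. by move=> [ul]; apply: cvg_lim => //; exact: norm_hausdorff. Qed.

Lemma clim_le u l (c : R) : clim u l -> (forall n, normc (u n) <= c) -> normc l <= c.
Proof.
move=> /climP ul uc; rewrite leNgt; apply/negP => cl.
have [N HN] := ul _ (let x : 0 < normc l - c := etrans (subr_gt0 _ _) cl in x).
have := HN N (leqnn N); rewrite ltNge normcB => /negP[].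
apply: le_trans (le_normcB _ _); rewrite lerB //; exact: uc.
Qed.

Lemma clim_ge u l (c : R) : clim u l -> (forall n, c <= normc (u n)) -> c <= normc l.
Proof.
move=> /climP ul uc; rewrite leNgt; apply/negP => cl.
have [N HN] := ul _ (let x : 0 < c - normc l := etrans (subr_gt0 _ _) cl in x).
have := HN N (leqnn N); rewrite ltNge => /negP[].
apply: le_trans (le_normcB _ _); rewrite lerB //; exact: uc.
Qed.

Lemma clim_shift u l N : clim u l -> clim (fun n => u (n + N)%N) l.
Proof.
move=> /climP H; apply/climP => e /H [M HM]; exists M => n Mn.
by apply: HM; apply: leq_trans Mn (leq_addr _ _).
Qed.

(** The telescoping series of the real and the imaginary parts converge absolutely, by comparison
    with a geometric series. *)
Lemma clim_geometric u (c r : R) : 0 <= r -> r < 1 ->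
  (forall n, normc (u n.+1 - u n) <= c * r ^+ n) -> exists l, clim u l.
Proof.
move=> r0 r1 H.
have real (f : nat -> R) : (forall n, `|f n.+1 - f n| <= c * r ^+ n) -> cvgn f.
  move=> Hf; have cS : cvgn (series (telescope f)).
    apply: normed_cvg.
    apply: (@series_le_cvg R _ (geometric c r)).
    - by move=> n; rewrite /= normr_ge0.
    - by move=> n; apply: le_trans (Hf n); exact: normr_ge0.
    - by move=> n; rewrite /= /telescope /=; exact: Hf.
    by apply: is_cvg_geometric_series; rewrite ger0_norm.
  have -> : f = (fun n => f 0%N + series (telescope f) n).
    by apply/funext => n; rewrite eq_sum_telescope.
  apply: (@is_cvgD R R^o nat (nbhs \oo) _ (fun=> f 0%N) (series (telescope f))).
    exact: is_cvg_cst.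
  exact: cS.
have cRe : cvgn (fun n => Re (u n)).
  apply: real => n; apply: le_trans (H n); apply: le_trans (Re_le_normc _).
  by case: (u n.+1) => ? ?; case: (u n).
have cIm : cvgn (fun n => Im (u n)).
  apply: real => n; apply: le_trans (H n); apply: le_trans (Im_le_normc _).
  by case: (u n.+1) => ? ?; case: (u n).
move: cRe cIm => /cvg_ex [a /(@cvgrPdist_lt R R^o) Ha] /cvg_ex [b /(@cvgrPdist_lt R
  R^o) Hb].
exists (a +i* b)%C; apply/climP => e e0.
have e20 : 0 < e / 2 by rewrite divr_gt0.
have [N1 _ H1] := Ha _ e20; have [N2 _ H2] := Hb _ e20.
exists (maxn N1 N2) => n; rewrite geq_max => /andP[/H1 h1 /H2 h2].
apply: le_lt_trans (normc_le_ReIm _) _; rewrite [ltRHS](splitr e).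
by move: h1 h2; case: (u n) => x y /= h1 h2; rewrite distrC in h1; rewrite distrC in
  h2; exact: ltrD.
Qed.

End ComplexLimits.

(** * The q-Pochhammer symbol: zeros and holomorphy *)

Section QPochhammer.
Variable R : realType.
Local Notation K := R[i].
Variable q : K.
Hypotheses (q0 : q != 0) (q1 : normc q < 1).
Implicit Types (z w : K).
Let r := normc q.
Let r0 : 0 < r. Proof. by rewrite normc_gt0. Qed.
Let r0' : 0 <= r. Proof. exact: ltW. Qed.

Definition qpart n z : K := \prod_(0 <= k < n) (1 - q ^+ k * z).

Lemma qpart0 z : qpart 0 z = 1. Proof. by rewrite /qpart big_nil. Qed.

Lemma qpartS n z : qpart n.+1 z = qpart n z * (1 - q ^+ n * z).
Proof. by rewrite /qpart big_nat_recr. Qed.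

Lemma qpartSl n z : qpart n.+1 z = (1 - z) * qpart n (q * z).
Proof.
elim: n => [|n IH]; first by rewrite qpartS !qpart0 expr0 mul1r mul1r mulr1.
by rewrite qpartS IH qpartS -!mulrA exprSr -mulrA.
Qed.

(** The partial product of $(-x;|q|)_\infty$, a majorant of [qpart n z] for $|z|\le x$. *)
Definition qmaj n (x : R) : R := \prod_(0 <= k < n) (1 + r ^+ k * x).

Lemma qmajS n x : qmaj n.+1 x = qmaj n x * (1 + r ^+ n * x).
Proof. by rewrite /qmaj big_nat_recr. Qed.

Definition qgeo n : R := \sum_(0 <= k < n) r ^+ k.

Lemma qgeoS n : qgeo n.+1 = qgeo n + r ^+ n.
Proof. by rewrite /qgeo big_nat_recr. Qed.

Lemma qgeo_ge0 n : 0 <= qgeo n.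
Proof. by apply: sumr_ge0 => k _; rewrite exprn_ge0. Qed.

Lemma qgeo_le n : qgeo n <= (1 - r)^-1.
Proof.
have H : qgeo n * (1 - r) = 1 - r ^+ n.
  elim: n => [|n IH]; first by rewrite /qgeo big_nil mul0r expr0 subrr.
  by rewrite qgeoS mulrDl IH exprS; ring.
by rewrite -[leRHS]mul1r ler_pdivlMr ?subr_gt0 // H gerBl exprn_ge0.
Qed.

Lemma qmaj_ge1 n x : 0 <= x -> 1 <= qmaj n x.
Proof.
move=> x0; elim: n => [|n IH]; first by rewrite /qmaj big_nil.
by rewrite qmajS mulr_ege1 // lerDl mulr_ge0 // exprn_ge0.
Qed.

Lemma qmaj_le n x : 0 <= x -> qmaj n x <= expR (x / (1 - r)).
Proof.
move=> x0; apply: (@le_trans _ _ (expR (x * qgeo n))); last first.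
  by rewrite ler_expR ler_wpM2l // qgeo_le.
elim: n => [|n IH]; first by rewrite /qmaj /qgeo !big_nil mulr0 expR0.
rewrite qmajS qgeoS [x * (_ + _)]mulrDr expRD; apply: ler_pM => //.
- exact: le_trans (qmaj_ge1 n x0).
- by rewrite addr_ge0 // mulr_ge0 // exprn_ge0.
by rewrite [x * _]mulrC; exact: expR_ge1Dx.
Qed.

Lemma factor_le n z (x : R) : normc z <= x -> normc (1 - q ^+ n * z) <= 1 + r ^+ n * x.
Proof.
move=> zx; apply: le_trans (lec_normcD _ _) _; rewrite normcNE normc1 lerD2l.
by rewrite normcM normcX ler_wpM2l // exprn_ge0.
Qed.

Lemma qpart_le n z x : normc z <= x -> normc (qpart n z) <= qmaj n x.
Proof.
move=> zx; elim: n => [|n IH]; first by rewrite qpart0 normc1 /qmaj big_nil.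
rewrite qpartS qmajS normcM; apply: ler_pM => //; try exact: normc_ge0.
exact: factor_le.
Qed.

Lemma clim_qPochhammer z : clim (qpart ^~ z) (qPochhammer q z).
Proof.
have [|l Hl] := @clim_geometric R (qpart ^~ z) (expR (normc z / (1 - r)) * normc z) r
  r0' q1.
  move=> n; have -> : qpart n.+1 z - qpart n z = - (qpart n z * (q ^+ n * z)).
    by rewrite qpartS; ring.
  rewrite normcNE !normcM normcX -/r mulrCA [leRHS]mulrC.
  rewrite ler_pM2l ?exprn_gt0 //; apply: ler_wpM2r; first exact: normc_ge0.
  apply: le_trans (qpart_le n (lexx _)) _; exact/qmaj_le/normc_ge0.
by rewrite (_ : qPochhammer q z = l) //; exact: clim_lim.
Qed.

Lemma qPochhammer_rec z : qPochhammer q z = (1 - z) * qPochhammer q (q * z).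
Proof.
apply: (@clim_unique _ (fun n => qpart (n + 1)%N z)).
  exact: (clim_shift 1 (clim_qPochhammer z)).
under eq_fun do rewrite addn1 qpartSl.
exact: (climM (clim_cst (1 - z)) (clim_qPochhammer (q * z))).
Qed.

Lemma qPochhammer_split n z :
  qPochhammer q z = qpart n z * qPochhammer q (q ^+ n * z).
Proof.
elim: n => [|n IH]; first by rewrite qpart0 expr0 !mul1r.
by rewrite IH qPochhammer_rec qpartS exprS !mulrA.
Qed.

(** The inequality $\prod(1-a_k)\ge1-\sum a_k$ for $0\le a_k\le1$. *)
Lemma qpart_lower n z : normc z <= 1 -> 1 - qgeo n * normc z <= normc (qpart n z).
Proof.
move=> z1; elim: n => [|n IH].
  by rewrite qpart0 normc1 /qgeo big_nil mul0r subr0.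
have rz : 0 <= 1 - r ^+ n * normc z.
  by rewrite subr_ge0 mulr_ile1 ?exprn_ge0 ?normc_ge0 // exprn_ile1 // ltW.
have low : 1 - r ^+ n * normc z <= normc (1 - q ^+ n * z).
  by have := le_normcB 1 (q ^+ n * z); rewrite normc1 normcM normcX.
rewrite qpartS normcM qgeoS.
apply: (@le_trans _ _ (normc (qpart n z) * (1 - r ^+ n * normc z))); last first.
  by apply: ler_wpM2l low; exact: normc_ge0.
apply: (@le_trans _ _ ((1 - qgeo n * normc z) * (1 - r ^+ n * normc z))); last first.
  exact: ler_wpM2r.
have : 0 <= qgeo n * normc z * (r ^+ n * normc z).
  by rewrite !mulr_ge0 ?qgeo_ge0 ?exprn_ge0 ?normc_ge0.
by set a := qgeo n; set b := r ^+ n; set c := normc z; rewrite mulrDl; lra.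
Qed.

(** The threshold makes the sum in [qpart_lower] at most $1/2$, so all partial products, and thus
    the limit, have modulus at least $1/2$. *)
Lemma qPochhammer_neq0_small z : normc z <= (1 - r) / 2 -> qPochhammer q z != 0.
Proof.
move=> zr; rewrite -normc_gt0; apply: (@lt_le_trans _ _ (2^-1)) ; first by rewrite
  invr_gt0.
apply: (clim_ge (clim_qPochhammer z)) => n.
have z1 : normc z <= 1 by have := r0; lra.
apply: le_trans (qpart_lower n z1).
have : qgeo n * normc z <= (1 - r)^-1 * ((1 - r) / 2).
  by apply: ler_pM; rewrite ?qgeo_ge0 ?normc_ge0 ?qgeo_le.
by rewrite mulrA mulVf ?mul1r ?gt_eqF ?subr_gt0 //; lra.
Qed.

Lemma qpart_eq0 n z : qpart n z = 0 -> exists k : nat, q ^+ k * z = 1.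
Proof.
elim: n => [|n IH]; first by rewrite qpart0 => /eqP; rewrite oner_eq0.
rewrite qpartS => /eqP; rewrite mulf_eq0 => /orP[/eqP/IH //|].
by rewrite subr_eq0 => /eqP E; exists n.
Qed.

(** For large [n] the tail in [qPochhammer_split] is evaluated so near 0 that it cannot vanish; a
    zero therefore comes from one of the first [n] factors. *)
Lemma qPochhammer_eq0 z : qPochhammer q z = 0 <-> exists k : nat, q ^+ k * z = 1.
Proof.
split; last first.
  case=> k E; rewrite (qPochhammer_split k.+1) qpartS E subrr mulr0 mul0r //.
move=> E.
have [n Hn] : exists n, r ^+ n < (1 - r) / 2 / (normc z + 1).
  by apply: pow_lt => //; rewrite !divr_gt0 ?subr_gt0 // ltr_wpDl // normc_ge0.
apply: (@qpart_eq0 n); apply/eqP; move/eqP: E.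
rewrite (qPochhammer_split n) mulf_eq0 => /orP[//|] /eqP E.
have : qPochhammer q (q ^+ n * z) != 0; last by rewrite E eqxx.
apply: qPochhammer_neq0_small; rewrite normcM normcX -/r.
have z1 : 0 < normc z + 1 by rewrite ltr_wpDl // normc_ge0.
move: Hn; rewrite ltr_pdivlMr // mulrDr mulr1 => Hn.
have : 0 < r ^+ n by rewrite exprn_gt0.
by move: Hn; set a := r ^+ n * normc z; set b := r ^+ n; lra.
Qed.

(* (qpart n w - qpart n z) / (w - z) *)
Fixpoint qslope n z w : K :=
  if n is n.+1 then qslope n z w * (1 - q ^+ n * w) - q ^+ n * qpart n z else 0.

Lemma qslopeE n z w : qpart n w = qpart n z + qslope n z w * (w - z).
Proof.
elim: n => [|n IH]; first by rewrite !qpart0 /= mul0r addr0.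
by rewrite !qpartS [qpart n w]IH /=; ring.
Qed.

(** A discrete Gronwall inequality: relative to [qmaj n x], each step adds at most $c|q|^n$. It
    gives both the bound and the Lipschitz estimate for [qslope]. *)
Lemma qrec_bound (u : nat -> R) (c x : R) : 0 <= x -> 0 <= c -> u 0%N <= 0 ->
  (forall n, u n.+1 <= u n * (1 + r ^+ n * x) + r ^+ n * (c * qmaj n x)) ->
  forall n, u n <= c * qgeo n * qmaj n x.
Proof.
move=> x0 c0 u0 uS; elim=> [|n IH]; first by rewrite /qgeo big_nil mulr0 mul0r.
apply: le_trans (uS n) _; rewrite qgeoS qmajS.
have f1 : 1 <= 1 + r ^+ n * x by rewrite lerDl mulr_ge0 // exprn_ge0.
have f0 := le_trans ler01 f1.
apply: (@le_trans _ _ (c * qgeo n * qmaj n x * (1 + r ^+ n * x) + r ^+ n * (c * qmaj n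
  x) * (1 + r ^+ n * x))).
  apply: lerD; first exact: ler_wpM2r.
  have Q0 : 0 <= qmaj n x := le_trans ler01 (qmaj_ge1 n x0).
  by apply: ler_peMr f1; apply: mulr_ge0; [rewrite exprn_ge0|rewrite mulr_ge0].
by rewrite le_eqVlt; apply/orP; left; apply/eqP; ring.
Qed.

Lemma geo_maj_le c x n : 0 <= x -> 0 <= c ->
  c * qgeo n * qmaj n x <= c * (1 - r)^-1 * expR (x / (1 - r)).
Proof.
move=> x0 c0; have Q0 : 0 <= qmaj n x := le_trans ler01 (qmaj_ge1 n x0).
apply: ler_pM => //; last exact: qmaj_le.
  by rewrite mulr_ge0 // qgeo_ge0.
by rewrite ler_wpM2l // qgeo_le.
Qed.

Lemma qslope_bound x n z w : normc z <= x -> normc w <= x ->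
  normc (qslope n z w) <= (1 - r)^-1 * expR (x / (1 - r)).
Proof.
move=> zx wx; have x0 := le_trans (normc_ge0 z) zx.
apply: (@le_trans _ _ (1 * qgeo n * qmaj n x)); last first.
  by rewrite -[leRHS]mul1r mulrA; exact: geo_maj_le.
apply: (@qrec_bound (fun n => normc (qslope n z w))) => //.
  by rewrite -[leLHS]/(normc (0 : K)) normc0.
move=> m /=; apply: le_trans (lec_normcD _ _) _; rewrite normcNE !normcM normcX -/r mul1r.
apply: lerD.
  by apply: ler_wpM2l; [exact: normc_ge0|exact: factor_le].
by apply: ler_wpM2l; [rewrite exprn_ge0|exact: qpart_le].
Qed.

(** The difference of the slopes obeys the recursion of [qrec_bound], its inhomogeneity being
    controlled by $|w-z|$ times the bound of [qslope_bound]. Uniformity in [n] lets the estimate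
    pass to the limit. *)
Lemma qslope_lipschitz x n z w : normc z <= x -> normc w <= x ->
  normc (qslope n z w - qslope n z z) <=
  normc (w - z) * ((1 - r)^-1 * expR (x / (1 - r))) * (1 - r)^-1 * expR (x / (1 - r)).
Proof.
move=> zx wx; have x0 := le_trans (normc_ge0 z) zx.
set C := (1 - r)^-1 * expR _.
have C0 : 0 <= C by rewrite mulr_ge0 ?expR_ge0 // invr_ge0 subr_ge0 ltW.
have D0 : 0 <= normc (w - z) * C by rewrite mulr_ge0 // normc_ge0.
apply: le_trans (geo_maj_le n x0 D0).
apply: (@qrec_bound (fun n => normc (qslope n z w - qslope n z z))) => //.
  by rewrite -[leLHS]/(normc (0 - 0 : K)) subrr normc0.
move=> m /=.
have -> : qslope m z w * (1 - q ^+ m * w) - q ^+ m * qpart m z -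
    (qslope m z z * (1 - q ^+ m * z) - q ^+ m * qpart m z) =
  (qslope m z w - qslope m z z) * (1 - q ^+ m * w) -
   q ^+ m * (qslope m z z * (w - z)) by ring.
apply: le_trans (lec_normcD _ _) _; rewrite normcNE !normcM normcX -/r.
apply: lerD.
  by apply: ler_wpM2l; [exact: normc_ge0|exact: factor_le].
rewrite ler_pM2l ?exprn_gt0 // mulrC -mulrA ler_wpM2l ?normc_ge0 //.
apply: (@le_trans _ _ C); first exact: qslope_bound.
by rewrite ler_peMr // qmaj_ge1.
Qed.

Lemma clim_qslope z w : exists l, clim (fun n => qslope n z w) l.
Proof.
pose x := Num.max (normc z) (normc w).
have zx : normc z <= x by rewrite le_max lexx.
have wx : normc w <= x by rewrite le_max lexx orbT.
have x0 := le_trans (normc_ge0 z) zx.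
apply: (@clim_geometric R _ ((1 - r)^-1 * expR (x / (1 - r)) * x + expR (x / (1 - r)))
  r r0' q1) => n /=.
have -> : qslope n z w * (1 - q ^+ n * w) - q ^+ n * qpart n z - qslope n z w =
   - (q ^+ n * (qslope n z w * w + qpart n z)) by ring.
rewrite normcNE normcM normcX -/r [leRHS]mulrC ler_pM2l ?exprn_gt0 //.
apply: le_trans (lec_normcD _ _) _; apply: lerD.
  rewrite normcM; apply: ler_pM; rewrite ?normc_ge0 //; exact: qslope_bound.
exact: le_trans (qpart_le n zx) (qmaj_le n x0).
Qed.

(** The Caratheodory quotient is the limit of the [qslope n z w]; the uniform Lipschitz bound makes
    it continuous at [z]. *)
Lemma holo_qPochhammer z : holo_at (qPochhammer q) z.
Proof.
have /choice [phi Hphi] : forall w, exists l, clim (fun n => qslope n z w) l.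
  exact: clim_qslope.
exists phi; split; last first.
  move=> w; apply: (clim_unique (clim_qPochhammer w)).
  under eq_fun do rewrite (qslopeE _ z w).
  exact: (climD (clim_qPochhammer z) (climM (Hphi w) (clim_cst (w - z)))).
apply/contcP => e e0.
pose x := normc z + 1.
pose C := (1 - r)^-1 * expR (x / (1 - r)) * (1 - r)^-1 * expR (x / (1 - r)).
have C0 : 0 < C by rewrite !mulr_gt0 ?expR_gt0 // invr_gt0 subr_gt0.
exists (Num.min 1 (e / C)); first by rewrite lt_min ltr01 divr_gt0.
move=> w; rewrite lt_min ltr_pdivlMr // => /andP[w1 we].
have zx : normc z <= x by rewrite lerDl.
have wx : normc w <= x.
  have -> : w = z + (w - z) by rewrite addrC subrK.
  by apply: le_trans (lec_normcD _ _) _; rewrite lerD2l ltW.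
apply: le_lt_trans we; apply: (clim_le (climB (Hphi w) (Hphi z))) => n.
by apply: le_trans (qslope_lipschitz n zx wx) _; rewrite /C !mulrA.
Qed.

End QPochhammer.

Section SimpleZeros.
Variable K : numFieldType.
Implicit Types (f g : K -> K) (z w : K).

Definition simple_zero f z := f z = 0 /\ exists2 psi, cdiff f z psi & psi z != 0.

Lemma simple_zero_near f g z (d : K) : 0 < d ->
  (forall w, `|w - z| < d -> f w = g w) -> simple_zero f z -> simple_zero g z.
Proof.
move=> d0 fg [fz [p [cp fE] pz]].
have fgz : f z = g z by apply: fg; rewrite subrr normr0.
split; first by rewrite -fgz.
exists (fun w => if w == z then p z else (g w - g z) / (w - z)); last by rewrite eqxx.
split.
  apply: (ccont_near d0 _ cp) => w wd; have [-> //|wz] := eqVneq w z.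
  by rewrite -fgz -fg // [f w]fE addrAC subrr add0r mulfK // subr_eq0.
move=> w; have [->|wz] := eqVneq w z; first by rewrite subrr mulr0 addr0.
by rewrite divfK ?subr_eq0 // addrC subrK.
Qed.

Lemma simple_zeroM f g z : simple_zero f z -> holo_at g z -> g z != 0 ->
  simple_zero (fun w => f w * g w) z.
Proof.
move=> [fz [p [cp fE] pz]] hg gz; split; first by rewrite fz mul0r.
exists (fun w => p w * g w); last by rewrite mulf_neq0.
split; first exact: (ccontM cp (holo_ccont hg)).
by move=> w; rewrite fz mul0r add0r fE fz add0r mulrAC.
Qed.

Lemma simple_zero_scale f c z : c != 0 -> simple_zero f (c * z) ->
  simple_zero (fun w => f (c * w)) z.
Proof.
move=> c0 [fz [p [cp fE] pz]]; split=> //.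
exists (fun w => p (c * w) * c); last by rewrite mulf_neq0.
split; last by move=> w; rewrite fE; ring.
have cl : ccont (fun w => c * w) z by exact: (ccontM (@ccont_cst _ c z) (@ccont_id _ z)).
exact: (ccontM (ccont_comp cl cp) (@ccont_cst _ c z)).
Qed.

End SimpleZeros.

(** * Zeros of theta functions and interpolation *)

Section Theta.
Variable R : realType.
Local Notation K := R[i].
Variable q : K.
Hypotheses (q0 : q != 0) (q1 : normc q < 1).
Implicit Types (z w p a b : K) (s : seq K).

Local Notation theta := (theta q).
Local Notation E := (qPochhammer q).

Lemma expq_neq0 (n : int) : q ^ n != 0.
Proof. by rewrite expfz_neq0. Qed.

Lemma expq_eq1 (n : int) : q ^ n = 1 -> n = 0.
Proof.
have H k : q ^+ k.+1 != 1.
  apply/eqP => /(congr1 (@normc R)); rewrite normcX normc1 => /eqP; rewrite lt_eqF //.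
  by rewrite exprn_ilt1 ?normc_ge0.
case: n => [[|k]|k] //; first by move=> /eqP; rewrite (negPf (H k)).
by rewrite NegzE -exprnN => /(congr1 (@GRing.inv _)); rewrite invrK invr1 => /eqP;
  rewrite (negPf (H k)).
Qed.

Lemma thetaE z : theta z = (1 - z) * (E (q * z) * E (q / z)).
Proof. by rewrite /Defs.theta (qPochhammer_rec q0 q1) mulrA. Qed.

Lemma theta1 : theta 1 = 0.
Proof. by rewrite thetaE subrr mul0r. Qed.

Lemma theta_inv z : z != 0 -> theta z^-1 = - z^-1 * theta z.
Proof.
move=> z0; rewrite [RHS]mulrC [in RHS]/Defs.theta (qPochhammer_rec q0 q1 z).
rewrite thetaE invrK [E (q / z) * _]mulrC; field; exact: z0.
Qed.

Lemma theta_q z : z != 0 -> theta (q * z) = - z^-1 * theta z.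
Proof.
by move=> z0; rewrite -theta_inv // /Defs.theta invfM mulrA mulfV // mul1r invrK mulrC.
Qed.

Lemma holo_theta z : z != 0 -> holo_at theta z.
Proof.
move=> z0; apply: holoM; first exact: holo_qPochhammer.
have hd : holo_at (fun w => q / w) z by exact: (holoM (holo_cst q z) (holoV z0 (holo_id
  z))).
exact: (holo_comp hd (holo_qPochhammer q0 q1 _)).
Qed.

Lemma theta_shift (n : int) : exists2 c, c != 0 &
  forall w, w != 0 -> theta (q ^ n * w) = c * w ^ (- n) * theta w.
Proof.
elim/int_ind: n => [|n [c c0 IH]|n [c c0 IH]].
- by exists 1; rewrite ?oner_neq0 // => w w0; rewrite oppr0 !expr0z !mul1r.
- exists (- c * (q ^ n%:Z)^-1); first by rewrite mulf_neq0 ?oppr_eq0 ?invr_neq0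
  ?expq_neq0.
  move=> w w0; have qw : q ^ n%:Z * w != 0 by rewrite mulf_neq0 ?expq_neq0.
  have -> : q ^ n.+1%:Z * w = q * (q ^ n%:Z * w) by rewrite mulrA -exprSz.
  have -> : w ^ (- n.+1%:Z) = w ^ (- n%:Z) * w^-1.
    by rewrite intS opprD addrC expfzDr // -invr_expz expr1z.
  rewrite theta_q // IH //; move: (expq_neq0 n%:Z); move: (q ^ n%:Z) => x x0.
  by field; rewrite x0 w0.
- exists (- c * (q ^ (- n.+1%:Z))); first by rewrite mulf_neq0 ?oppr_eq0 ?expq_neq0.
  move=> w w0; set u := q ^ (- n.+1%:Z) * w.
  have u0 : u != 0 by rewrite mulf_neq0 ?expq_neq0.
  have qu : q * u = q ^ (- n%:Z) * w.
    by rewrite /u mulrA -[X in X * _ * _]expr1z -expfzDr // intS opprD addrA subrr add0r.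
  have := theta_q u0; rewrite qu IH // => H.
  have -> : theta u = - u * (c * w ^ (- - n%:Z) * theta w).
    by rewrite H; field.
  rewrite opprK opprK intS expfzDr // expr1z /u; ring.
Qed.

Lemma qZM a b : qZ q a -> qZ q b -> qZ q (a * b).
Proof. by move=> [m _ <-] [n _ <-]; exists (m + n) => //; rewrite expfzDr. Qed.

Lemma qZV a : qZ q a -> qZ q a^-1.
Proof. by move=> [m _ <-]; exists (- m) => //; rewrite invr_expz. Qed.

Lemma theta_eq0 z : z != 0 -> theta z = 0 <-> qZ q z.
Proof.
move=> z0; split; last first.
  move=> [n _ <-]; have [c c0 H] := theta_shift n.
  by rewrite -[q ^ n]mulr1 H ?oner_neq0 // theta1 mulr0.
move=> /eqP; rewrite mulf_eq0 => /orP[|] /eqP /(qPochhammer_eq0 q0 q1) [k Hk].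
  exists (- k%:Z) => //; rewrite -invr_expz -exprnP.
  by apply: (mulfI (expf_neq0 k q0)); rewrite mulfV ?expf_neq0.
exists k.+1%:Z => //; rewrite -exprnP exprSr.
by apply: (mulIf (invr_neq0 z0)); rewrite mulfV // -mulrA.
Qed.

Lemma theta_neq0 z : z != 0 -> ~ qZ q z -> theta z != 0.
Proof. by move=> z0 nz; apply/eqP => /(theta_eq0 z0). Qed.

(** At 1 the factor $1-z$ of [thetaE] exhibits the simple zero, since the other factors do not
    vanish there; [theta_shift] carries it to $q^n$. *)
Lemma simple_theta z : qZ q z -> simple_zero theta z.
Proof.
have s1 : simple_zero theta 1.
  split; first exact: theta1.
  exists (fun w => - (E (q * w) * E (q / w))); last first.
    rewrite oppr_eq0 divr1 mulr1 mulf_neq0 //;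
    by apply/eqP => /(qPochhammer_eq0 q0 q1) [k]; rewrite -exprSr => /(@expq_eq1 k.+1%:Z).
  split; last by move=> w; rewrite theta1 thetaE; ring.
  apply/ccontN/ccontM.
    have cl : ccont (fun w => q * w) 1 by exact: (ccontM (@ccont_cst _ q 1) (@ccont_id
      _ 1)).
    exact: (ccont_comp cl (holo_ccont (holo_qPochhammer q0 q1 _))).
  have cl : ccont (fun w => q / w) 1.
    exact: (ccontM (@ccont_cst _ q 1) (ccontV (oner_neq0 _) (@ccont_id _ 1))).
  exact: (ccont_comp cl (holo_ccont (holo_qPochhammer q0 q1 _))).
move=> [n _ <-]; have [c c0 H] := theta_shift n.
have qn0 := expq_neq0 n; have qn0' := expq_neq0 (- n).
have qE : q ^ (- n) * q ^ n = 1 by rewrite -expfzDr // addNr.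
have d0 : 0 < `|q ^ n| by rewrite normr_gt0.
apply: (simple_zero_near (f := fun w => theta (q ^ (- n) * w) * (c * (q ^ (- n) * w) ^
  (- n))) d0).
  move=> w wq; have w0 : w != 0.
    by apply: contraTneq wq => ->; rewrite sub0r normrN ltxx.
  rewrite mulrC -H ?mulf_neq0 // mulrA [q ^ n * _]mulrC qE mul1r //.
apply: simple_zeroM.
- by apply: (@simple_zero_scale _ theta (q ^ (- n)) (q ^ n)) => //; rewrite qE.
- have hl : holo_at (fun w => q ^ (- n) * w) (q ^ n).
    exact: (holoM (holo_cst _ _) (holo_id _)).
  apply: (holoM (holo_cst c _)); apply: (@holo_comp _ (fun u => u ^ (- n)) _ _ hl).
  by apply: holo_exprz; rewrite qE oner_neq0.
by rewrite qE exp1rz mulr1.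
Qed.

Definition theta_prod s z : K := \prod_(p <- s) theta (z / p).

Lemma theta_prod_cons p s z : theta_prod (p :: s) z = theta (z / p) * theta_prod s z.
Proof. by rewrite /theta_prod big_cons. Qed.

Definition all_neq0 s := forall p, p \in s -> p != 0.

(** One order of each pair is enough, as [qZ q] is closed under inverses. *)
Fixpoint qdistinct s : Prop :=
  if s is p :: s' then (forall x, x \in s' -> ~ qZ q (p / x)) /\ qdistinct s' else True.

Lemma all_neq0_cons p s : all_neq0 (p :: s) -> p != 0 /\ all_neq0 s.
Proof.
by move=> H; split; [apply: H; rewrite inE eqxx|move=> x xs; apply: H; rewrite inE xs
  orbT].
Qed.

Lemma holo_theta_prod s z : all_neq0 s -> z != 0 -> holo_at (theta_prod s) z.
Proof.
move=> + z0; elim: s => [|p s IH].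
  by move=> _; rewrite /theta_prod; under eq_fun do rewrite big_nil; exact: holo_cst.
move=> /all_neq0_cons [p0 /IH hs].
have -> : theta_prod (p :: s) = (fun w => theta (w / p) * theta_prod s w).
  by apply/funext => w; rewrite theta_prod_cons.
apply: (holoM _ hs).
have hl : holo_at (fun w => w / p) z by exact: (holoM (holo_id _) (holo_cst _ _)).
by apply: (@holo_comp _ theta _ _ hl); apply: holo_theta; rewrite mulf_neq0 ?invr_neq0.
Qed.

Lemma theta_prod_q s z : all_neq0 s -> z != 0 ->
  theta_prod s (q * z) = (\prod_(p <- s) (- p)) * z ^- size s * theta_prod s z.
Proof.
move=> + z0; elim: s => [|p s IH].
  by rewrite /theta_prod !big_nil expr0 invr1 !mul1r.
move=> /all_neq0_cons [p0 /IH hs].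
have zp : z / p != 0 by rewrite mulf_neq0 ?invr_neq0.
rewrite !theta_prod_cons hs -mulrA theta_q // big_cons /= exprS !invfM invrK.
by move: (theta_prod _ _) (theta _) (z ^- _) (\prod_(_ <- _) _) => t t' x y; ring.
Qed.

Lemma theta_prod_eq0 s z : all_neq0 s -> z != 0 ->
  theta_prod s z = 0 -> exists2 p, p \in s & qZ q (z / p).
Proof.
move=> + z0; elim: s => [|p s IH].
  by move=> _; rewrite /theta_prod big_nil => /eqP; rewrite oner_eq0.
move=> /all_neq0_cons [p0 /IH hs]; rewrite theta_prod_cons => /eqP.
rewrite mulf_eq0 => /orP[/eqP|/eqP/hs [x xs H]]; last by exists x => //; rewrite inE xs
  orbT.
by move=> /theta_eq0 H; exists p; rewrite ?inE ?eqxx //; apply: H; rewrite mulf_neq0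
  ?invr_neq0.
Qed.

Lemma theta_prod_root s p : all_neq0 s -> p \in s -> theta_prod s p = 0.
Proof.
move=> s0 ps; rewrite /theta_prod (big_rem p) //= divff ?s0 //.
by rewrite theta1 mul0r.
Qed.

Lemma simple_theta_prod s z : all_neq0 s -> qdistinct s -> z != 0 ->
  theta_prod s z = 0 -> simple_zero (theta_prod s) z.
Proof.
move=> + + z0; elim: s => [|p s IH].
  by move=> _ _; rewrite /theta_prod big_nil => /eqP; rewrite oner_eq0.
move=> /all_neq0_cons [p0 s0] [ps ds] Dz.
have E1 : theta_prod (p :: s) = (fun w => theta (w / p) * theta_prod s w).
  by apply/funext => w; rewrite theta_prod_cons.
have zp : z / p != 0 by rewrite mulf_neq0 ?invr_neq0.
have [/eqP tz|tz] := boolP (theta (z / p) == 0); last first.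
  have -> : theta_prod (p :: s) = (fun w => theta_prod s w * theta (w / p)).
    by rewrite E1; apply/funext => w; rewrite mulrC.
  apply: simple_zeroM => //.
    apply: IH => //; move: Dz; rewrite theta_prod_cons => /eqP.
    by rewrite mulf_eq0 (negPf tz) => /eqP.
  have hl : holo_at (fun w => w / p) z by exact: (holoM (holo_id _) (holo_cst _ _)).
  by apply: (@holo_comp _ theta _ _ hl); apply: holo_theta.
rewrite E1; apply: simple_zeroM.
- have -> : (fun w => theta (w / p)) = (fun w => theta (p^-1 * w)).
    by apply/funext => w; rewrite mulrC.
  apply: simple_zero_scale; first exact: invr_neq0.
  by apply: simple_theta; rewrite mulrC; apply/theta_eq0.
- exact: holo_theta_prod.
apply/eqP => /(theta_prod_eq0 s0 z0) [x xs zx]; apply: (ps x xs).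
have -> : p / x = (z / p)^-1 * (z / x).
  by have := s0 x xs => x0; field; rewrite z0 p0 x0.
by apply: qZM => //; apply: qZV; apply/theta_eq0.
Qed.

Lemma qshift_zero (F : K -> K) a k p (n : int) : p != 0 ->
  (forall z, z != 0 -> F (q * z) = a * z ^- k * F z) -> a != 0 ->
  F p = 0 -> F (q ^ n * p) = 0.
Proof.
move=> p0 Fq a0 Fp; have qp (m : int) : q ^ m * p != 0 by rewrite mulf_neq0 ?expq_neq0.
elim/int_ind: n => [|n IH|n IH]; first by rewrite expr0z mul1r.
  by rewrite exprSz -mulrA Fq ?qp // IH mulr0.
apply/eqP; have := Fq _ (qp (- n.+1%:Z)).
have -> : q * (q ^ (- n.+1%:Z) * p) = q ^ (- n%:Z) * p.
  by rewrite mulrA -[X in X * _ * _]expr1z -expfzDr // intS opprD addrA subrr add0r.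
rewrite IH => /esym /eqP; rewrite !mulf_eq0 (negPf a0) invr_eq0 expf_eq0 (negPf (qp _))
  andbF //.
Qed.

(** [F] and [theta_prod s] have the same factor $z^{-|s|}$ in their functional equations, and all
    zeros of the product are simple zeros shared by [F]. So the quotient has a constant multiplier
    and is a monomial. *)
Lemma theta_interpolation (F : K -> K) s a : all_neq0 s -> qdistinct s -> a != 0 ->
  (forall z, z != 0 -> holo_at F z) ->
  (forall z, z != 0 -> F (q * z) = a * z ^- size s * F z) ->
  (forall p, p \in s -> F p = 0) ->
  exists (n : int) (beta : K),
    (forall z, z != 0 -> F z = beta * z ^ n * theta_prod s z) /\
    (beta = 0 \/ a = (\prod_(p <- s) (- p)) * q ^ n).
Proof.
move=> s0 ds a0 hF Fq Fs.
have b0 : \prod_(p <- s) (- p) != 0.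
  by rewrite prodf_seq_neq0; apply/allP => p /s0; rewrite oppr_eq0.
apply: (@qperiodic_quotient R q q0 q1 F (theta_prod s) (fun z => z ^- size s)) => //.
- by move=> z z0; rewrite invr_neq0 // expf_neq0.
- by move=> z z0; exact: holo_theta_prod.
- by move=> z z0; rewrite theta_prod_q.
move=> z z0 Dz; split; last by case: (simple_theta_prod s0 ds z0 Dz).
have [p ps [n _ Hn]] := theta_prod_eq0 s0 z0 Dz.
have -> : z = q ^ n * p by rewrite Hn divfK // s0.
by apply: (qshift_zero _ (s0 p ps) Fq a0); exact: Fs.
Qed.

(** Abel's relation: the multiplier fixes the product of the zeros modulo $q^{\mathbb Z}$, so zeros
    with a wrong product force $F=0$. *)
Lemma theta_interpolation0 (F : K -> K) s a : all_neq0 s -> qdistinct s -> a != 0 ->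
  (forall z, z != 0 -> holo_at F z) ->
  (forall z, z != 0 -> F (q * z) = a * z ^- size s * F z) ->
  (forall p, p \in s -> F p = 0) ->
  ~ qZ q (a / \prod_(p <- s) (- p)) ->
  forall z, z != 0 -> F z = 0.
Proof.
move=> s0 ds a0 hF Fq Fs na z z0.
have [n [beta [FE [b|aE]]]] := theta_interpolation s0 ds a0 hF Fq Fs.
  by rewrite FE // b !mul0r.
case: na; exists n => //; rewrite aE mulrAC mulfV ?mul1r //.
by rewrite prodf_seq_neq0; apply/allP => p /s0; rewrite oppr_eq0.
Qed.

Lemma theta_interpolation1 (F : K -> K) s : all_neq0 s -> qdistinct s ->
  (forall z, z != 0 -> holo_at F z) ->
  (forall z, z != 0 -> F (q * z) = (\prod_(p <- s) (- p)) * z ^- size s * F z) ->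
  (forall p, p \in s -> F p = 0) ->
  exists beta, forall z, z != 0 -> F z = beta * theta_prod s z.
Proof.
move=> s0 ds hF Fq Fs.
have b0 : \prod_(p <- s) (- p) != 0.
  by rewrite prodf_seq_neq0; apply/allP => p /s0; rewrite oppr_eq0.
have [n [beta [FE [b|aE]]]] := theta_interpolation s0 ds b0 hF Fq Fs.
  by exists 0 => z z0; rewrite FE // b !mul0r.
exists beta => z z0; rewrite FE //.
have -> : n = 0 by apply: expq_eq1; apply: (mulfI b0); rewrite -aE mulr1.
by rewrite expr0z mulr1.
Qed.

End Theta.

(** * Linear systems of theta functions *)

Section Determinant.
Variable K : comNzRingType.
Implicit Type g : nat -> nat -> K.

Let minor g (j : nat) := fun a b => g a.+1 (bump j b).

Let det_rec n g : \det (\matrix_(i < n.+1, j < n.+1) g i j) =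
  \sum_(j < n.+1) (-1) ^+ j * g 0 j * \det (\matrix_(a < n, b < n) minor g j a b).
Proof.
rewrite (expand_det_row _ ord0); apply: eq_bigr => j _.
rewrite mxE /cofactor add0n mulrA [g _ _ * _]mulrC; congr (_ * \det _).
by apply/matrixP => a b; rewrite !mxE.
Qed.

(** Laplace expansion along the first two rows. In [row_matrix] these rows belong to the first
    component and the other two to the second, so each minor is one that [theta2_basis] factors. *)
Lemma det4E g : \det (\matrix_(i < 4, j < 4) g i j) =
    (g 0 0 * g 1 1 - g 1 0 * g 0 1) * (g 2 2 * g 3 3 - g 3 2 * g 2 3)
  - (g 0 0 * g 1 2 - g 1 0 * g 0 2) * (g 2 1 * g 3 3 - g 3 1 * g 2 3)
  + (g 0 0 * g 1 3 - g 1 0 * g 0 3) * (g 2 1 * g 3 2 - g 3 1 * g 2 2)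
  + (g 0 1 * g 1 2 - g 1 1 * g 0 2) * (g 2 0 * g 3 3 - g 3 0 * g 2 3)
  - (g 0 1 * g 1 3 - g 1 1 * g 0 3) * (g 2 0 * g 3 2 - g 3 0 * g 2 2)
  + (g 0 2 * g 1 3 - g 1 2 * g 0 3) * (g 2 0 * g 3 1 - g 3 0 * g 2 1).
Proof.
have det2 (h : nat -> nat -> K) : \det (\matrix_(i < 2, j < 2) h i j) = h 0 0 * h 1 1 -
  h 0 1 * h 1 0 :> K.
  rewrite (det_rec 1 h) !big_ord_recl big_ord0 !det_mx11 !mxE /minor /=; ring.
have det3 (h : nat -> nat -> K) : \det (\matrix_(i < 3, j < 3) h i j) =
    h 0 0 * (h 1 1 * h 2 2 - h 1 2 * h 2 1) - h 0 1 * (h 1 0 * h 2 2 - h 1 2 * h 2 0)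
    + h 0 2 * (h 1 0 * h 2 1 - h 1 1 * h 2 0) :> K.
  rewrite (det_rec 2 h).
  under eq_bigr => j _ do rewrite (det2 (minor h j)).
  rewrite !big_ord_recl big_ord0 /minor /=; ring.
rewrite (det_rec 3 g).
under eq_bigr => j _ do rewrite (det3 (minor g j)).
rewrite !big_ord_recl big_ord0 /minor /=; ring.
Qed.

End Determinant.

(** * Theta functions of degree two *)

Section RowFunctions.
Variable R : realType.
Local Notation K := R[i].
Variable q : K.
Hypotheses (q0 : q != 0) (q1 : normc q < 1).
Implicit Types (z w p a b : K) (s : seq K).
Local Notation theta := (theta q).
Let r := normc q.

Lemma expq_norm (n : int) : n != 0 -> normc (q ^ n) <= r \/ normc (q ^ n)^-1 <= r.
Proof.
have rr k : r ^+ k.+1 <= r by rewrite exprS ger_pMr ?normc_gt0 // exprn_ile1 ?normc_ge0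
  // ltW.
case: n => [[|k]|k] // _; first by left; rewrite -exprnP normcX.
by right; rewrite NegzE -exprnN invrK normcX.
Qed.

(** The points [t j], with modulus between $|q|$ (excluded) and 1, lie in pairwise distinct classes
    modulo $q^{\mathbb Z}$, while each [c] in [s] excludes at most one class. *)
Lemma generic_point s : exists2 p, p != 0 & forall c, c \in s -> ~ qZ q (p / c).
Proof.
pose t (j : nat) : R := r + (1 - r) / j.+1%:R.
have t1 j : r < t j <= 1.
  have j0 : 0 < j.+1%:R :> R by [].
  rewrite ltrDl divr_gt0 ?subr_gt0 //=.
  by rewrite -lerBrDl ler_pdivrMr // ler_peMr ?subr_ge0 ?ler1n // ltW.
have rp : 0 < r by rewrite normc_gt0.
have tp j : 0 < t j by case/andP: (t1 j) => /(lt_trans rp).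
have tn j : normc (t j)%:C%C = t j by exact: normc_pos_real.
have tinj i j : qZ q ((t i)%:C%C / (t j)%:C%C) -> i = j.
  have lt_ratio i' j' : r < normc ((t i')%:C%C / (t j')%:C%C : K).
    rewrite normcM normcV !tn ltr_pdivlMr //.
    have /andP[ri _] := t1 i'; have /andP[_ j1] := t1 j'.
    by apply: le_lt_trans ri; rewrite ger_pMr.
  move=> [n _ En]; have n0 : n = 0.
    apply/eqP; apply: contraT => /expq_norm []; rewrite En leNgt ?lt_ratio //.
    by rewrite invfM invrK mulrC lt_ratio.
  move: En; rewrite n0 expr0z => /esym /divr1_eq /complexI.
  move=> /addrI /mulfI; rewrite subr_eq0 eq_sym lt_eqF // => /(_ isT) /invr_inj /eqP.
  by rewrite eqr_nat => /eqP [].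
apply: contrapT => H.
have /choice [g Hg] : forall j : nat, exists c, c \in s /\ qZ q ((t j)%:C%C / c).
  move=> j; apply: contrapT => H'; apply: H; exists (t j)%:C%C.
    by rewrite -normc_gt0 tn.
  by move=> c cs qc; apply: H'; exists c.
have ginj : injective g.
  move=> i j gij; apply: tinj.
  have [_ [m _ Em]] := Hg i; have [_ [n _ En]] := Hg j.
  exists (m - n) => //; rewrite expfzDr // -invr_expz Em En gij.
  have c0 : g j != 0.
    by apply: contra_eq_neq En => ->; rewrite invr0 mulr0 expfz_neq0.
  by field; rewrite c0 -normc_eq0 tn gt_eqF.
have /uniq_leq_size : uniq (map g (iota 0 (size s).+1)) by rewrite map_inj_uniq //
  iota_uniq.
move=> /(_ s); rewrite size_map size_iota ltnn => /(_ _)/wrap[] //.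
by move=> x /mapP [j _ ->]; case: (Hg j).
Qed.

(** Theta functions of degree two; [a] is, modulo $q^{\mathbb Z}$, the product of the two zeros of a
    nonzero one. *)
Definition theta2 a (f : K -> K) := (forall z, z != 0 -> holo_at f z) /\
  (forall z, z != 0 -> f (q * z) = a * z ^- 2 * f z).

Lemma theta2_lin a f g c d : theta2 a f -> theta2 a g ->
  theta2 a (fun z => c * f z + d * g z).
Proof.
move=> [hf fq] [hg gq]; split => z z0.
  exact: (holoD (holoM (holo_cst c z) (hf z z0)) (holoM (holo_cst d z) (hg z z0))).
by rewrite fq // gq //; ring.
Qed.

Lemma theta2_zero a f p1 p2 : a != 0 -> theta2 a f -> p1 != 0 -> p2 != 0 ->
  ~ qZ q (p1 / p2) -> ~ qZ q (a / (p1 * p2)) -> f p1 = 0 -> f p2 = 0 ->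
  forall z, z != 0 -> f z = 0.
Proof.
move=> a0 [hf fq] p10 p20 p12 pa f1 f2.
apply: (@theta_interpolation0 R q q0 q1 f [:: p1; p2] a) => //.
- by move=> p; rewrite !inE => /orP[] /eqP ->.
- by split; [move=> x; rewrite inE => /eqP ->|split].
- by move=> p; rewrite !inE => /orP[] /eqP ->.
by rewrite !big_cons big_nil mulr1 mulrNN.
Qed.

Lemma theta2_prod a p : a != 0 -> p != 0 ->
  theta2 a (fun z => theta (z / p) * theta (z * p / a)).
Proof.
move=> a0 p0; split => z z0.
  have h1 : holo_at (fun w => w / p) z by exact: (holoM (holo_id z) (holo_cst p^-1 z)).
  have h2 : holo_at (fun w => w * p / a) z.
    exact: (holoM (holoM (holo_id z) (holo_cst p z)) (holo_cst a^-1 z)).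
  apply: holoM; [apply: (@holo_comp _ theta _ _ h1)|apply: (@holo_comp _ theta _ _ h2)];
    by apply: holo_theta; rewrite ?mulf_neq0 ?invr_neq0.
have -> : q * z / p = q * (z / p) by rewrite mulrA.
have -> : q * z * p / a = q * (z * p / a) by rewrite !mulrA.
rewrite !theta_q ?mulf_neq0 ?invr_neq0 //.
move: (theta _) (theta _) => t t'; field; by rewrite z0 p0 a0.
Qed.

(** As a function of [z] it vanishes at [w] and at [a / w]; the prefactor [w] makes it antisymmetric
    in [z] and [w]. *)
Definition wr a z w := w * theta (z / w) * theta (z * w / a).

(* A basis whose Wronskian-like 2x2 minors factor: Weierstrass' three-term relation. *)
Lemma theta2_basis a s : a != 0 -> all_neq0 s -> exists e1 e2 kappa,
  [/\ theta2 a e1 /\ theta2 a e2, kappa != 0,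
    (forall f, theta2 a f -> exists c d, forall z, z != 0 -> f z = c * e1 z + d * e2 z),
    (forall c d, (forall z, z != 0 -> c * e1 z + d * e2 z = 0) -> c = 0 /\ d = 0) &
    (forall z w, z != 0 -> w \in s ->
       e1 z * e2 w - e2 z * e1 w = kappa * wr a z w)].
Proof.
move=> a0 s0.
(* [e1] has the zeros [p2], [a / p2] and [e2] the zeros [p1], [a / p1]. The choice of [p1] makes
   them independent; that of [p2] makes [p2] and each [w] in [s] a pair of points at which a theta
   function of multiplier [a] is determined. *)
have [p2 p20 Hp2] := generic_point (s ++ [seq a / w | w <- s]).
have [p1 p10 Hp1] := generic_point [:: p2; a / p2].
have p12 : ~ qZ q (p1 / p2) by apply: Hp1; rewrite inE eqxx.
have p12a : ~ qZ q (p1 * p2 / a).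
  have := Hp1 (a / p2); rewrite !inE eqxx orbT => /(_ isT).
  by rewrite invfM invrK [_^-1 * p2]mulrC mulrA.
have p12a' : ~ qZ q (a / (p1 * p2)).
  by move=> /qZV; rewrite invfM invrK mulrC.
pose e1 z := theta (z / p2) * theta (z * p2 / a).
pose e2 z := theta (z / p1) * theta (z * p1 / a).
have t1 : theta2 a e1 by exact: theta2_prod.
have t2 : theta2 a e2 by exact: theta2_prod.
have e12 : e1 p2 = 0 by rewrite /e1 divff // theta1 // mul0r.
have e21 : e2 p1 = 0 by rewrite /e2 divff // theta1 // mul0r.
have e11 : e1 p1 != 0.
  by rewrite mulf_neq0 // theta_neq0 ?mulf_neq0 ?invr_neq0.
have e22 : e2 p2 != 0.
  rewrite mulf_neq0 // theta_neq0 ?mulf_neq0 ?invr_neq0 //.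
    by move=> /qZV; rewrite invfM invrK mulrC.
  by rewrite [p2 * p1]mulrC.
(* The constant is [e2 p2 / p2], read off at [z = p2], where [e1] vanishes. *)
exists e1, e2, (p2^-1 * theta (p2 / p1) * theta (p2 * p1 / a)); split => //.
- by rewrite -mulrA mulf_neq0 ?invr_neq0.
- move=> f tf; exists (f p1 / e1 p1), (f p2 / e2 p2) => z z0.
  apply/eqP; rewrite -subr_eq0; apply/eqP.
  have H := theta2_lin 1 (-1) tf (theta2_lin (f p1 / e1 p1) (f p2 / e2 p2) t1 t2).
  have := theta2_zero a0 H p10 p20 p12 p12a' _ _ z0; rewrite !mul1r !mulN1r; apply.
    by rewrite e21 mulr0 addr0 divfK // subrr.
  by rewrite e12 mulr0 add0r divfK // subrr.
- move=> c d H; split.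
    by have /eqP := H p1 p10; rewrite e21 mulr0 addr0 mulf_eq0 (negPf e11) orbF => /eqP.
  by have /eqP := H p2 p20; rewrite e12 mulr0 add0r mulf_eq0 (negPf e22) orbF => /eqP.
move=> z w z0 ws; have w0 := s0 w ws.
set kap := p2^-1 * _ * _.
apply/eqP; rewrite -subr_eq0; apply/eqP.
(* The difference of the two sides, as a function of [z], is a theta function of multiplier [a]
   vanishing at [p2] and [w]. *)
have H := theta2_lin 1 (- (kap * w)) (theta2_lin (e2 w) (- e1 w) t1 t2) (theta2_prod a0
  w0).
have p2w : ~ qZ q (p2 / w) by apply: Hp2; rewrite mem_cat ws.
have p2wa : ~ qZ q (p2 * w / a).
  have := Hp2 (a / w); rewrite mem_cat (map_f (fun w => a / w) ws) orbT => /(_ isT).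
  by rewrite invfM invrK [_^-1 * w]mulrC mulrA.
have p2wa' : ~ qZ q (a / (p2 * w)) by move=> /qZV; rewrite invfM invrK mulrC.
have := theta2_zero a0 H p20 w0 p2w p2wa' _ _ z0.
have -> : e1 z * e2 w - e2 z * e1 w - kap * wr a z w =
  1 * (e2 w * e1 z + - e1 w * e2 z) + - (kap * w) * (theta (z / w) * theta (z * w / a)).
  by rewrite /wr; ring.
apply; last by rewrite divff // theta1 //; ring.
rewrite e12 /kap.
have -> : theta (p2 / w) = - (p2 / w) * theta (w / p2).
  have wp : w / p2 != 0 by rewrite mulf_neq0 ?invr_neq0.
  by have := theta_inv q0 q1 wp; rewrite invfM invrK [p2 / w]mulrC.
rewrite /e1 /e2 [p2 * w]mulrC.
move: (theta _) (theta _) (theta _) (theta _) => A B C D.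
by field; rewrite w0 p20.
Qed.

End RowFunctions.

(** * The four linear conditions on a row *)

Section Rows.
Variable R : realType.
Local Notation K := R[i].
Variable q : K.
Hypotheses (q0 : q != 0) (q1 : normc q < 1).
Variables (a b : K) (x X Y : nat -> K).
Hypotheses (a0 : a != 0) (b0 : b != 0) (x0 : forall k, x k != 0).

Local Notation wa i j := (wr q a (x i) (x j)).
Local Notation wb i j := (wr q b (x i) (x j)).

(* Laplace expansion of the determinant of the system ell f k = 0, k < 4, in the
   bases of theta2_basis, up to a constant. *)
Definition Tpoly : K :=
  wb 0 1 * wa 2 3 * (X 0%N * X 1%N * Y 2%N * Y 3%N)
  - wb 0 2 * wa 1 3 * (X 0%N * X 2%N * Y 1%N * Y 3%N)
  + wb 0 3 * wa 1 2 * (X 0%N * X 3%N * Y 1%N * Y 2%N)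
  + wb 1 2 * wa 0 3 * (X 1%N * X 2%N * Y 0%N * Y 3%N)
  - wb 1 3 * wa 0 2 * (X 1%N * X 3%N * Y 0%N * Y 2%N)
  + wb 2 3 * wa 0 1 * (X 2%N * X 3%N * Y 0%N * Y 1%N).

Definition ell (f1 f2 : K -> K) k := Y k * f1 (x k) - X k * f2 (x k).

(** Coordinates in the two bases of [theta2_basis]: the four conditions become [v *m M = 0], so
    solvability, uniqueness and dual rows are read off from one square matrix. *)
Lemma row_matrix : exists (F1 F2 : 'rV[K]_4 -> K -> K) (M : 'M[K]_4),
  [/\ forall v, theta2 q a (F1 v) /\ theta2 q b (F2 v),
      forall v (k : 'I_4), (v *m M) 0 k = ell (F1 v) (F2 v) k,
      forall f1 f2, theta2 q a f1 -> theta2 q b f2 ->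
        exists v, forall z, z != 0 -> f1 z = F1 v z /\ f2 z = F2 v z,
      forall v, (forall z, z != 0 -> F1 v z = 0 /\ F2 v z = 0) <-> v = 0 &
      (\det M == 0) = (Tpoly == 0)].
Proof.
pose s := [:: x 0%N; x 1%N; x 2%N; x 3%N].
have s0 : all_neq0 s by move=> p; rewrite !inE => /or4P [] /eqP ->.
have xs k : (k < 4)%N -> x k \in s.
  by case: k => [|[|[|[|]]]] // _; rewrite !inE eqxx ?orbT.
have [e1 [e2 [ka [[t1 t2] ka0 span free wrE]]]] := theta2_basis q0 q1 a0 s0.
have [e1' [e2' [kb [[t1' t2'] kb0 span' free' wrE']]]] := theta2_basis q0 q1 b0 s0.
pose i0 : 'I_4 := @Ordinal 4 0 isT; pose i1 : 'I_4 := @Ordinal 4 1 isT.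
pose i2 : 'I_4 := @Ordinal 4 2 isT; pose i3 : 'I_4 := @Ordinal 4 3 isT.
pose F1 (v : 'rV[K]_4) z := v 0 i0 * e1 z + v 0 i1 * e2 z.
pose F2 (v : 'rV[K]_4) z := v 0 i2 * e1' z + v 0 i3 * e2' z.
pose g (i k : nat) := match i with 0%N => Y k * e1 (x k) | 1%N => Y k * e2 (x k)
  | 2%N => - X k * e1' (x k) | _ => - X k * e2' (x k) end.
have sum4 (G : 'I_4 -> K) : \sum_i G i = G i0 + G i1 + G i2 + G i3.
  rewrite !big_ord_recl big_ord0 addr0 !addrA.
  by congr (_ + _ + _ + _); congr G; apply: val_inj.
exists F1, F2, (\matrix_(i < 4, k < 4) g i k); split.
- by move=> v; split; exact: theta2_lin.
- by move=> v k; rewrite mxE sum4 !mxE /= /ell /F1 /F2; ring.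
- move=> f1 f2 /span [c [d H]] /span' [c' [d' H']].
  exists (\row_(i < 4) nth 0 [:: c; d; c'; d'] i) => z z0.
  by rewrite /F1 /F2 !mxE /= H // H'.
- move=> v; split=> [Hv|->]; last by move=> z _; rewrite /F1 /F2 !mxE !mul0r addr0.
  have [v0 v1] : v 0 i0 = 0 /\ v 0 i1 = 0 by apply: free => z /Hv [].
  have [v2 v3] : v 0 i2 = 0 /\ v 0 i3 = 0 by apply: free' => z /Hv [].
  apply/rowP => -[[|[|[|[|//]]]] k4]; rewrite mxE.
  + by rewrite -v0; congr (v 0 _); apply: val_inj.
  + by rewrite -v1; congr (v 0 _); apply: val_inj.
  + by rewrite -v2; congr (v 0 _); apply: val_inj.
  + by rewrite -v3; congr (v 0 _); apply: val_inj.
have -> : \det (\matrix_(i < 4, k < 4) g i k) = (ka * kb) * Tpoly.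
  rewrite det4E /g.
  have A i j : (j < 4)%N -> Y i * e1 (x i) * (Y j * e2 (x j)) - Y i * e2 (x i) * (Y j *
    e1 (x j)) =
      Y i * Y j * (ka * wa i j).
    by move=> /xs js; rewrite -wrE //; ring.
  have B i j : (j < 4)%N -> - X i * e1' (x i) * (- X j * e2' (x j)) - - X i * e2' (x i)
    * (- X j * e1' (x j)) =
      X i * X j * (kb * wb i j).
    by move=> /xs js; rewrite -wrE' //; ring.
  rewrite !A // !B // /Tpoly; do 12! move: (wr _ _ _ _) => ?.
  by do 4! [move: (X _) => ?]; do 4! [move: (Y _) => ?]; ring.
by rewrite mulf_eq0 mulf_eq0 (negPf ka0) (negPf kb0).
Qed.

Lemma row_exists : Tpoly = 0 -> exists f1 f2, [/\ theta2 q a f1, theta2 q b f2,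
  forall k, (k < 4)%N -> ell f1 f2 k = 0 & exists2 z, z != 0 & (f1 z != 0) || (f2 z !=
    0)].
Proof.
move=> T0; have [F1 [F2 [M [HF ellE _ free detE]]]] := row_matrix.
have : \det M == 0 by rewrite detE T0.
move=> /det0P [v v0 vM]; exists (F1 v), (F2 v); split; try by case: (HF v).
  by move=> k k4; rewrite -[k]/(nat_of_ord (Ordinal k4)) -ellE vM mxE.
apply: contrapT => H; move/eqP: v0; apply; apply/free => z z0.
split; apply/eqP; apply: contraT => Fz; case: H; exists z => //; rewrite Fz ?orbT //.
Qed.

Lemma Tpoly_eq0 f1 f2 : theta2 q a f1 -> theta2 q b f2 ->
  (forall k, (k < 4)%N -> ell f1 f2 k = 0) ->
  (exists2 z, z != 0 & (f1 z != 0) || (f2 z != 0)) -> Tpoly = 0.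
Proof.
move=> t1 t2 Hk [z z0 fz]; have [F1 [F2 [M [HF ellE span free detE]]]] := row_matrix.
have [v Hv] := span _ _ t1 t2.
apply/eqP; rewrite -detE; apply/det0P; exists v.
  apply: contraTneq fz => v0.
  have [-> ->] := Hv z z0.
  by have [_ /(_ v0) H] := free v; have [-> ->] := H z z0; rewrite eqxx.
apply/rowP => k; rewrite ellE mxE -[RHS](Hk k (ltn_ord k)) /ell.
by have [-> ->] := Hv (x k) (x0 k).
Qed.

Lemma dual_row k : Tpoly != 0 -> (k < 4)%N -> exists f1 f2, [/\ theta2 q a f1, theta2 q
  b f2 &
  forall j, (j < 4)%N -> ell f1 f2 j = (j == k)%:R].
Proof.
move=> T0 k4; have [F1 [F2 [M [HF ellE _ _ detE]]]] := row_matrix.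
have uM : M \in unitmx by rewrite unitmxE unitfE detE.
pose v : 'rV_4 := delta_mx 0 (Ordinal k4) *m invmx M.
exists (F1 v), (F2 v); split; try by case: (HF v).
move=> j j4; rewrite -[j]/(nat_of_ord (Ordinal j4)) -ellE /v mulmxKV // mxE eqxx /=.
by rewrite -val_eqE.
Qed.

End Rows.

(** * Two-row solutions *)

Section Wedge.
Variable R : realType.
Local Notation K := R[i].
Variable q : K.
Hypotheses (q0 : q != 0) (q1 : normc q < 1).
Implicit Types (f g h : K -> K) (z w : K) (s : seq K).
Local Notation theta := (theta q).

Lemma simple_zero_isolated f p : simple_zero f p ->
  exists2 d : K, 0 < d & forall w, w != p -> `|w - p| < d -> f w != 0.
Proof.
move=> [fp [psi [cpsi fE] psip]]; have [d d0 Hd] := ccont_neq0 cpsi psip.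
exists d => // w wp /Hd psiw; rewrite fE fp add0r mulf_neq0 // subr_eq0 //.
Qed.

Lemma theta_prod_isolated s z : all_neq0 s -> qdistinct q s -> z != 0 ->
  exists2 d : K, 0 < d & forall w, w != z -> `|w - z| < d -> theta_prod q s w != 0.
Proof.
move=> s0 ds z0; have [Dz|Dz] := eqVneq (theta_prod q s z) 0.
  exact: simple_zero_isolated (simple_theta_prod q0 q1 s0 ds z0 Dz).
have [d d0 Hd] := ccont_neq0 (holo_ccont (holo_theta_prod q0 q1 s0 z0)) Dz.
by exists d => // w _; exact: Hd.
Qed.

Lemma ccont_punctured_eq g h z : ccont g z -> ccont h z ->
  (exists2 d : K, 0 < d & forall w, w != z -> `|w - z| < d -> g w = h w) -> g z = h z.
Proof.
move=> cg ch [d d0 Hd]; apply: (ccont_dense_eq cg ch) => e e0.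
have [dR dE] : exists k, d = (k%:C)%C by apply/complex_realP/gtr0_real.
move: d0 Hd; rewrite dE ltcR => d0 Hd.
pose t := Num.min dR e / 2.
have t0 : 0 < t by rewrite divr_gt0 // lt_min d0.
have [td te] : t < dR /\ t < e.
  have : Num.min dR e <= dR by rewrite ge_min lexx.
  have : Num.min dR e <= e by rewrite ge_min lexx orbT.
  by move: t0; rewrite /t; set u := Num.min _ _ => *; split; lra.
have wz : z + t%:C%C - z = t%:C%C by rewrite addrAC subrr add0r.
exists (z + t%:C%C); first by rewrite wz normc_pos_real.
apply: Hd; last by rewrite wz normC_normc normc_pos_real // ltcR.
by rewrite -subr_eq0 wz -normc_eq0 normc_pos_real // gt_eqF.
Qed.

(** The zeros of [theta_prod q s] are isolated; cancellation is valid off them and extends by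
    continuity. *)
Lemma theta_prod_cancel s g h : all_neq0 s -> qdistinct q s ->
  (forall z, z != 0 -> ccont g z) -> (forall z, z != 0 -> ccont h z) ->
  (forall z, z != 0 -> g z * theta_prod q s z = h z * theta_prod q s z) ->
  forall z, z != 0 -> g z = h z.
Proof.
move=> s0 ds cg ch E z z0; apply: ccont_punctured_eq; [exact: cg|exact: ch|].
have [d d0 Hd] := theta_prod_isolated s0 ds z0.
have z0' : 0 < `|z| by rewrite normr_gt0.
have [e [e0 ed ez]] : exists e : K, [/\ 0 < e, e <= d & e <= `|z|].
  have /orP[rd|dr] := real_leVge (gtr0_real d0) (gtr0_real z0').
    by exists d; split.
  by exists `|z|; split.
exists e => // w wz we; apply: (mulIf (Hd w wz (lt_le_trans we ed))); apply: E.
by apply: contraTneq (lt_le_trans we ez) => ->; rewrite sub0r normrN ltxx.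
Qed.

(** The multiplier forces the fourth zero to be [y4], which may be equivalent to another [y] modulo
    $q^{\mathbb Z}$. Therefore the zero added by subtracting a multiple of the product is placed at
    a generic [w], where it contradicts the multiplier. *)
Lemma three_zeros (F : K -> K) y1 y2 y3 y4 : all_neq0 [:: y1; y2; y3; y4] ->
  qdistinct q [:: y1; y2; y3] ->
  (forall z, z != 0 -> holo_at F z) ->
  (forall z, z != 0 -> F (q * z) = (y1 * y2 * y3 * y4) * z ^- 4 * F z) ->
  F y1 = 0 -> F y2 = 0 -> F y3 = 0 ->
  exists c, forall z, z != 0 -> F z = c * theta_prod q [:: y1; y2; y3; y4] z.
Proof.
move=> y0 [d1 [d2 _]] hF Fq F1 F2 F3.
have [w w0 Hw] := generic_point q0 q1 [:: y1; y2; y3; y4].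
have mem y : y \in [:: y1; y2; y3; y4] -> y != 0 by exact: y0.
have [n1 n2 n3 n4] : [/\ y1 != 0, y2 != 0, y3 != 0 & y4 != 0].
  by split; apply: y0; rewrite !inE eqxx ?orbT.
have Dw : theta_prod q [:: y1; y2; y3; y4] w != 0.
  by apply/eqP => /(theta_prod_eq0 q0 q1 y0 w0) [p /Hw].
pose c := F w / theta_prod q [:: y1; y2; y3; y4] w.
exists c => z z0; apply/eqP; rewrite -subr_eq0; apply/eqP.
have wy y : y \in [:: y1; y2; y3; y4] -> ~ qZ q (y / w).
  by move=> /Hw H /qZV; rewrite invfM invrK mulrC.
pose s := [:: y1; y2; y3; w].
apply: (@theta_interpolation0 R q q0 q1 (fun z => F z - c * theta_prod q [:: y1; y2;
  y3; y4] z) s (y1 * y2 * y3 * y4)) => //.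
- by move=> p; rewrite !inE => /or4P [] /eqP ->.
- split.
    move=> x; rewrite !inE => /or3P [] /eqP ->; [apply: d1|apply: d1|apply: wy];
      by rewrite !inE eqxx ?orbT.
  split.
    move=> x; rewrite !inE => /orP [] /eqP ->; [apply: d2|apply: wy];
      by rewrite !inE eqxx ?orbT.
  split; last by split.
  by move=> x; rewrite !inE => /eqP ->; apply: wy; rewrite !inE eqxx ?orbT.
- by rewrite !mulf_neq0.
- move=> u u0; apply: holoB; first exact: hF.
  exact: (holoM (holo_cst _ _) (holo_theta_prod q0 q1 y0 u0)).
- move=> u u0; rewrite Fq // theta_prod_q // !big_cons big_nil /= mulr1 !mulrNN.
  by set D := theta_prod _ _ _; ring.
- have root y : y \in [:: y1; y2; y3; y4] -> F y = 0 ->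
      F y - c * theta_prod q [:: y1; y2; y3; y4] y = 0.
    by move=> ys ->; rewrite theta_prod_root // mulr0 subr0.
  move=> p; rewrite !inE => /or4P [] /eqP ->; last by rewrite /c divfK // subrr.
  + by apply: root; rewrite ?inE ?eqxx ?orbT.
  + by apply: root; rewrite ?inE ?eqxx ?orbT.
  + by apply: root; rewrite ?inE ?eqxx ?orbT.
have -> : \prod_(p <- s) (- p) = y1 * y2 * (y3 * w).
  by rewrite !big_cons big_nil; ring.
have -> : y1 * y2 * y3 * y4 / (y1 * y2 * (y3 * w)) = y4 / w.
  by field; rewrite n1 n2 n3 w0.
by apply: wy; rewrite !inE eqxx ?orbT.
Qed.

Definition wedge (f1 f2 g1 g2 : K -> K) z := f1 z * g2 z - f2 z * g1 z.

Lemma wedge_theta4 a1 b1 a2 b2 P f1 f2 g1 g2 :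
  theta2 q a1 f1 -> theta2 q b1 f2 -> theta2 q a2 g1 -> theta2 q b2 g2 ->
  a1 * b2 = P -> b1 * a2 = P ->
  (forall z, z != 0 -> holo_at (wedge f1 f2 g1 g2) z) /\
  (forall z, z != 0 -> wedge f1 f2 g1 g2 (q * z) = P * z ^- 4 * wedge f1 f2 g1 g2 z).
Proof.
move=> [hf1 f1q] [hf2 f2q] [hg1 g1q] [hg2 g2q] P1 P2; split=> z z0.
  exact: (holoB (holoM (hf1 z z0) (hg2 z z0)) (holoM (hf2 z z0) (hg1 z z0))).
rewrite /wedge f1q // f2q // g1q // g2q //.
have -> : z ^- 4 = z ^- 2 * z ^- 2 by rewrite -invfM -exprD.
by rewrite mulrBr -{1}P1 -P2; ring.
Qed.

Lemma theta2_two_zeros a f p1 p2 : a != 0 -> theta2 q a f -> p1 != 0 -> p2 != 0 ->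
  ~ qZ q (p1 / p2) -> f p1 = 0 -> f p2 = 0 ->
  (forall z, z != 0 -> f z = 0) \/ qZ q (a / (p1 * p2)).
Proof.
move=> a0 tf p10 p20 p12 f1 f2.
have [H|H] := pselect (qZ q (a / (p1 * p2))); first by right.
by left; apply: theta2_zero H f1 f2.
Qed.

(** The two known zeros of [g] make it a monomial times an explicit theta product, which can be
    cancelled unless the coefficient is 0; this stands in for the identity theorem. *)
Lemma theta2_cancel a f g p1 p2 : a != 0 -> theta2 q a g -> p1 != 0 -> p2 != 0 ->
  ~ qZ q (p1 / p2) -> g p1 = 0 -> g p2 = 0 ->
  (forall z, z != 0 -> holo_at f z) -> (forall z, z != 0 -> f z * g z = 0) ->
  (forall z, z != 0 -> f z = 0) \/ (forall z, z != 0 -> g z = 0).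
Proof.
move=> a0 [hg gq] p10 p20 p12 g1 g2 hf fg.
have s0 : all_neq0 [:: p1; p2] by move=> p; rewrite !inE => /orP[] /eqP ->.
have ds : qdistinct q [:: p1; p2].
  by split; [move=> x; rewrite inE => /eqP ->|split].
have [|n [beta [gE _]]] := theta_interpolation q0 q1 s0 ds a0 hg gq.
  by move=> p; rewrite !inE => /orP[] /eqP ->.
have [b0|b0] := eqVneq beta 0; [right|left].
  by move=> z z0; rewrite gE // b0 !mul0r.
apply: (theta_prod_cancel s0 ds (h := fun=> 0)) => z z0; first exact: holo_ccont (hf z
  z0).
  exact: ccont_cst.
rewrite mul0r; have /eqP := fg z z0; rewrite gE // mulrCA mulf_eq0 mulf_eq0 (negPf b0).
by rewrite (negPf (expfz_neq0 n z0)) => /eqP.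
Qed.

End Wedge.

(** * Solution rows for a fixed tuple of ratios, and their wedges *)

Section Solutions.
Variable R : realType.
Local Notation K := R[i].
Variable q : K.
Hypotheses (q0 : q != 0) (q1 : normc q < 1).
Variables (t0 ki : K) (x X Y : nat -> K).
Hypotheses (t00 : t0 != 0) (ki0 : ki != 0) (x0 : forall k, x k != 0).
Hypothesis (xd : forall i j, (i < 4)%N -> (j < 4)%N -> i != j -> ~ qZ q (x i / x j)).
Hypothesis (xprod : x 0%N * x 1%N * x 2%N * x 3%N = t0 ^+ 2).
Hypothesis (XY : forall k, (X k != 0) || (Y k != 0)).
Hypothesis (ki2 : ~ qZ q (ki ^+ 2)).
Implicit Types (s z : K) (f g h : K -> K).
Local Notation theta := (theta q).
Local Notation T s := (Tpoly q (t0 * s / ki) (t0 * s * ki) x X Y).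
Local Notation ell := (ell x X Y).

(** The parameter [s] stands for $\kappa_0$: a connection matrix has first row for $s=\kappa_0$ and
    second row for $s=1/\kappa_0$. *)
Definition solution_row s f1 f2 := [/\ theta2 q (t0 * s / ki) f1, theta2 q (t0 * s *
  ki) f2 &
  forall k, (k < 4)%N -> ell f1 f2 k = 0].

Definition nz f := exists2 z, z != 0 & f z != 0.

Lemma nzP f : nz f \/ forall z, z != 0 -> f z = 0.
Proof.
have [|H] := pselect (nz f); [by left|right] => z z0.
by apply/eqP; apply: contraT => fz; case: H; exists z.
Qed.

Let s4 := [:: x 0%N; x 1%N; x 2%N; x 3%N].

Lemma s4_neq0 : all_neq0 s4.
Proof. by move=> p; rewrite !inE => /or4P [] /eqP ->. Qed.

Lemma s4_distinct : qdistinct q s4.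
Proof.
split; first by move=> y; rewrite !inE => /or3P [] /eqP ->; exact: xd.
split; first by move=> y; rewrite !inE => /orP [] /eqP ->; exact: xd.
by split; [move=> y; rewrite !inE => /eqP ->; exact: xd|split].
Qed.

Lemma s4_prod : \prod_(p <- s4) (- p) = t0 ^+ 2.
Proof. by rewrite !big_cons big_nil -xprod; ring. Qed.

(** At [x k] both rows are annihilated by the nonzero vector [(Y k, - X k)], hence they are
    proportional. *)
Lemma wedge_root f1 f2 g1 g2 k : ell f1 f2 k = 0 -> ell g1 g2 k = 0 ->
  wedge f1 f2 g1 g2 (x k) = 0.
Proof.
rewrite /ell /wedge => /eqP; rewrite subr_eq0 => /eqP F /eqP; rewrite subr_eq0 => /eqP G.
have /orP[X0|Y0] := XY k; [apply: (mulfI X0)|apply: (mulfI Y0)]; rewrite mulr0.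
  have -> : X k * (f1 (x k) * g2 (x k) - f2 (x k) * g1 (x k)) =
     f1 (x k) * (X k * g2 (x k)) - (X k * f2 (x k)) * g1 (x k) by ring.
  by rewrite -F -G; ring.
have -> : Y k * (f1 (x k) * g2 (x k) - f2 (x k) * g1 (x k)) =
     (Y k * f1 (x k)) * g2 (x k) - f2 (x k) * (Y k * g1 (x k)) by ring.
by rewrite F G; ring.
Qed.

Lemma row_wedge_theta4 s s' f1 f2 g1 g2 :
  theta2 q (t0 * s / ki) f1 -> theta2 q (t0 * s * ki) f2 ->
  theta2 q (t0 * s' / ki) g1 -> theta2 q (t0 * s' * ki) g2 ->
  (forall z, z != 0 -> holo_at (wedge f1 f2 g1 g2) z) /\
  (forall z, z != 0 -> wedge f1 f2 g1 g2 (q * z) =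
     (t0 ^+ 2 * (s * s')) * z ^- 4 * wedge f1 f2 g1 g2 z).
Proof.
by move=> h1 h2 h3 h4; apply: (wedge_theta4 h1 h2 h3 h4); field.
Qed.

(** The wedge has multiplier $t_0^2ss'$, whereas the product of its four zeros $x_k$ is $t_0^2$. *)
Lemma wedge_off s s' f1 f2 g1 g2 : s != 0 -> s' != 0 -> solution_row s f1 f2 ->
  solution_row s' g1 g2 ->
  ~ qZ q (s * s') -> forall z, z != 0 -> wedge f1 f2 g1 g2 z = 0.
Proof.
move=> s0 s0' [f1t f2t fe] [g1t g2t ge] ss.
have [hw wq] := row_wedge_theta4 f1t f2t g1t g2t.
apply: (theta_interpolation0 q0 q1 s4_neq0 s4_distinct _ hw wq).
- by rewrite !mulf_neq0 ?expf_neq0.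
- by move=> p; rewrite !inE => /or4P [] /eqP ->; apply: wedge_root; rewrite ?fe ?ge.
by rewrite s4_prod mulrAC mulfV ?mul1r // expf_neq0.
Qed.

Lemma wedge_const s s' f1 f2 g1 g2 : solution_row s f1 f2 -> solution_row s' g1 g2 ->
  s * s' = 1 -> exists beta, forall z, z != 0 -> wedge f1 f2 g1 g2 z = beta *
    theta_prod q s4 z.
Proof.
move=> [f1t f2t fe] [g1t g2t ge] ss.
have [hw wq] := row_wedge_theta4 f1t f2t g1t g2t.
apply: (theta_interpolation1 q0 q1 s4_neq0 s4_distinct hw).
  by rewrite s4_prod; move: wq; rewrite ss mulr1.
by move=> p; rewrite !inE => /or4P [] /eqP ->; apply: wedge_root; rewrite ?fe ?ge.
Qed.

Section TwoRows.
Variables (s : K) (f1 f2 g1 g2 : K -> K).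
Hypotheses (s0 : s != 0) (s2 : ~ qZ q (s ^+ 2)).
Hypotheses (rf : solution_row s f1 f2) (rg : solution_row s^-1 g1 g2).

Let sV0 : s^-1 != 0. Proof. by rewrite invr_neq0. Qed.

Lemma notin_qZ_sqrt : ~ qZ q s.
Proof. by move=> H; apply: s2; rewrite expr2; exact: qZM. Qed.

Lemma T1_neq0 beta : beta != 0 ->
  (forall z, z != 0 -> wedge f1 f2 g1 g2 z = beta * theta_prod q s4 z) -> T 1 != 0.
Proof.
move=> b0 wE; apply/eqP => T1.
have [||h1 [h2 [h1t h2t he [z z0 hz]]]] := row_exists q0 q1 _ _ x0 T1.
- by rewrite !mulf_neq0 ?oner_neq0 ?invr_neq0.
- by rewrite !mulf_neq0 ?oner_neq0.
have rh : solution_row 1 h1 h2 by split.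
have fh : forall z, z != 0 -> wedge f1 f2 h1 h2 z = 0.
  apply: (wedge_off s0 (oner_neq0 _) rf rh); rewrite mulr1; exact: notin_qZ_sqrt.
have gh : forall z, z != 0 -> wedge g1 g2 h1 h2 z = 0.
  apply: (wedge_off sV0 (oner_neq0 _) rg rh); rewrite mulr1 => /qZV; rewrite invrK.
  exact: notin_qZ_sqrt.
(* The row [h] is proportional to both [f] and [g], so its entries times the wedge of [f] and [g]
   vanish; then the theta product is cancelled. *)
have H1 : forall z, z != 0 -> h1 z = 0.
  apply: (theta_prod_cancel q0 q1 s4_neq0 s4_distinct (h := fun=> 0)) => u u0.
  - by apply: holo_ccont; case: h1t => h _; exact: h.
  - exact: ccont_cst.
  rewrite mul0r; apply: (mulfI b0); rewrite mulr0 mulrCA -wE // /wedge.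
  have := fh u u0; have := gh u u0; rewrite /wedge => /eqP; rewrite subr_eq0 => /eqP G.
  move=> /eqP; rewrite subr_eq0 => /eqP F.
  have -> : h1 u * (f1 u * g2 u - f2 u * g1 u) = f1 u * (g2 u * h1 u) - g1 u * (f2 u *
    h1 u).
    by ring.
  by rewrite -F -G; ring.
have H2 : forall z, z != 0 -> h2 z = 0.
  apply: (theta_prod_cancel q0 q1 s4_neq0 s4_distinct (h := fun=> 0)) => u u0.
  - by apply: holo_ccont; case: h2t => h _; exact: h.
  - exact: ccont_cst.
  rewrite mul0r; apply: (mulfI b0); rewrite mulr0 mulrCA -wE // /wedge.
  have := fh u u0; have := gh u u0; rewrite /wedge => /eqP; rewrite subr_eq0 => /eqP G.
  move=> /eqP; rewrite subr_eq0 => /eqP F.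
  have -> : h2 u * (f1 u * g2 u - f2 u * g1 u) = g2 u * (f1 u * h2 u) - f2 u * (g1 u *
    h2 u).
    by ring.
  by rewrite F G; ring.
by move: hz; rewrite H1 // H2 // eqxx.
Qed.

Hypotheses (nf : nz f1 \/ nz f2) (ng : nz g1 \/ nz g2).
Hypothesis fg0 : forall z, z != 0 -> wedge f1 f2 g1 g2 z = 0.
Hypothesis T1 : T 1 != 0.

Let af0 : t0 * s / ki != 0. Proof. by rewrite !mulf_neq0 ?invr_neq0. Qed.
Let bf0 : t0 * s * ki != 0. Proof. by rewrite !mulf_neq0. Qed.
Let ag0 : t0 * s^-1 / ki != 0. Proof. by rewrite !mulf_neq0 ?invr_neq0. Qed.
Let bg0 : t0 * s^-1 * ki != 0. Proof. by rewrite !mulf_neq0 ?invr_neq0. Qed.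

Let holof1 z : z != 0 -> holo_at f1 z. Proof. by case: rf => -[h _] _ _; exact: h. Qed.
Let holof2 z : z != 0 -> holo_at f2 z. Proof. by case: rf => _ [h _] _; exact: h. Qed.
Let holog1 z : z != 0 -> holo_at g1 z. Proof. by case: rg => -[h _] _ _; exact: h. Qed.
Let holog2 z : z != 0 -> holo_at g2 z. Proof. by case: rg => _ [h _] _; exact: h. Qed.

Lemma not_nz f : nz f -> ~ (forall z, z != 0 -> f z = 0).
Proof. by move=> [z z0 fz] H; move: fz; rewrite H // eqxx. Qed.

(** Products of zeros are compared. If both entries of [f] are nonzero, both multipliers agree with
    $x_ix_js^2$ modulo $q^{\mathbb Z}$, so $\kappa_\infty^2\in q^{\mathbb Z}$. If one entry of [f]
    is zero, so is the same entry of [g], and the remaining entries of [f] and [g] give $s^2\in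
    q^{\mathbb Z}$. *)
Lemma no_two_shifted i j : (i < 4)%N -> (j < 4)%N -> i != j ->
  f1 (x i * s) = 0 -> f2 (x i * s) = 0 -> g1 (x i / s) = 0 -> g2 (x i / s) = 0 ->
  f1 (x j * s) = 0 -> f2 (x j * s) = 0 -> g1 (x j / s) = 0 -> g2 (x j / s) = 0 -> False.
Proof.
move=> i4 j4 ij f1i f2i g1i g2i f1j f2j g1j g2j.
have [f1t f2t _] := rf; have [g1t g2t _] := rg.
have xi0 := x0 i; have xj0 := x0 j.
have pi0 : x i * s != 0 by rewrite mulf_neq0.
have pj0 : x j * s != 0 by rewrite mulf_neq0.
have ri0 : x i / s != 0 by rewrite mulf_neq0.
have rj0 : x j / s != 0 by rewrite mulf_neq0.
have dp : ~ qZ q (x i * s / (x j * s)).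
  have -> : x i * s / (x j * s) = x i / x j by field; rewrite xj0 s0.
  exact: xd.
have dr : ~ qZ q (x i / s / (x j / s)).
  have -> : x i / s / (x j / s) = x i / x j by field; rewrite xj0 s0.
  exact: xd.
have F1 := theta2_two_zeros q0 q1 af0 f1t pi0 pj0 dp f1i f1j.
have F2 := theta2_two_zeros q0 q1 bf0 f2t pi0 pj0 dp f2i f2j.
have G1 := theta2_two_zeros q0 q1 ag0 g1t ri0 rj0 dr g1i g1j.
have G2 := theta2_two_zeros q0 q1 bg0 g2t ri0 rj0 dr g2i g2j.
case: (nzP f1) => [n1|z1]; case: (nzP f2) => [n2|z2].
- case: F1 => [/(not_nz n1) //|A]; case: F2 => [/(not_nz n2) //|B].
  apply: ki2; have := qZM q0 (qZV A) B.
  by congr (qZ q _); field; rewrite t00 ki0 s0 xi0 xj0.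
- have fg : forall z, z != 0 -> f1 z * g2 z = 0.
    by move=> z z0; have := fg0 z0; rewrite /wedge z2 // mul0r subr0.
  have [/(not_nz n1) //|zg2] := theta2_cancel q0 q1 bg0 g2t ri0 rj0 dr g2i g2j holof1 fg.
  case: F1 => [/(not_nz n1) //|A].
  case: ng => [m1|/not_nz //]; case: G1 => [/(not_nz m1) //|B].
  apply: s2; have := qZM q0 (qZV A) B.
  by congr (qZ q _); field; rewrite t00 ki0 s0 xi0 xj0.
- have fg : forall z, z != 0 -> f2 z * g1 z = 0.
    by move=> z z0; have := fg0 z0; rewrite /wedge z1 // mul0r sub0r => /eqP; rewrite
      oppr_eq0 => /eqP.
  have [/(not_nz n2) //|zg1] := theta2_cancel q0 q1 ag0 g1t ri0 rj0 dr g1i g1j holof2 fg.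
  case: F2 => [/(not_nz n2) //|A].
  case: ng => [/not_nz //|m2]; case: G2 => [/(not_nz m2) //|B].
  apply: s2; have := qZM q0 (qZV A) B.
  by congr (qZ q _); field; rewrite t00 ki0 s0 xi0 xj0.
by case: nf => /not_nz.
Qed.

(** A nonzero entry would have a multiplier equivalent to both $x_ix_j$ and $x_ix_k$, which forces
    $x_j/x_k\in q^{\mathbb Z}$. *)
Lemma no_three_common i j k : (i < 4)%N -> (j < 4)%N -> (k < 4)%N -> i != j -> i != k
  -> j != k ->
  f1 (x i) = 0 -> f2 (x i) = 0 -> f1 (x j) = 0 -> f2 (x j) = 0 ->
  f1 (x k) = 0 -> f2 (x k) = 0 -> False.
Proof.
move=> i4 j4 k4 ij ik jk f1i f2i f1j f2j f1k f2k.
have [f1t f2t _] := rf.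
have H c f : c != 0 -> theta2 q c f -> f (x i) = 0 -> f (x j) = 0 -> f (x k) = 0 ->
    forall z, z != 0 -> f z = 0.
  move=> c0 ft fi fj fk.
  have [//|A] := theta2_two_zeros q0 q1 c0 ft (x0 i) (x0 j) (xd i4 j4 ij) fi fj.
  have [//|B] := theta2_two_zeros q0 q1 c0 ft (x0 i) (x0 k) (xd i4 k4 ik) fi fk.
  case: (xd j4 k4 jk); have := qZM q0 (qZV A) B.
  by congr (qZ q _); field; rewrite c0 !x0.
by case: nf => /not_nz; apply; [exact: (H _ f1 af0)|exact: (H _ f2 bf0)].
Qed.

(* Let h be the dual row: ell h j = (j == k). Then f /\ h and g /\ h vanish at the
   three x_j with j <> k, so that their fourth zeros are x_k s and x_k / s; since
   f /\ g = 0, one may compare f (g /\ h) with g (f /\ h). *)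
Lemma zero_alternative k j1 j2 j3 : perm_eq [:: j1; j2; j3; k] [:: 0; 1; 2; 3]%N ->
  (f1 (x k) = 0 /\ f2 (x k) = 0) \/
  [/\ f1 (x k * s) = 0, f2 (x k * s) = 0, g1 (x k / s) = 0 & g2 (x k / s) = 0].
Proof.
move=> pe.
have lt4 j : j \in [:: j1; j2; j3; k] -> (j < 4)%N.
  by rewrite (perm_mem pe) !inE => /or4P [] /eqP ->.
have [l1 l2 l3 lk] : [/\ (j1 < 4)%N, (j2 < 4)%N, (j3 < 4)%N & (k < 4)%N].
  by split; apply: lt4; rewrite !inE eqxx ?orbT.
have : uniq [:: j1; j2; j3; k] by rewrite (perm_uniq pe).
rewrite /= !inE !negb_or !andbT => /andP[/and3P[n12 n13 n1k] /andP[/andP[n23 n2k] n3k]].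
have kx : x j1 * x j2 * x j3 * x k = t0 ^+ 2.
  have : \prod_(j <- [:: j1; j2; j3; k]) x j = \prod_(j <- [:: 0; 1; 2; 3]%N) x j.
    exact: perm_big.
  by rewrite !big_cons !big_nil !mulr1 /= !mulrA => ->; rewrite -xprod.
have [f1t f2t fe] := rf; have [g1t g2t ge] := rg.
have [||h1 [h2 [h1t h2t he]]] := dual_row q0 q1 _ _ x0 T1 lk.
- by rewrite !mulf_neq0 ?oner_neq0 ?invr_neq0.
- by rewrite !mulf_neq0 ?oner_neq0.
have [hF Fq] := row_wedge_theta4 f1t f2t h1t h2t.
have [hG Gq] := row_wedge_theta4 g1t g2t h1t h2t.
have xk0 := x0 k.
have Froot j : (j < 4)%N -> j != k -> wedge f1 f2 h1 h2 (x j) = 0.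
  by move=> j4 /negPf jk; apply: wedge_root; rewrite ?fe ?he ?jk.
have Groot j : (j < 4)%N -> j != k -> wedge g1 g2 h1 h2 (x j) = 0.
  by move=> j4 /negPf jk; apply: wedge_root; rewrite ?ge ?he ?jk.
have ds : qdistinct q [:: x j1; x j2; x j3].
  split; first by move=> y; rewrite !inE => /orP [] /eqP ->; exact: xd.
  by split; [move=> y; rewrite !inE => /eqP ->; exact: xd|split].
have ns u : u != 0 -> all_neq0 [:: x j1; x j2; x j3; u].
  by move=> u0 p; rewrite !inE => /or4P [] /eqP ->.
have n3 : all_neq0 [:: x j1; x j2; x j3] by move=> p; rewrite !inE => /or3P [] /eqP ->.
have xks0 : x k * s != 0 by rewrite mulf_neq0.
have xkV0 : x k / s != 0 by rewrite mulf_neq0.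
(* The wedge of [f] and [h] has multiplier $t_0^2s=x_{j_1}x_{j_2}x_{j_3}(x_ks)$, which locates the
   fourth zero at $x_ks$; for [g] it is $x_k/s$. *)
have [||||c FE] := three_zeros q0 q1 (ns _ xks0) ds hF; try exact: Froot.
  by move=> z z0; rewrite Fq // mulr1 -kx !mulrA.
have [||||c' GE] := three_zeros q0 q1 (ns _ xkV0) ds hG; try exact: Groot.
  by move=> z z0; rewrite Gq // mulr1 -kx !mulrA.
have split3 u z : theta_prod q [:: x j1; x j2; x j3; u] z =
    theta (z / u) * theta_prod q [:: x j1; x j2; x j3] z.
  by rewrite !theta_prod_cons /theta_prod big_nil; ring.
have hl u z : u != 0 -> z != 0 -> holo_at (fun w => theta (w / u)) z.
  move=> u0 z0; have l : holo_at (fun w => w / u) z by exact: (holoM (holo_id z)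
    (holo_cst u^-1 z)).
  by apply: (@holo_comp _ theta _ _ l); apply: holo_theta; rewrite ?mulf_neq0 ?invr_neq0.
have key (f g : K -> K) : (forall z, z != 0 -> holo_at f z) -> (forall z, z != 0 ->
  holo_at g z) ->
    (forall z, z != 0 -> f z * wedge g1 g2 h1 h2 z = g z * wedge f1 f2 h1 h2 z) ->
    forall z, z != 0 -> f z * (c' * theta (z / (x k / s))) = g z * (c * theta (z / (x k
      * s))).
  move=> hf hg E; apply: (theta_prod_cancel q0 q1 n3 ds) => z z0.
  - by apply: holo_ccont; apply: holoM; [exact: hf|exact: (holoM (holo_cst c' z) (hl _
    _ xkV0 z0))].
  - by apply: holo_ccont; apply: holoM; [exact: hg|exact: (holoM (holo_cst c z) (hl _ _
    xks0 z0))].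
  have := E z z0; rewrite FE // GE // !split3 => E'.
  by move: E'; set D := theta_prod _ _ _; rewrite !mulrA.
have E1 := key f1 g1 holof1 holog1 _; have E2 := key f2 g2 holof2 holog2 _.
have {E1}E1 : forall z, z != 0 -> f1 z * (c' * theta (z / (x k / s))) = g1 z * (c *
  theta (z / (x k * s))).
  apply: E1 => z z0; have := fg0 z0; rewrite /wedge => /eqP; rewrite subr_eq0 => /eqP E.
  have -> : f1 z * (g1 z * h2 z - g2 z * h1 z) = f1 z * g1 z * h2 z - (f1 z * g2 z) *
    h1 z by ring.
  by rewrite E; ring.
have {E2}E2 : forall z, z != 0 -> f2 z * (c' * theta (z / (x k / s))) = g2 z * (c *
  theta (z / (x k * s))).
  apply: E2 => z z0; have := fg0 z0; rewrite /wedge => /eqP; rewrite subr_eq0 => /eqP E.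
  have -> : f2 z * (g1 z * h2 z - g2 z * h1 z) = (f2 z * g1 z) * h2 z - f2 z * g2 z *
    h1 z by ring.
  by rewrite -E; ring.
have single u : u != 0 -> all_neq0 [:: u] /\ qdistinct q [:: u].
  by move=> u0; split; [move=> p; rewrite inE => /eqP ->|split].
have prod1 u z : theta_prod q [:: u] z = theta (z / u).
  by rewrite theta_prod_cons /theta_prod big_nil mulr1.
have kill u d f : u != 0 -> (forall z, z != 0 -> holo_at f z) ->
    (forall z, z != 0 -> f z * (d * theta (z / u)) = 0) -> nz f -> d = 0.
  move=> u0 hf E nzf; apply/eqP; apply: contraT => d0; case: (not_nz nzf).
  have [us uds] := single u u0.
  apply: (theta_prod_cancel q0 q1 us uds (h := fun=> 0)) => z z0.
  - exact: holo_ccont (hf z z0).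
  - exact: ccont_cst.
  by rewrite prod1 mul0r; apply: (mulfI d0); rewrite mulrCA E // mulr0.
have nks : theta (s ^+ 2) != 0 by rewrite theta_neq0 // expf_neq0.
have nks' : theta (s ^- 2) != 0.
  by rewrite theta_neq0 // ?invr_neq0 ?expf_neq0 // => /qZV; rewrite invrK.
(* If [c] is 0, [f] is parallel to [h] also at [x k]; since [ell f k = 0] and [ell h k = 1], the row
   [f] vanishes there. Otherwise [c'] is nonzero too, and [E1], [E2] are evaluated at $x_ks$ and
   $x_k/s$, where one side vanishes while $\theta_q(s^{\pm2})\ne0$. *)
have [c0|c0] := eqVneq c 0.
  left.
  have c'0 : c' = 0.
    case: nf => n; [apply: (kill _ c' f1 xkV0 holof1)|apply: (kill _ c' f2 xkV0
      holof2)] => // z z0.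
      by rewrite E1 // c0 mul0r mulr0.
    by rewrite E2 // c0 mul0r mulr0.
  have := FE (x k) xk0; rewrite c0 mul0r /wedge => /eqP; rewrite subr_eq0 => /eqP W.
  have Eh : Y k * h1 (x k) - X k * h2 (x k) = 1 by have := he k lk; rewrite eqxx.
  have := fe k lk; rewrite /ell => /eqP; rewrite subr_eq0 => /eqP Ef.
  split.
    rewrite -[f1 _]mulr1 -Eh mulrBr !mulrA [f1 _ * Y k]mulrC Ef.
    have -> : X k * f2 (x k) * h1 (x k) - f1 (x k) * X k * h2 (x k) =
       X k * (f2 (x k) * h1 (x k) - f1 (x k) * h2 (x k)) by ring.
    by rewrite W subrr mulr0.
  rewrite -[f2 _]mulr1 -Eh mulrBr.
  have -> : f2 (x k) * (Y k * h1 (x k)) - f2 (x k) * (X k * h2 (x k)) =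
    Y k * (f2 (x k) * h1 (x k)) - (X k * f2 (x k)) * h2 (x k) by ring.
  by rewrite -W -Ef; ring.
have c'0 : c' != 0.
  apply: contraNneq c0 => c'0; apply/eqP.
  case: ng => n; [apply: (kill _ c g1 xks0 holog1)|apply: (kill _ c g2 xks0 holog2)] =>
    // z z0.
    by rewrite -E1 // c'0 mul0r mulr0.
  by rewrite -E2 // c'0 mul0r mulr0.
have ss1 : x k * s / (x k / s) = s ^+ 2 by field; rewrite s0 xk0.
have ss2 : x k / s / (x k * s) = s ^- 2 by field; rewrite s0 xk0.
have n1 : c' * theta (s ^+ 2) != 0 by rewrite mulf_neq0.
have n2 : c * theta (s ^- 2) != 0 by rewrite mulf_neq0.
right; split.
- have /eqP := E1 _ xks0; rewrite ss1 divff // theta1 // !mulr0.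
  by rewrite mulf_eq0 (negPf n1) orbF => /eqP.
- have /eqP := E2 _ xks0; rewrite ss1 divff // theta1 // !mulr0.
  by rewrite mulf_eq0 (negPf n1) orbF => /eqP.
- have /esym/eqP := E1 _ xkV0; rewrite ss2 divff // theta1 // !mulr0.
  by rewrite mulf_eq0 (negPf n2) orbF => /eqP.
have /esym/eqP := E2 _ xkV0; rewrite ss2 divff // theta1 // !mulr0.
by rewrite mulf_eq0 (negPf n2) orbF => /eqP.
Qed.

(** Pigeonhole over the alternatives for the four indices: at least three of the first kind, or at
    least two of the second. *)
Lemma rows_not_parallel : False.
Proof.
have A0 := @zero_alternative 0 1 2 3 isT.
have A1 := @zero_alternative 1 0 2 3 isT.
have A2 := @zero_alternative 2 0 1 3 isT.
have A3 := @zero_alternative 3 0 1 2 isT.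
have N2 := no_two_shifted; have N3 := no_three_common.
case: A0 => [[a1 a2]|[a1 a2 a3 a4]]; case: A1 => [[b1 b2]|[b1 b2 b3 b4]];
case: A2 => [[c1 c2]|[c1 c2 c3 c4]]; case: A3 => [[d1 d2]|[d1 d2 d3 d4]];
first [exact: (@N3 0 1 2)%N|exact: (@N3 0 1 3)%N|exact: (@N3 0 2 3)%N|exact: (@N3 1 2
  3)%N|
   exact: (@N2 0 1)%N|exact: (@N2 0 2)%N|exact: (@N2 0 3)%N|exact: (@N2 1 2)%N|
   exact: (@N2 1 3)%N|exact: (@N2 2 3)%N].
Qed.

End TwoRows.

End Solutions.

(** * The polynomial T and the coordinates *)

Section ThomLink.
Variable R : realType.
Local Notation K := R[i].
Variable q : K.
Hypotheses (q0 : q != 0) (q1 : normc q < 1).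
Local Notation theta := (theta q).

Lemma ThomE (kappa : params K) (t0 : K) (X Y : nat -> K) :
  Thom q kappa t0 (fun k => X k) (fun k => Y k) =
    Tcoef q kappa t0 1 2 * (X 0%N * X 1%N * Y 2%N * Y 3%N)
  + Tcoef q kappa t0 1 3 * (X 0%N * X 2%N * Y 1%N * Y 3%N)
  + Tcoef q kappa t0 1 4 * (X 0%N * X 3%N * Y 1%N * Y 2%N)
  + Tcoef q kappa t0 2 3 * (X 1%N * X 2%N * Y 0%N * Y 3%N)
  + Tcoef q kappa t0 2 4 * (X 1%N * X 3%N * Y 0%N * Y 2%N)
  + Tcoef q kappa t0 3 4 * (X 2%N * X 3%N * Y 0%N * Y 1%N).
Proof.
rewrite /Thom; move: (Tcoef q kappa t0) => T.
have E (i j : 'I_4) : T i.+1 j.+1 * X i * X j * \prod_(k < 4 | (k != i) && (k != j)) Y k =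
   T i.+1 j.+1 * X i * X j * ((if (0 != i :> nat) && (0 != j :> nat) then Y 0%N else 1) *
     (if (1 != i :> nat) && (1 != j :> nat) then Y 1%N else 1) *
     (if (2 != i :> nat) && (2 != j :> nat) then Y 2%N else 1) *
     (if (3 != i :> nat) && (3 != j :> nat) then Y 3%N else 1)).
  rewrite big_mkcond !big_ord_recl big_ord0 -!val_eqE /= mulr1 !mulrA //.
under eq_bigr => i _ do rewrite (eq_bigr _ (fun j _ => E i j)) big_mkcond.
rewrite !big_ord_recl !big_ord0 /=.
ring.
Qed.

Lemma theta_eqV (u v : K) : v != 0 -> u * v = 1 -> theta u = - v^-1 * theta v.
Proof.
move=> v0 uv; rewrite -(theta_inv q0 q1 v0); congr theta.
by apply: (mulIf v0); rewrite uv mulVf.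
Qed.

Lemma thetas_pair (u v : K) : thetas q [:: u; v] = theta u * theta v.
Proof. by rewrite /thetas !big_cons big_nil mulr1. Qed.

(* The points x_k, extended by the harmless nonzero value 1 to all indices. *)
Definition xpt_nat (kappa : params K) (t0 : K) (k : nat) : K :=
  nth 1 [:: kt kappa * t0; (kt kappa)^-1 * t0; k1 kappa; (k1 kappa)^-1] k.

(** The theta arguments on both sides agree up to inversion. The monomials produced by [theta_eqV],
    together with the prefactors in [wr], combine to one factor common to all six terms. *)
Lemma Thom_Tpoly (s kt k1 ki t0 : K) (X Y : nat -> K) :
  s != 0 -> kt != 0 -> k1 != 0 -> ki != 0 -> t0 != 0 ->
  Thom q (Params s kt k1 ki) t0 (fun k => X k) (fun k => Y k) =
  - (s * kt * k1 * ki) *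
    Tpoly q (t0 * s / ki) (t0 * s * ki) (xpt_nat (Params s kt k1 ki) t0) X Y.
Proof.
move=> s0 kt0 k10 ki0 t00; rewrite ThomE /Tpoly /wr /xpt_nat /= !thetas_pair.
have -> : (kt * t0) * (kt^-1 * t0) / (t0 * s * ki) = s^-1 * ki^-1 * t0 by field;
  rewrite ?kt0 ?k10 ?ki0 ?s0 ?t00.
rewrite (@theta_eqV (k1 * k1^-1 / (t0 * s / ki)) (s * ki^-1 * t0)); [|by rewrite
  !mulf_neq0 ?invr_neq0|by field; rewrite ?kt0 ?k10 ?ki0 ?s0 ?t00].
have -> : (kt * t0) * k1 / (t0 * s * ki) = kt * k1 * s^-1 * ki^-1 by field; rewrite
  ?kt0 ?k10 ?ki0 ?s0 ?t00.
rewrite (@theta_eqV ((kt^-1 * t0) * k1^-1 / (t0 * s / ki)) (s * kt * k1 * ki^-1)); [|by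
  rewrite !mulf_neq0 ?invr_neq0|by field; rewrite ?kt0 ?k10 ?ki0 ?s0 ?t00].
rewrite (@theta_eqV ((kt * t0) * k1^-1 / (t0 * s * ki)) (s * k1 * ki * kt^-1)); [|by
  rewrite !mulf_neq0 ?invr_neq0|by field; rewrite ?kt0 ?k10 ?ki0 ?s0 ?t00].
have -> : (kt^-1 * t0) * k1 / (t0 * s / ki) = k1 * ki * s^-1 * kt^-1 by field; rewrite
  ?kt0 ?k10 ?ki0 ?s0 ?t00.
rewrite (@theta_eqV ((kt^-1 * t0) * k1 / (t0 * s * ki)) (s * kt * ki * k1^-1)); [|by
  rewrite !mulf_neq0 ?invr_neq0|by field; rewrite ?kt0 ?k10 ?ki0 ?s0 ?t00].
have -> : (kt * t0) * k1^-1 / (t0 * s / ki) = kt * ki * s^-1 * k1^-1 by field; rewrite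
  ?kt0 ?k10 ?ki0 ?s0 ?t00.
rewrite (@theta_eqV ((kt^-1 * t0) * k1^-1 / (t0 * s * ki)) (s * kt * k1 * ki)); [|by
  rewrite !mulf_neq0 ?invr_neq0|by field; rewrite ?kt0 ?k10 ?ki0 ?s0 ?t00].
have -> : (kt * t0) * k1 / (t0 * s / ki) = kt * k1 * ki * s^-1 by field; rewrite ?kt0
  ?k10 ?ki0 ?s0 ?t00.
rewrite (@theta_eqV (k1 * k1^-1 / (t0 * s * ki)) (s * ki * t0)); [|by rewrite
  !mulf_neq0 ?invr_neq0|by field; rewrite ?kt0 ?k10 ?ki0 ?s0 ?t00].
have -> : (kt * t0) * (kt^-1 * t0) / (t0 * s / ki) = s^-1 * ki * t0 by field; rewrite
  ?kt0 ?k10 ?ki0 ?s0 ?t00.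
have -> : (kt * t0) / (kt^-1 * t0) = kt ^+ 2 by field; rewrite ?kt0 ?k10 ?ki0 ?s0 ?t00.
have -> : k1 / k1^-1 = k1 ^+ 2 by field; rewrite ?kt0 ?k10 ?ki0 ?s0 ?t00.
have -> : (kt * t0) / k1 = kt * k1^-1 * t0 by field; rewrite ?kt0 ?k10 ?ki0 ?s0 ?t00.
have -> : (kt^-1 * t0) / k1^-1 = kt^-1 * k1 * t0 by field; rewrite ?kt0 ?k10 ?ki0 ?s0
  ?t00.
have -> : (kt * t0) / k1^-1 = kt * k1 * t0 by field; rewrite ?kt0 ?k10 ?ki0 ?s0 ?t00.
have -> : (kt^-1 * t0) / k1 = kt^-1 * k1^-1 * t0 by field; rewrite ?kt0 ?k10 ?ki0 ?s0
  ?t00.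
move: (theta (kt ^+ 2)) => u0.
move: (theta (k1 ^+ 2)) => u1.
move: (theta (kt * k1^-1 * t0)) => u2.
move: (theta (kt^-1 * k1 * t0)) => u3.
move: (theta (kt * k1 * t0)) => u4.
move: (theta (kt^-1 * k1^-1 * t0)) => u5.
move: (theta (s^-1 * ki^-1 * t0)) => u6.
move: (theta (s * ki^-1 * t0)) => u7.
move: (theta (kt * k1 * s^-1 * ki^-1)) => u8.
move: (theta (s * kt * k1 * ki^-1)) => u9.
move: (theta (s * k1 * ki * kt^-1)) => u10.
move: (theta (k1 * ki * s^-1 * kt^-1)) => u11.
move: (theta (s * kt * ki * k1^-1)) => u12.
move: (theta (kt * ki * s^-1 * k1^-1)) => u13.
move: (theta (s * kt * k1 * ki)) => u14.
move: (theta (kt * k1 * ki * s^-1)) => u15.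
move: (theta (s * ki * t0)) => u16.
move: (theta (s^-1 * ki * t0)) => u17.
by field; rewrite ?kt0 ?k10 ?ki0 ?s0 ?t00.
Qed.

(** Every [Tcoef] contains the parameter and its inverse in a pair of thetas that the substitution
    exchanges. *)
Lemma Thom_symm (s kt k1 ki t0 : K) (X Y : nat -> K) :
  Thom q (Params s^-1 kt k1 ki) t0 (fun k => X k) (fun k => Y k) =
  Thom q (Params s kt k1 ki) t0 (fun k => X k) (fun k => Y k).
Proof.
rewrite !ThomE /= !thetas_pair !invrK.
have -> : kt * k1 * s / ki = s * kt * k1 / ki by ring.
have -> : s^-1 * kt * k1 / ki = kt * k1 / s / ki by ring.
have -> : k1 * ki * s / kt = s * k1 * ki / kt by ring.
have -> : s^-1 * k1 * ki / kt = k1 * ki / s / kt by ring.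
have -> : kt * ki * s / k1 = s * kt * ki / k1 by ring.
have -> : s^-1 * kt * ki / k1 = kt * ki / s / k1 by ring.
have -> : s^-1 * kt * k1 * ki = kt * k1 * ki / s by ring.
have -> : kt * k1 * ki * s = s * kt * k1 * ki by ring.
do 16! [move: (theta _) => ?].
by do 4! [move: (X _) => ?]; do 4! [move: (Y _) => ?]; ring.
Qed.

End ThomLink.

(** * Column ratios and the two quotients *)

Section Coordinates.
Variable R : realType.
Local Notation K := R[i].

Lemma ord2P (P : 'I_2 -> Prop) : P 0 -> P 1 -> forall i, P i.
Proof.
move=> P0 P1 -[[|[|//]] i2].
  by have -> : Ordinal i2 = 0 by exact: val_inj.
by have -> : Ordinal i2 = 1 by exact: val_inj.
Qed.

Lemma det_mx2 (M : 'M[K]_2) : \det M = M 0 0 * M 1 1 - M 0 1 * M 1 0.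
Proof.
rewrite (expand_det_row _ 0) !big_ord_recl big_ord0 addr0 /cofactor !det_mx11 !mxE.
have -> : lift ord0 ord0 = 1 :> 'I_2 by exact: val_inj.
have E : lift (1 : 'I_2) 0 = 0 :> 'I_2 by exact: val_inj.
by rewrite ?E /= expr0 expr1; ring.
Qed.

Lemma is_column_ratioE (M : 'M[K]_2) p : is_column_ratio M p <->
  forall i, hom_y p * M i 0 = hom_x p * M i 1.
Proof.
case: p => [a|] /=; split=> H.
- by move=> i; have := congr1 (fun v : 'cV_2 => v i 0) H; rewrite !mxE mul1r.
- by apply/colP => i; have := H i; rewrite !mxE mul1r.
- by move=> i; have := congr1 (fun v : 'cV_2 => v i 0) H; rewrite !mxE mul0r mul1r.
- by apply/colP => i; have := H i; rewrite !mxE mul0r mul1r.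
Qed.

Lemma column_ratio_unique (M : 'M[K]_2) p p' : M != 0 ->
  is_column_ratio M p -> is_column_ratio M p' -> p = p'.
Proof.
move=> M0 /is_column_ratioE H /is_column_ratioE H'.
have [i Mi] : exists i, (M i 0 != 0) || (M i 1 != 0).
  apply: contrapT => N; move/eqP: M0; apply; apply/matrixP => i j; rewrite mxE.
  have {}N k : M k 0 = 0 /\ M k 1 = 0.
    by split; apply/eqP; apply: contraT => nz; case: N; exists k; rewrite nz ?orbT.
  by move: j; apply: ord2P; case: (N i).
have h := H i; have h' := H' i.
case: p p' h h' {H H'} => [a|] [a'|] /=; rewrite ?mul1r ?mul0r => h h'.
- have M1 : M i 1 != 0 by move: Mi; rewrite h; apply: contraTneq => ->; rewrite mulr0
  eqxx.
  by congr Some; apply: (mulIf M1); rewrite -h -h'.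
- by move: Mi; rewrite h -h' mulr0 eqxx.
- by move: Mi; rewrite h' -h mulr0 eqxx.
by [].
Qed.

Lemma column_ratio_exists (M : 'M[K]_2) : \det M = 0 -> exists p, is_column_ratio M p.
Proof.
rewrite det_mx2 => /eqP; rewrite subr_eq0 => /eqP D.
have [z1|n1] := eqVneq (M 0 1) 0; have [z2|n2] := eqVneq (M 1 1) 0.
- exists None; apply/is_column_ratioE => i /=; rewrite mul0r mul1r.
  by move: i; apply: ord2P; rewrite ?z1 ?z2.
- exists (Some (M 1 0 / M 1 1)); apply/is_column_ratioE; apply: ord2P => /=.
    apply: (mulIf n2); rewrite mul1r D z1 !(mul0r, mulr0) //.
  by rewrite mul1r divfK.
- exists (Some (M 0 0 / M 0 1)); apply/is_column_ratioE; apply: ord2P => /=.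
    by rewrite mul1r divfK.
  by apply: (mulfI n1); rewrite mul1r -D z2 !mulr0.
exists (Some (M 0 0 / M 0 1)); apply/is_column_ratioE; apply: ord2P => /=.
  by rewrite mul1r divfK.
apply: (mulfI n1); rewrite mul1r -D mulrA [_ * (_ / _)]mulrC divfK //.
Qed.

Lemma column_ratioP (M : 'M[K]_2) : \det M = 0 -> is_column_ratio M (column_ratio M).
Proof. by move=> /column_ratio_exists [p Hp]; exact: (xgetPex _ (ex_intro _ p Hp)). Qed.

Lemma column_ratioE (M : 'M[K]_2) p : M != 0 -> is_column_ratio M p -> column_ratio M = p.
Proof.
move=> M0 Hp; apply: (column_ratio_unique M0 _ Hp).
exact: (xgetPex _ (ex_intro _ p Hp)).
Qed.

Lemma scale_P1_1 (p : P1 K) : scale_P1 1 p = p.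
Proof. by case: p => [a|] //=; rewrite mul1r. Qed.

Lemma scale_P1M (c d : K) (p : P1 K) : scale_P1 c (scale_P1 d p) = scale_P1 (c * d) p.
Proof. by case: p => [a|] //=; rewrite mulrA. Qed.

Lemma scale_class_refl (rho : 'I_4 -> P1 K) : scale_class rho rho.
Proof. by exists 1; rewrite ?oner_neq0 // => k; rewrite scale_P1_1. Qed.

Lemma scale_class_eq (rho rho' : 'I_4 -> P1 K) : scale_class rho rho' ->
  scale_class rho' = scale_class rho.
Proof.
move=> [c c0 Hc]; apply/seteqP; split=> u [d d0 Hd].
  by exists (d * c); [rewrite mulf_neq0|move=> k; rewrite Hd Hc scale_P1M].
exists (d / c); first by rewrite mulf_neq0 ?invr_neq0.
by move=> k; rewrite Hd Hc scale_P1M divfK.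
Qed.

(* hom_x and hom_y are only homogeneous up to a common factor. *)
Lemma hom_scale (c : K) (p : P1 K) : c != 0 -> exists2 l, l != 0 &
  hom_x (scale_P1 c p) = l * (c * hom_x p) /\ hom_y (scale_P1 c p) = l * hom_y p.
Proof.
move=> c0; case: p => [a|] /=.
  by exists 1; rewrite ?oner_neq0 // !mul1r.
by exists c^-1; rewrite ?invr_neq0 // mulr1 mulVf // mulr0.
Qed.

Lemma hom_neq0 (p : P1 K) : (hom_x p != 0) || (hom_y p != 0).
Proof. by case: p => [a|] /=; rewrite oner_eq0 ?orbT. Qed.

Lemma diag_equivP (C C' : K -> 'M[K]_2) : diag_equiv C C' <->
  exists l m : 'I_2 -> K, [/\ forall i, l i != 0, forall j, m j != 0 &
    forall z, z != 0 -> forall i j, C' z i j = l i * C z i j * m j].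
Proof.
have diagE (D : 'M[K]_2) : is_diag_mx D && (D \in unitmx) ->
    D = diag_mx (\row_i D i i) /\ forall i, D i i != 0.
  move=> /andP[/is_diag_mxP dD uD].
  have DE : D = diag_mx (\row_i D i i).
    apply/matrixP => i j; rewrite !mxE; case: eqVneq => [->|ij]; first by rewrite mulr1n.
    by rewrite mulr0n dD.
  split => // i; move: uD; rewrite unitmxE unitfE DE det_diag.
  move=> /prodf_neq0 H; by have := H i isT; rewrite !mxE eqxx mulr1n.
have diagI (l : 'I_2 -> K) : (forall i, l i != 0) ->
    is_diag_mx (diag_mx (\row_i l i)) && (diag_mx (\row_i l i) \in unitmx).
  move=> l0; rewrite diag_mx_is_diag unitmxE unitfE det_diag /=.
  by apply/prodf_neq0 => k _; rewrite mxE.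
split.
  move=> [D1 [D2 [/diagE [E1 n1] /diagE [E2 n2] H]]].
  exists (fun i => D1 i i), (fun i => D2 i i); split => // z z0 i j.
  rewrite H // [in LHS]E1 [in LHS]E2 mul_mx_diag mul_diag_mx !mxE //.
move=> [l [m [l0 m0 H]]]; exists (diag_mx (\row_i l i)), (diag_mx (\row_i m i)).
split; [exact: diagI|exact: diagI|] => z z0; apply/matrixP => i j.
by rewrite mul_mx_diag mul_diag_mx !mxE H.
Qed.

Lemma diag_equiv_refl (C : K -> 'M[K]_2) : diag_equiv C C.
Proof.
apply/diag_equivP; exists (fun=> 1), (fun=> 1).
by split => [i|j|z z0 i j]; rewrite ?oner_neq0 // mul1r mulr1.
Qed.

Lemma diag_class_eq (C C' : K -> 'M[K]_2) : diag_equiv C C' -> diag_class C =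
  diag_class C'.
Proof.
move=> /diag_equivP [l [m [l0 m0 H]]]; apply/seteqP; split => C''.
  move=> /diag_equivP [l' [m' [l'0 m'0 H']]]; apply/diag_equivP.
  exists (fun i => l' i / l i), (fun j => m' j / m j).
  split => [i|j|z z0 i j]; try by rewrite mulf_neq0 ?invr_neq0.
  by rewrite H' // H //; field; rewrite l0 m0.
move=> /diag_equivP [l' [m' [l'0 m'0 H']]]; apply/diag_equivP.
exists (fun i => l' i * l i), (fun j => m' j * m j).
split => [i|j|z z0 i j]; try by rewrite mulf_neq0.
by rewrite H' // H //; ring.
Qed.

End Coordinates.

(** * Connection matrices and the bijection *)

Section Monodromy.
Variable R : realType.
Local Notation K := R[i].
Variables (q ka0 kat ka1 kai t0 : K).
Hypotheses (q0 : q != 0) (q1 : normc q < 1).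
Hypotheses (n0 : ka0 != 0) (nt : kat != 0) (n1 : ka1 != 0) (ni : kai != 0) (t00 : t0 !=
  0).
Let kappa := Params ka0 kat ka1 kai.
Hypothesis hres : nonresonant q kappa t0.
Local Notation x := (xpt_nat kappa t0).
Local Notation D := (theta_prod q [:: x 0%N; x 1%N; x 2%N; x 3%N]).
Implicit Types (C : K -> 'M[K]_2) (rho : 'I_4 -> P1 K) (z : K).

Let nV : ka0^-1 != 0. Proof. by rewrite invr_neq0. Qed.

Let sq0 : ~ qZ q (ka0 ^+ 2). Proof. by case: hres => -[]. Qed.
Let sqi : ~ qZ q (kai ^+ 2). Proof. by case: hres => -[]. Qed.

Lemma xpt_neq0 k : x k != 0.
Proof.
by case: k => [|[|[|[|k]]]]; rewrite /xpt_nat /= ?mulf_neq0 ?invr_neq0 // nth_nil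
  oner_neq0.
Qed.

Lemma xpt_prod : x 0%N * x 1%N * x 2%N * x 3%N = t0 ^+ 2.
Proof. by rewrite /xpt_nat /=; field; rewrite nt n1. Qed.

(** The six ratios are $\kappa_t^2$, $\kappa_1^2$ and $t_0(\kappa_t\kappa_1)^{\pm1}$,
    $t_0(\kappa_t/\kappa_1)^{\pm1}$, which up to inversion are those excluded by non-resonance. *)
Lemma xpt_distinct i j : (i < 4)%N -> (j < 4)%N -> i != j -> ~ qZ q (x i / x j).
Proof.
wlog ij : i j / (i < j)%N.
  move=> H i4 j4; rewrite neq_ltn => /orP[ij|ji]; first by apply: H; rewrite // neq_ltn
    ij.
  move=> /qZV; rewrite invfM invrK mulrC; apply: H => //.
  by rewrite neq_ltn ji.
have := hres; rewrite /nonresonant /= => -[[_ ht h1 _] r1 r2 r3 r4].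
have back u v : u != 0 -> t0 * u^-1 = v -> qZ q u -> (exists2 w, qZ q w & t0 * w = v).
  by move=> u0 <- /qZV uq; exists u^-1.
case: i ij => [|[|[|[|i]]]] //; case: j => [|[|[|[|j]]]] // _ _ _ _; rewrite /xpt_nat
  /= => H.
- by apply: ht; move: H; congr (qZ q _); field; rewrite nt t00.
- apply: r4; apply: (back _ _ _ _ H); first by rewrite !mulf_neq0 ?invr_neq0.
  by field; rewrite nt n1 t00.
- apply: r2; apply: (back _ _ _ _ H); first by rewrite !mulf_neq0 ?invr_neq0.
  by field; rewrite nt n1 t00.
- apply: r1; apply: (back _ _ _ _ H); first by rewrite !mulf_neq0 ?invr_neq0.
  by field; rewrite nt n1 t00.
- apply: r3; apply: (back _ _ _ _ H); first by rewrite !mulf_neq0 ?invr_neq0.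
  by field; rewrite nt n1 t00.
by apply: h1; move: H; congr (qZ q _); field; rewrite n1.
Qed.

Lemma xpt_tnth (k : 'I_4) : x k = tnth (xpt kappa t0) k.
Proof. by rewrite /xpt_nat (tnth_nth 1). Qed.

Let D_neq0 := s4_neq0 xpt_neq0.
Let D_dist := s4_distinct xpt_distinct.

Lemma D_generic : exists2 z, z != 0 & D z != 0.
Proof.
have [w w0 Hw] := generic_point q0 q1 [:: x 0%N; x 1%N; x 2%N; x 3%N].
by exists w => //; apply/eqP => /(theta_prod_eq0 q0 q1 D_neq0 w0) [p /Hw].
Qed.

Lemma thetas_D z : thetas q [:: kat * z / t0; kat^-1 * z / t0; ka1 * z; ka1^-1 * z] = D z.
Proof.
rewrite /thetas /theta_prod !big_cons !big_nil /xpt_nat /= !mulr1.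
have -> : z / (kat * t0) = kat^-1 * z / t0 by field; rewrite nt t00.
have -> : z / (kat^-1 * t0) = kat * z / t0 by field; rewrite nt t00.
have -> : z / ka1^-1 = ka1 * z by rewrite invrK mulrC.
have -> : z / ka1 = ka1^-1 * z by rewrite mulrC.
by ring.
Qed.

Definition entry C (i j : 'I_2) : K -> K := fun z => C z i j.

Lemma entry_wedge C z :
  \det (C z) = wedge (entry C 0 0) (entry C 0 1) (entry C 1 0) (entry C 1 1) z.
Proof. by rewrite det_mx2. Qed.

Definition rows_of C := [/\ theta2 q (t0 * ka0 / kai) (entry C 0 0),
  theta2 q (t0 * ka0 * kai) (entry C 0 1),
  theta2 q (t0 * ka0^-1 / kai) (entry C 1 0) &
  theta2 q (t0 * ka0^-1 * kai) (entry C 1 1)].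

(** The factors $\kappa_0^{\sigma_3}$ and $\kappa_\infty^{-\sigma_3}$ are diagonal, so the
    q-difference equation decouples into one scalar equation per entry. *)
Lemma connection_matrixE C : connection_matrix q kappa t0 C <-> rows_of C /\
  exists2 c, c != 0 & forall z, z != 0 ->
    wedge (entry C 0 0) (entry C 0 1) (entry C 1 0) (entry C 1 1) z = c * D z.
Proof.
have detE : (exists2 c, c != 0 & forall z, z != 0 ->
    wedge (entry C 0 0) (entry C 0 1) (entry C 1 0) (entry C 1 1) z = c * D z) <->
  (exists2 c : K, c != 0 & forall z : K, z != 0 ->
        \det (C z) = c * thetas q [:: kt kappa * z / t0; (kt kappa)^-1 * z / t0;
                                      k1 kappa * z; (k1 kappa)^-1 * z]).
  split=> -[c c0 H]; exists c => // z z0; first by rewrite thetas_D -H // entry_wedge.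
  by rewrite -entry_wedge H // thetas_D.
have entryE (M : 'M[K]_2) i j z : ((t0 * z ^- 2) *: (pow_sigma3 ka0 *m M *m pow_sigma3
  kai^-1)) i j
  = t0 * z ^- 2 * ((if i == 0 then ka0 else ka0^-1) * M i j * (if j == 0 then kai^-1
    else kai)).
  by rewrite /pow_sigma3 mul_mx_diag mul_diag_mx !mxE invrK.
split.
  move=> [hC fC /detE dC]; split => //.
  have hol i j z : z != 0 -> holo_at (entry C i j) z by move=> /(hC i j z) /holo_atP.
  split; split; try exact: hol; move=> z z0; rewrite /entry fC // entryE /=; field;
    by rewrite z0 ?ni ?n0.
move=> [[[h00 e00] [h01 e01] [h10 e10] [h11 e11]] /detE dC]; split => //.
  move=> i j z z0; apply/holo_atP; move: i j; apply: ord2P; apply: ord2P.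
  - exact: h00.
  - exact: h01.
  - exact: h10.
  - exact: h11.
move=> z z0; apply/matrixP => i j; rewrite entryE; move: i j; apply: ord2P; apply:
  ord2P => /=.
- by rewrite [LHS]e00 // /entry; field; rewrite z0 ni.
- by rewrite [LHS]e01 // /entry; field; rewrite z0.
- by rewrite [LHS]e10 // /entry; field; rewrite z0 ni n0.
- by rewrite [LHS]e11 // /entry; field; rewrite z0 n0.
Qed.

Lemma x_in (k : 'I_4) : x k \in [:: x 0%N; x 1%N; x 2%N; x 3%N].
Proof. by case: k => -[|[|[|[|//]]]] k4; rewrite !inE eqxx ?orbT. Qed.

(* The determinant has a simple zero at x_k, whereas it would have a double zero
   if all entries vanished there. *)
Lemma connection_rank C (k : 'I_4) : connection_matrix q kappa t0 C ->
  \det (C (x k)) = 0 /\ C (x k) != 0.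
Proof.
move=> /connection_matrixE [[[h00 _] [h01 _] [h10 _] [h11 _]] [c c0 dE]].
have xk0 := xpt_neq0 k.
have Dx : D (x k) = 0 by exact: theta_prod_root D_neq0 (x_in k).
split; first by rewrite entry_wedge dE // Dx mulr0.
apply/eqP => Ck.
have e0 i j : entry C i j (x k) = 0 by rewrite /entry Ck mxE.
have [_ [psi [cpsi DE] psi0]] := simple_theta_prod q0 q1 D_neq0 D_dist xk0 Dx.
have [p00 [c00 E00]] := h00 _ xk0; have [p01 [c01 E01]] := h01 _ xk0.
have [p10 [c10 E10]] := h10 _ xk0; have [p11 [c11 E11]] := h11 _ xk0.
have : c * psi (x k) = (x k - x k) * (p00 (x k) * p11 (x k) - p01 (x k) * p10 (x k)).
  apply: (@ccont_punctured_eq R (fun w => c * psi w)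
    (fun w => (w - x k) * (p00 w * p11 w - p01 w * p10 w))).
  - exact: (ccontM (@ccont_cst _ c _) cpsi).
  - apply: ccontM; first exact: (ccontB (@ccont_id _ _) (@ccont_cst _ (x k) _)).
    exact: (ccontB (ccontM c00 c11) (ccontM c01 c10)).
  exists `|x k|; first by rewrite normr_gt0.
  move=> w wx wd; have w0 : w != 0.
    by apply: contraTneq wd => ->; rewrite sub0r normrN ltxx.
  have wx' : w - x k != 0 by rewrite subr_eq0.
  apply: (mulIf wx'); have := dE w w0.
  rewrite DE Dx add0r /wedge E00 E01 E10 E11 !e0 !add0r => Hd.
  have -> : c * psi w * (w - x k) = c * (psi w * (w - x k)) by rewrite mulrA.
  by rewrite -Hd; ring.
by rewrite subrr mul0r => /eqP; rewrite mulf_eq0 (negPf c0) (negPf psi0).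
Qed.

(** Indexed by [nat] to match [Tpoly]; [inord] sends the indices from 4 on to 0. *)
Definition hX rho (k : nat) := hom_x (rho (inord k)).
Definition hY rho (k : nat) := hom_y (rho (inord k)).

Lemma hXY rho k : (hX rho k != 0) || (hY rho k != 0).
Proof. exact: hom_neq0. Qed.

Lemma hX_ord rho (k : 'I_4) : hX rho k = hom_x (rho k).
Proof. by rewrite /hX inord_val. Qed.

Lemma hY_ord rho (k : 'I_4) : hY rho k = hom_y (rho k).
Proof. by rewrite /hY inord_val. Qed.

Local Notation T s rho := (Tpoly q (t0 * s / kai) (t0 * s * kai) x (hX rho) (hY rho)).

Lemma T_zeroE rho : T_zero q kappa t0 rho <-> T ka0 rho = 0.
Proof.
rewrite /T_zero; under [X in Thom _ _ _ X]eq_fun do rewrite -hX_ord.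
under [X in Thom _ _ _ _ X]eq_fun do rewrite -hY_ord.
rewrite Thom_Tpoly //; split=> [/eqP|->]; last by rewrite mulr0.
by rewrite mulf_eq0 oppr_eq0 !mulf_eq0 (negPf n0) (negPf nt) (negPf n1) (negPf ni) =>
  /eqP.
Qed.

Lemma T_hatE rho : T_zero q (hat kappa) t0 rho <-> T 1 rho = 0.
Proof.
rewrite /T_zero; under [X in Thom _ _ _ X]eq_fun do rewrite -hX_ord.
under [X in Thom _ _ _ _ X]eq_fun do rewrite -hY_ord.
rewrite Thom_Tpoly ?oner_neq0 //; split=> [/eqP|H]; last first.
  by rewrite -[X in _ * X = _]/(T 1 rho) H mulr0.
by rewrite mulf_eq0 oppr_eq0 !mulf_eq0 oner_eq0 (negPf nt) (negPf n1) (negPf ni) => /eqP.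
Qed.

Lemma T_symm rho : T ka0 rho = 0 -> T ka0^-1 rho = 0.
Proof.
have := Thom_symm q ka0 kat ka1 kai t0 (hX rho) (hY rho).
rewrite !Thom_Tpoly //.
move=> E H; move: E; rewrite -[X in _ = _ * X]/(T ka0 rho) H mulr0 => /eqP.
by rewrite mulf_eq0 oppr_eq0 !mulf_eq0 (negPf nV) (negPf nt) (negPf n1) (negPf ni) =>
  /eqP.
Qed.

(** Each monomial has two [X] and two [Y] with the four indices all occurring, so every term
    acquires the same factor $c^2l_0l_1l_2l_3$. *)
Lemma Tpoly_scale s c rho rho' : c != 0 -> (forall k, rho' k = scale_P1 c (rho k)) ->
  T s rho = 0 -> T s rho' = 0.
Proof.
move=> c0 Hr T0.
have /choice [l Hl] : forall k : nat, exists l, [/\ l != 0, hX rho' k = l * (c * hX rho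
  k) &
    hY rho' k = l * hY rho k].
  move=> k; have [l l0 [h1 h2]] := hom_scale (rho (inord k)) c0.
  by exists l; rewrite /hX /hY Hr h1 h2.
rewrite /Tpoly.
have E k : hX rho' k = l k * (c * hX rho k) by case: (Hl k).
have E' k : hY rho' k = l k * hY rho k by case: (Hl k).
transitivity (c ^+ 2 * (l 0%N * l 1%N * l 2%N * l 3%N) * T s rho); last by rewrite T0
  mulr0.
rewrite !E !E' /Tpoly; do 12! [move: (wr _ _ _ _) => ?].
do 4! [move: (hX _ _) => ?]; do 4! [move: (hY _ _) => ?].
by do 4! [move: (l _) => ?]; ring.
Qed.

Lemma rho_ell C (k i : nat) (k4 : (k < 4)%N) (i2 : 'I_2) : connection_matrix q kappa t0
  C ->
  ell x (hX (rho_of kappa t0 C)) (hY (rho_of kappa t0 C)) (entry C i2 0) (entry C i2 1)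
    k = 0.
Proof.
move=> hC; have [dC _] := connection_rank (Ordinal k4) hC.
have /is_column_ratioE /(_ i2) := column_ratioP dC.
rewrite /ell -[k]/(nat_of_ord (Ordinal k4)) hX_ord hY_ord /rho_of /entry -xpt_tnth => ->.
by rewrite subrr.
Qed.

Local Notation srow rho := (solution_row q t0 kai x (hX rho) (hY rho)).

Lemma connection_solution_rows C : connection_matrix q kappa t0 C ->
  srow (rho_of kappa t0 C) ka0 (entry C 0 0) (entry C 0 1) /\
  srow (rho_of kappa t0 C) ka0^-1 (entry C 1 0) (entry C 1 1).
Proof.
move=> hC; have /connection_matrixE [[h00 h01 h10 h11] _] := hC.
by split; split => // k k4; exact: rho_ell.
Qed.

Lemma wedge_nz f1 f2 g1 g2 z : z != 0 -> wedge f1 f2 g1 g2 z != 0 ->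
  (f1 z != 0) || (f2 z != 0).
Proof.
by move=> z0; apply: contraR; rewrite negb_or !negbK /wedge => /andP[/eqP -> /eqP ->];
  rewrite !mul0r subr0.
Qed.

Lemma rho_of_diag C C' : connection_matrix q kappa t0 C -> diag_equiv C C' ->
  scale_class (rho_of kappa t0 C) (rho_of kappa t0 C').
Proof.
move=> hC /diag_equivP [l [m [l0 m0 H]]].
have c0 : m 0 / m 1 != 0 by rewrite mulf_neq0 ?invr_neq0.
exists (m 0 / m 1) => // k; have [dC Ck] := connection_rank k hC.
have H' := H _ (xpt_neq0 k).
rewrite /rho_of -!xpt_tnth; apply: column_ratioE.
  apply: contra_neq Ck => C'k; apply/matrixP => i j; rewrite mxE.
  have := H' i j; rewrite C'k mxE => /esym/eqP.
  by rewrite !mulf_eq0 (negPf (l0 i)) (negPf (m0 j)) orbF => /eqP.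
have /is_column_ratioE E := column_ratioP dC.
have [u u0 [hx hy]] := hom_scale (column_ratio (C (x k))) c0.
apply/is_column_ratioE => i; rewrite hx hy !H'.
have -> : u * hom_y (column_ratio (C (x k))) * (l i * C (x k) i 0 * m 0) =
  u * l i * m 0 * (hom_y (column_ratio (C (x k))) * C (x k) i 0) by ring.
by rewrite E; field; exact: m0.
Qed.

Lemma Pmap_diag_class C : connection_matrix q kappa t0 C ->
  Pmap kappa t0 (diag_class C) = scale_class (rho_of kappa t0 C).
Proof.
move=> hC; apply/seteqP; split => [r [C' CC']|r Hr].
  by rewrite (scale_class_eq (rho_of_diag hC CC')).
by exists C => //; exact: diag_equiv_refl.
Qed.

Let a_neq0 s : s != 0 -> t0 * s / kai != 0.
Proof. by move=> s0; rewrite !mulf_neq0 ?invr_neq0. Qed.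

Let b_neq0 s : s != 0 -> t0 * s * kai != 0.
Proof. by move=> s0; rewrite !mulf_neq0. Qed.

Lemma surface_class kap rho : (forall c rho', c != 0 ->
    (forall k, rho' k = scale_P1 c (rho k)) -> T_zero q kap t0 rho' -> T_zero q kap t0
      rho) ->
  surface q kap t0 (scale_class rho) <-> T_zero q kap t0 rho.
Proof.
move=> inv; split=> [[rho' Tr E]|Tr]; last by exists rho.
have [c c0 Hc] : scale_class rho rho' by rewrite -E; exact: scale_class_refl.
exact: (inv c rho').
Qed.

Lemma scale_inv c rho rho' : c != 0 -> (forall k, rho' k = scale_P1 c (rho k)) ->
  forall k, rho k = scale_P1 c^-1 (rho' k).
Proof. by move=> c0 H k; rewrite H scale_P1M mulVf // scale_P1_1. Qed.

Lemma surface_kappaE rho : surface q kappa t0 (scale_class rho) <-> T ka0 rho = 0.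
Proof.
split=> [/surface_class H|/T_zeroE Tr]; last by exists rho.
apply/T_zeroE; apply: H => c rho' c0 Hc /T_zeroE Tr; apply/T_zeroE.
by apply: (Tpoly_scale _ (scale_inv c0 Hc) Tr); rewrite invr_neq0.
Qed.

Lemma surface_hatE rho : surface q (hat kappa) t0 (scale_class rho) <-> T 1 rho = 0.
Proof.
split=> [/surface_class H|/T_hatE Tr]; last by exists rho.
apply/T_hatE; apply: H => c rho' c0 Hc /T_hatE Tr; apply/T_hatE.
by apply: (Tpoly_scale _ (scale_inv c0 Hc) Tr); rewrite invr_neq0.
Qed.

Lemma surface_starE rho : surface_star q kappa t0 (scale_class rho) <->
  T ka0 rho = 0 /\ T 1 rho <> 0.
Proof.
rewrite /surface_star /curve; split.
  by move=> [/surface_kappaE H nc]; split => // /surface_hatE H1; apply: nc; split => //;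
    apply/surface_kappaE.
by move=> [H1 H2]; split; [apply/surface_kappaE|move=> [_ /surface_hatE]].
Qed.

Lemma connection_on_surface C : connection_matrix q kappa t0 C ->
  surface_star q kappa t0 (scale_class (rho_of kappa t0 C)).
Proof.
move=> hC; apply/surface_starE.
have [rf rg] := connection_solution_rows hC.
have /connection_matrixE [[h00 h01 _ _] [c c0 dE]] := hC.
split.
  have [z z0 Dz] := D_generic.
  have [_ _ fe] := rf.
  apply: (Tpoly_eq0 q0 q1 (a_neq0 n0) (b_neq0 n0) xpt_neq0 h00 h01 fe).
  exists z => //; apply: (@wedge_nz _ _ (entry C 1 0) (entry C 1 1)) => //.
  by rewrite dE // mulf_neq0.
exact/eqP/(T1_neq0 q0 q1 t00 ni xpt_neq0 xpt_distinct xpt_prod (hXY _) n0 sq0 rf rg c0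
  dE).
Qed.

Lemma connection_exists rho : T ka0 rho = 0 -> T 1 rho <> 0 ->
  exists2 C, connection_matrix q kappa t0 C & forall k, rho_of kappa t0 C k = rho k.
Proof.
move=> T0 /eqP T1.
have [f1 [f2 [f1t f2t fe [z z0 fz]]]] := row_exists q0 q1 (a_neq0 n0) (b_neq0 n0)
  xpt_neq0 T0.
have [g1 [g2 [g1t g2t ge [w w0 gw]]]] := row_exists q0 q1 (a_neq0 nV) (b_neq0 nV)
  xpt_neq0 (T_symm T0).
have rf : srow rho ka0 f1 f2 by split.
have rg : srow rho ka0^-1 g1 g2 by split.
have [c dE] := wedge_const q0 q1 ni xpt_neq0 xpt_distinct xpt_prod (hXY rho) rf rg
  (mulfV n0).
(* The only place in the construction where $T(\rho:\widehat\kappa,t_0)\ne0$ enters: it supplies the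
   dual rows that exclude parallel rows. *)
have c0 : c != 0.
  apply/eqP => c0.
  apply: (rows_not_parallel q0 q1 t00 ni xpt_neq0 xpt_distinct xpt_prod (hXY rho) sqi
    n0 sq0 rf rg) => //.
  - by case/orP: fz => h; [left|right]; exists z.
  - by case/orP: gw => h; [left|right]; exists w.
  by move=> u u0; rewrite dE // c0 mul0r.
pose C z : 'M[K]_2 := \matrix_(i, j) (if i == 0 then (if j == 0 then f1 z else f2 z)
   else (if j == 0 then g1 z else g2 z)).
have C00 : entry C 0 0 = f1 by apply/funext => u; rewrite /entry mxE.
have C01 : entry C 0 1 = f2 by apply/funext => u; rewrite /entry mxE.
have C10 : entry C 1 0 = g1 by apply/funext => u; rewrite /entry mxE.
have C11 : entry C 1 1 = g2 by apply/funext => u; rewrite /entry mxE.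
have hC : connection_matrix q kappa t0 C.
  apply/connection_matrixE; rewrite /rows_of C00 C01 C10 C11; split; first by split.
  by exists c.
exists C => // k; have [_ Ck] := connection_rank k hC.
rewrite /rho_of -xpt_tnth; apply: column_ratioE => //; apply/is_column_ratioE.
rewrite -hX_ord -hY_ord; apply: ord2P; apply/eqP; rewrite -subr_eq0; apply/eqP.
  by rewrite -[RHS](fe k (ltn_ord k)) /ell -C00 -C01.
by rewrite -[RHS](ge k (ltn_ord k)) /ell -C10 -C11.
Qed.

(* C' C^-1 is diagonal and constant: its entries are wedges divided by det C. *)
Lemma connection_unique C C' : connection_matrix q kappa t0 C ->
  connection_matrix q kappa t0 C' ->
  scale_class (rho_of kappa t0 C) (rho_of kappa t0 C') -> diag_equiv C C'.
Proof.
move=> hC hC' [c c0 Hc].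
have [rf rg] := connection_solution_rows hC.
have /connection_matrixE [_ [d d0 dE]] := hC.
have /connection_matrixE [[t00' t01' t10' t11'] [d' d'0 dE']] := hC'.
set rho := rho_of kappa t0 C in Hc rf rg.
(* Dividing the first column of [C'] by [c] gives it the same [rho] as [C], so that rows of both
   matrices solve the same systems. *)
have th2Z a f : theta2 q a f -> theta2 q a (fun z => c^-1 * f z).
  move=> tf; have := theta2_lin c^-1 0 tf tf.
  by congr theta2; apply/funext => z; rewrite mul0r addr0.
have ellZ (i : 'I_2) k : (k < 4)%N ->
    ell x (hX rho) (hY rho) (fun z => c^-1 * entry C' i 0 z) (entry C' i 1) k = 0.
  move=> k4; have := @rho_ell C' k 0 k4 i hC'; rewrite /ell /hX /hY Hc.
  have [u u0 [-> ->]] := hom_scale (rho (inord k)) c0.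
  move=> H; apply: (mulfI (mulf_neq0 u0 c0)); rewrite mulr0 -[RHS]H.
  by field; exact: c0.
have rf' : srow rho ka0 (fun z => c^-1 * entry C' 0 0 z) (entry C' 0 1).
  by split => //; [exact: th2Z|exact: ellZ].
have rg' : srow rho ka0^-1 (fun z => c^-1 * entry C' 1 0 z) (entry C' 1 1).
  by split => //; [exact: th2Z|exact: ellZ].
have sqV : ~ qZ q (ka0^-1 * ka0^-1).
  by move=> /qZV; rewrite invfM invrK -expr2.
have sq : ~ qZ q (ka0 * ka0) by rewrite -expr2.
have W00 := wedge_off q0 q1 t00 ni xpt_neq0 xpt_distinct xpt_prod (hXY rho) n0 n0 rf
  rf' sq.
have W11 := wedge_off q0 q1 t00 ni xpt_neq0 xpt_distinct xpt_prod (hXY rho) nV nV rg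
  rg' sqV.
have [b0 W01] := wedge_const q0 q1 ni xpt_neq0 xpt_distinct xpt_prod (hXY rho) rf' rg
  (mulfV n0).
have [b1 W10] := wedge_const q0 q1 ni xpt_neq0 xpt_distinct xpt_prod (hXY rho) rf rg'
  (mulfV n0).
have hol (i j : 'I_2) z : z != 0 -> holo_at (entry C' i j) z.
  by case: hC' => h _ _ z0; apply/holo_atP; exact: h.
have holC (i j : 'I_2) z : z != 0 -> holo_at (entry C i j) z.
  by case: hC => h _ _ z0; apply/holo_atP; exact: h.
have cancel (f g : K -> K) b : (forall z, z != 0 -> holo_at f z) -> (forall z, z != 0
  -> holo_at g z) ->
    (forall z, z != 0 -> f z * (d * D z) = g z * (b * D z)) ->
    forall z, z != 0 -> f z = b / d * g z.
  move=> hf hg E; apply: (theta_prod_cancel q0 q1 D_neq0 D_dist) => z z0.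
  - exact: holo_ccont (hf z z0).
  - exact: ccontM (@ccont_cst _ (b / d) z) (holo_ccont (hg z z0)).
  apply: (mulfI d0); rewrite mulrCA E //; field; exact: d0.
have holZ (i : 'I_2) z : z != 0 -> holo_at (fun w => c^-1 * entry C' i 0 w) z.
  by move=> z0; exact: (holoM (holo_cst c^-1 z) (hol i 0 z z0)).
(* Cramer's rule: for rows $f,g$ of [C] and $f'$ of the rescaled [C'], parallelism of $f$ and $f'$
   gives $f'_i(f\wedge g)=f_i(f'\wedge g)$, and both wedges are constant multiples of [D]. *)
have E00 : forall z, z != 0 -> c^-1 * entry C' 0 0 z = b0 / d * entry C 0 0 z.
  apply: (cancel _ _ b0 (holZ 0) (holC 0 0)) => z z0.
  rewrite -dE // -W01 //; have := W00 z z0; rewrite /wedge => /eqP; rewrite subr_eq0 =>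
    /eqP E.
  by rewrite !mulrBr [_ * (entry C 0 1 z * _)]mulrA [_ * entry C 0 1 z]mulrC -E; ring.
have E01 : forall z, z != 0 -> entry C' 0 1 z = b0 / d * entry C 0 1 z.
  apply: (cancel _ _ b0 (hol 0 1) (holC 0 1)) => z z0.
  rewrite -dE // -W01 //; have := W00 z z0; rewrite /wedge => /eqP; rewrite subr_eq0 =>
    /eqP E.
  by rewrite !mulrBr [_ * (entry C 0 0 z * _)]mulrA [_ * entry C 0 0 z]mulrC E; ring.
have E10 : forall z, z != 0 -> c^-1 * entry C' 1 0 z = b1 / d * entry C 1 0 z.
  apply: (cancel _ _ b1 (holZ 1) (holC 1 0)) => z z0.
  rewrite -dE // -W10 //; have := W11 z z0; rewrite /wedge => /eqP; rewrite subr_eq0 =>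
    /eqP E.
  have -> : entry C 1 0 z * (entry C 0 0 z * entry C' 1 1 z - entry C 0 1 z * (c^-1 *
    entry C' 1 0 z)) =
     entry C 0 0 z * (entry C 1 0 z * entry C' 1 1 z) - entry C 0 1 z * entry C 1 0 z *
       (c^-1 * entry C' 1 0 z).
    by ring.
  by rewrite E; ring.
have E11 : forall z, z != 0 -> entry C' 1 1 z = b1 / d * entry C 1 1 z.
  apply: (cancel _ _ b1 (hol 1 1) (holC 1 1)) => z z0.
  rewrite -dE // -W10 //; have := W11 z z0; rewrite /wedge => /eqP; rewrite subr_eq0 =>
    /eqP E.
  have -> : entry C 1 1 z * (entry C 0 0 z * entry C' 1 1 z - entry C 0 1 z * (c^-1 *
    entry C' 1 0 z)) =
     entry C 0 0 z * entry C 1 1 z * entry C' 1 1 z - entry C 0 1 z * (entry C 1 1 z *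
       (c^-1 * entry C' 1 0 z)).
    by ring.
  by rewrite -E; ring.
have [z z0 Dz] := D_generic.
have dz : wedge (entry C' 0 0) (entry C' 0 1) (entry C' 1 0) (entry C' 1 1) z != 0.
  by rewrite dE' // mulf_neq0.
have F0 : (entry C' 0 0 z != 0) || (entry C' 0 1 z != 0) by exact: wedge_nz dz.
have F1 : (entry C' 1 0 z != 0) || (entry C' 1 1 z != 0).
  apply: contraNT dz; rewrite negb_or !negbK /wedge => /andP[/eqP -> /eqP ->].
  by rewrite !mulr0 subr0.
have b00 : b0 != 0.
  apply: contraTneq F0 => b00; have := E00 z z0; rewrite E01 // b00 !mul0r eqxx orbF
    negbK.
  by move/eqP; rewrite mulf_eq0 invr_eq0 (negPf c0).
have b10 : b1 != 0.
  apply: contraTneq F1 => b10; have := E10 z z0; rewrite E11 // b10 !mul0r eqxx orbF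
    negbK.
  by move/eqP; rewrite mulf_eq0 invr_eq0 (negPf c0).
apply/diag_equivP.
(* The left factors are the ratios of wedges; the right factor [(c, 1)] undoes the rescaling of the
   first column. *)
exists (fun i => if i == 0 then b0 / d else b1 / d), (fun j => if j == 0 then c else
  1); split.
- by apply: ord2P => /=; rewrite mulf_neq0 ?invr_neq0.
- by apply: ord2P => /=; rewrite ?oner_neq0.
move=> u u0; apply: ord2P; apply: ord2P => /=; rewrite ?mulr1.
- by rewrite -[_ * C u 0 0]E00 // mulrC mulVKf.
- exact: E01.
- by rewrite -[_ * C u 1 0]E10 // mulrC mulVKf.
exact: E11.
Qed.

Lemma Pmap_bij :
  set_bij (monodromy_manifold q kappa t0) (surface_star q kappa t0) (Pmap kappa t0).
Proof.
split.
- by move=> _ [C hC <-]; rewrite Pmap_diag_class //; exact: connection_on_surface.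
- move=> X X' /set_mem [C hC <-] /set_mem [C' hC' <-]; rewrite !Pmap_diag_class // => E.
  apply/diag_class_eq/connection_unique => //.
  by rewrite E; exact: scale_class_refl.
move=> S SS; have [[rho _ rE] _] := SS; move: SS; rewrite -rE.
move=> /surface_starE [T0 T1]; have [C hC Cr] := connection_exists T0 T1.
exists (diag_class C); first by exists C.
rewrite Pmap_diag_class //; congr scale_class; exact/funext.
Qed.

End Monodromy.

Theorem theorem2p15 (R : realType) (q : R[i]) (kappa : params R[i]) (t0 : R[i])
    (hq0 : 0 < `|q|) (hq1 : `|q| < 1)
    (hk0 : k0 kappa != 0) (hkt : kt kappa != 0)
    (hk1 : k1 kappa != 0) (hkinf : kinf kappa != 0) (ht0 : t0 != 0)
    (hres : nonresonant q kappa t0) :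
  [/\ (* Pmap is the map [C] |-> [rho] *)
      forall C, connection_matrix q kappa t0 C ->
        Pmap kappa t0 (diag_class C) = scale_class (rho_of kappa t0 C),
      Pmap kappa t0 @` monodromy_manifold q kappa t0 =
        surface q kappa t0 `\` curve q kappa t0 &
      set_bij (monodromy_manifold q kappa t0) (surface_star q kappa t0)
        (Pmap kappa t0)].
Proof.
have q0 : q != 0 by rewrite -normr_gt0.
have q1 : normc q < 1 by rewrite -ltcR -normC_normc.
case: kappa hk0 hkt hk1 hkinf hres => a0 at_ a1 ai /= n0 nt n1 ni hres.
have bij := Pmap_bij q0 q1 n0 nt n1 ni ht0 hres.
split => //; first by move=> C; exact: Pmap_diag_class.
case: bij => F _ S; apply/seteqP; split; last exact: S.
by move=> _ [X XM <-]; exact: F.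
Qed.
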